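(* Let $\sigma:A\to A^+$ be a substitution of some primitive components with $n_\sigma\ge2$, and let $$X_\sigma=\bigcup_{i=1}^{n_\sigma}X_i\cup\bigcup_{i=2}^{n_\sigma}\mathrm{Orb}_{T_\sigma}(y_i)\cup\bigcup_{i=2}^{n_\sigma}\bigcup_{j=1}^{N_i}\mathrm{Orb}_{T_\sigma}(x_{ij})$$ be the decomposition of $X_\sigma$ described in the context. Then: (1) The counting measure on each $\mathrm{Orb}_{T_\sigma}(x_{ij})$ is ergodic. This measure is finite if and only if the point $x_{ij}$ is a fixed point of $T_\sigma$. (2) The counting measure on each $\mathrm{Orb}_{T_\sigma}(y_i)$ is an ergodic, infinite measure. (3) If $X_i\ne\emptyset$, then a ($T_\sigma$-)invariant (nonzero) Radon measure on $X_i$, provided with the relative topology, is unique up to scaling, and ergodic. This measure is finite if $\theta_i>\lambda_{i-1}$, and infinite if $\theta_i\le\lambda_{i-1}$.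
   Context: $\mathbb N=\{1,2,\dots\}$. $A$ is a finite alphabet with at least two letters, $A^+$ the set of nonempty finite words over $A$. A substitution is a map $\sigma:A\to A^+$, extended to $A^+$ and to $A^{\mathbb Z}$ by concatenation ($\sigma(x)=\dots\sigma(x_{-1}).\sigma(x_0)\sigma(x_1)\dots$, the dot being placed just before coordinate $0$). $\mathcal L(\sigma)$ is the set of all factors of words $\sigma^n(a)$, $n\in\mathbb N$, $a\in A$. $X_\sigma=\{x\in A^{\mathbb Z}: x_{-i}\dots x_i\in\mathcal L(\sigma)\text{ for all }i\in\mathbb N\}$, $T_\sigma$ is the left shift on $X_\sigma$, $\mathrm{Orb}_{T_\sigma}(x)=\{T_\sigma^n x:n\in\mathbb Z\}$. A Radon measure on a locally compact metric space is a positive measure that is finite on compact sets. $\sigma$ is of some primitive components (of $n$ primitive components; $n_\sigma:=n$) if there is a chain $\emptyset\ne A_1\subsetneq\dots\subsetneq A_n=A$ such that, with $A_0=\emptyset$: (1) for $1\le i\le n$, $\sigma(a)\in A_i^+$ if $a\in A_i$; (2) there is $k\in\mathbb N$ such that for any $1\le i\le n$, any $a\in A_i\setminus A_{i-1}$ and any $b\in A_i$, the letter $b$ occurs in $\sigma^k(a)$. For $1\le i\le n_\sigma$, $\sigma_i:A_i\to A_i^+$ is the restriction of $\sigma$, with associated subshift $X_{\sigma_i}$; $X_{\sigma_0}=\emptyset$. One has $X_{\sigma_1}\subset\dots\subset X_{\sigma_{n_\sigma}}=X_\sigma$. $\theta_i$ is the dominant (Perron--Frobenius) eigenvalue of the primitive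 matrix $Q_i$ indexed by $A_i\setminus A_{i-1}$ whose $(a,b)$-entry is the number of occurrences of $b$ in $\sigma(a)$. $\lambda_i=\max_{1\le j\le i}\theta_j$ for $i\ge1$, and $\lambda_0=0$. Quasi-periodic points: let $1<i\le n_\sigma$. If $a\in A_{i-1}$, $b\in A_i\setminus A_{i-1}$, $u\in A_{i-1}^+$, $v\in A_i^+$ satisfy $ab\in\mathcal L(\sigma_i)$ and $\sigma(ab)=uabv$, the point $\omega=\dots\sigma^2(u)\sigma(u)ua.bv\sigma(v)\sigma^2(v)\dots$ is a quasi-fixed point of $\sigma$; symmetrically, if $ba\in\mathcal L(\sigma_i)$ and $\sigma(ba)=vbau$, then $\omega=\dots\sigma^2(v)\sigma(v)v.bau\sigma(u)\sigma^2(u)\dots$ is a quasi-fixed point. A quasi-fixed point of a power $\sigma^k$ is a quasi-periodic point of $\sigma$. A quasi-periodic point $x\in X_{\sigma_i}\setminus X_{\sigma_{i-1}}$ is of a primitive type if for $k\in\mathbb Z$: $x_k\in A_i\setminus A_{i-1}$ iff $k=0$. The decomposition: for each $1\le i\le n_\sigma$, $X_{\sigma_i}\setminus X_{\sigma_{i-1}}=X_i\cup\mathrm{Orb}_{T_\sigma}(y_i)\cup\bigcup_{j=1}^{N_i}\mathrm{Orb}_{T_\sigma}(x_{ij})$ is a disjoint union of possibly empty, locally compact, $T_\sigma$-invariant sets (the points $y_i,x_{ij}$ may fail to exist, and do not occur for $i=1$, so $X_1=X_{\sigma_1}$) such that: if $X_i\neq\emptyset$ then $X_i=X_{\sigma_i}\setminus(X_{\sigma_{i-1}}\cup\bigcup_{j}\mathrm{Orb}_{T_\sigma}(x_{ij}))$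 and the orbit of every point of $X_i$ is dense in $X_{\sigma_i}$; each existing $y_i$ is a quasi-periodic point of a primitive type; each $x_{ij}$ is a periodic point of $\sigma$ (i.e. $\sigma^k(x_{ij})=x_{ij}$ for some $k\in\mathbb N$), and if it is periodic under $T_\sigma$ then $A_1$ is a singleton $\{s\}$ and $x_{ij}=s^\infty$ (the constant sequence).
   Formalization: The decomposition is also required to have no T_σ-fixed point in X_i for i ≥ 2; otherwise σ(s)=s, σ(b)=bs allows X_2={s^∞}, N_2=0, where θ_2=λ_1=1 but the invariant measure is finite, against (3). *)

(* Defs.v *)
(* MathComp / MathComp-Analysis *)
From HB Require Import structures.
From mathcomp Require Import all_boot all_order all_algebra.
From mathcomp Require Import complex.
From mathcomp Require Import all_classical all_reals all_analysis.

Set Implicit Arguments.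
Unset Strict Implicit.
Unset Printing Implicit Defensive.

Import Order.TTheory GRing.Theory Num.Theory.
Import numFieldNormedType.Exports.

Local Open Scope classical_set_scope.
Local Open Scope ring_scope.

Definition fullshift (A : finType) : topologicalType :=
  {ptws int -> discrete_topology A}.

Section Words.
Variable A : finType.
Implicit Types (sigma : A -> seq A) (B : {set A}) (w : seq A).

Definition substitution sigma : Prop := forall a, sigma a != [::].

(* [w \in B^+] *)
Definition word_on B w : bool := (w != [::]) && all (mem B) w.

Definition subst_word sigma w : seq A := flatten (map sigma w).

Definition subst_pow sigma (k : nat) : A -> seq A :=
  fun a => iter k (subst_word sigma) [:: a].

(* When [sigma] maps [B] to [B^+], this is the language of its restriction
   to [B]. *)
Definition lang sigma B : set (seq A) :=
  [set w | exists n a, [/\ (0 < n)%N, a \in B & infix w (subst_pow sigma n a)]].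

(* The two-sided sequence  ... l 2 l 1 l 0 . r 0 r 1 r 2 ...  with the dot just
   before coordinate 0; when all [l j] and [r j] are nonempty, the letter [d]
   is irrelevant and the first [m.+1] words suffice to read the [m]-th letter
   on either side. *)
Definition biconcat (d : A) (l r : nat -> seq A) : fullshift A :=
  fun k : int => match k with
  | Posz m => nth d (flatten [seq r j | j <- iota 0 m.+1]) m
  | Negz m => nth d (flatten [seq rev (l j) | j <- iota 0 m.+1]) m
  end.

Definition subst_bi sigma (x : fullshift A) : fullshift A :=
  biconcat (x 0) (fun j => sigma (x (Negz j))) (fun j => sigma (x (Posz j))).

Definition Tshift (x : fullshift A) : fullshift A := fun k : int => x (k + 1).

Definition Torbit (x : fullshift A) : set (fullshift A) :=
  [set z | exists m : int, z = (fun k : int => x (k + m)) :> fullshift A].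

Definition window (x : fullshift A) (i : nat) : seq A :=
  [seq (x (k%:Z - i%:Z) : A) | k <- iota 0 i.*2.+1].

Definition subshift sigma B : set (fullshift A) :=
  [set x | forall i : nat, (0 < i)%N -> lang sigma B (window x i)].

End Words.

Section PrimitiveComponents.
Variables (A : finType) (sigma : A -> seq A) (n : nat) (Ac : nat -> {set A}).

Record primitive_components : Prop := PrimitiveComponents {
  pc_bottom : Ac 0 = finset.set0 ;
  pc_first : Ac 1 != finset.set0 ;
  pc_chain : forall i, (1 <= i < n)%N -> Ac i \proper Ac i.+1 ;
  pc_top : Ac n = [set: A]%SET ;
  pc_stable : forall i a, (1 <= i <= n)%N -> a \in Ac i ->
    word_on (Ac i) (sigma a) ;
  pc_primitive : exists2 k, (0 < k)%N &
    forall i a b, (1 <= i <= n)%N -> a \in (Ac i :\: Ac i.-1)%SET ->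
      b \in Ac i -> b \in subst_pow sigma k a
}.

(* X_(sigma_i); it is empty for i = 0 since [Ac 0] is. *)
Definition subshift_at (i : nat) : set (fullshift A) := subshift sigma (Ac i).

Definition comp_matrix (R : realType) (i : nat) :
    'M[R]_(#|(Ac i :\: Ac i.-1)%SET|) :=
  \matrix_(p, q) (count_mem (enum_val q) (sigma (enum_val p)))%:R.

Definition dominant_eigenvalue (R : realType) (m : nat) (Q : 'M[R]_m) (t : R) :
    Prop :=
  [/\ 0 < t, eigenvalue Q t &
    forall z : R[i], eigenvalue (map_mx (real_complex R) Q) z ->
      z != t%:C%C -> `|z| < t%:C%C].

Definition theta (R : realType) (i : nat) : R :=
  xget 0 [set t | dominant_eigenvalue (comp_matrix R i) t].

Definition lambda_max (R : realType) (i : nat) : R :=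
  \big[Num.max/0]_(1 <= j < i.+1) theta R j.

End PrimitiveComponents.

Section QuasiPeriodic.
Variables (A : finType) (sigma : A -> seq A) (n : nat) (Ac : nat -> {set A}).

Definition quasi_fixed (tau : A -> seq A) (i : nat) (w : fullshift A) : Prop :=
  exists (a b : A) (u v : seq A),
    [/\ a \in Ac i.-1, b \in (Ac i :\: Ac i.-1)%SET,
        word_on (Ac i.-1) u, word_on (Ac i) v &
      [/\ lang tau (Ac i) [:: a; b],
          subst_word tau [:: a; b] = u ++ [:: a; b] ++ v &
          w = biconcat a
                (fun j => if j is j'.+1
                          then iter j' (subst_word tau) u else [:: a])
                (fun j => if j is j'.+1
                          then iter j' (subst_word tau) v else [:: b])]
      \/
      [/\ lang tau (Ac i) [:: b; a],
          subst_word tau [:: b; a] = v ++ [:: b; a] ++ u &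
          w = biconcat a
                (fun j => iter j (subst_word tau) v)
                (fun j => if j is j'.+1
                          then iter j' (subst_word tau) u else [:: b; a])]].

Definition quasi_periodic (w : fullshift A) : Prop :=
  exists k i, [/\ (0 < k)%N, (1 < i <= n)%N &
    quasi_fixed (subst_pow sigma k) i w].

Definition quasi_periodic_primitive_type (i : nat) (w : fullshift A) : Prop :=
  [/\ quasi_periodic w,
      (subshift_at sigma Ac i `\` subshift_at sigma Ac i.-1) w &
      forall k : int, (w k : A) \in (Ac i :\: Ac i.-1)%SET <-> k = 0].

End QuasiPeriodic.

Section Decomposition.
Variables (A : finType) (sigma : A -> seq A) (n : nat) (Ac : nat -> {set A}).
Variables (X : nat -> set (fullshift A)) (y : nat -> option (fullshift A)).
Variables (N : nat -> nat) (x : nat -> nat -> fullshift A).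

Definition opt_orbit (o : option (fullshift A)) : set (fullshift A) :=
  if o is Some q then Torbit q else set0.

Definition x_orbits (i : nat) : set (fullshift A) :=
  \bigcup_(j in [set j | (1 <= j <= N i)%N]) Torbit (x i j).

Local Notation XS := (subshift_at sigma Ac).

Record decomposition : Prop := Decomposition {
  dec_cover : forall i, (1 <= i <= n)%N ->
    XS i `\` XS i.-1 = X i `|` opt_orbit (y i) `|` x_orbits i ;
  dec_disjXy : forall i, (1 <= i <= n)%N -> X i `&` opt_orbit (y i) = set0 ;
  dec_disjXx : forall i, (1 <= i <= n)%N -> X i `&` x_orbits i = set0 ;
  dec_disjyx : forall i, (1 <= i <= n)%N ->
    opt_orbit (y i) `&` x_orbits i = set0 ;
  dec_disjxx : forall i j k, (1 <= i <= n)%N -> (1 <= j <= N i)%N ->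
    (1 <= k <= N i)%N -> j <> k -> Torbit (x i j) `&` Torbit (x i k) = set0 ;
  (* local compactness of the subtypes, i.e. in the relative topology *)
  dec_lcX : forall i, (1 <= i <= n)%N -> locally_compact [set: X i] ;
  dec_lcy : forall i, (1 <= i <= n)%N ->
    locally_compact [set: opt_orbit (y i)] ;
  dec_lcx : forall i j, (1 <= i <= n)%N -> (1 <= j <= N i)%N ->
    locally_compact [set: Torbit (x i j)] ;
  dec_invX : forall i, (1 <= i <= n)%N -> @Tshift A @` X i = X i ;
  dec_y1 : y 1 = None ;
  dec_N1 : N 1 = 0%N ;
  dec_X : forall i, (1 <= i <= n)%N -> X i !=set0 ->
    X i = XS i `\` (XS i.-1 `|` x_orbits i) /\
    (forall z, X i z -> XS i `<=` closure (Torbit z)) ;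
  dec_y : forall i q, (1 <= i <= n)%N -> y i = Some q ->
    quasi_periodic_primitive_type sigma n Ac i q ;
  dec_x : forall i j, (1 <= i <= n)%N -> (1 <= j <= N i)%N ->
    (exists2 k, (0 < k)%N & iter k (subst_bi sigma) (x i j) = x i j) /\
    ((exists2 k, (0 < k)%N & iter k (@Tshift A) (x i j) = x i j) ->
      exists s, Ac 1 = [set s]%SET /\ x i j = (fun _ : int => s)) ;
  (* A fixed point of the shift lying above the first level is listed among
     the [x i j].  The clauses above leave one ambiguity: for s -> s and
     b -> bs one has X_(sigma_1) = set0 and X_(sigma_2) = {s^oo}, and they
     allow both X_2 = set0, x_21 = s^oo and X_2 = {s^oo}, N_2 = 0.  Only the
     former is meant: with the latter, X_2 has a finite invariant measure
     although theta_2 = lambda_1 = 1. *)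
  dec_fixed : forall i z, (2 <= i <= n)%N -> X i z -> Tshift z <> z
}.

End Decomposition.

(* Measurable types must be pointed, so a space [T] gets its Borel structure
   relative to a point [p] of [T]; [p] plays no other role. *)
Definition based (T : Type) (p : T) : Type := T.

HB.instance Definition _ (T : topologicalType) (p : T) :=
  Topological.copy (based p) T.
HB.instance Definition _ (T : topologicalType) (p : T) :=
  isPointed.Build (based p) p.

Definition borel (T : topologicalType) (p : T) :=
  g_sigma_algebraType (@open (based p)).

Section Measures.
Local Open Scope ereal_scope.
Variables (R : realType) (T : topologicalType) (p : T).
Implicit Types (mu : {measure set (borel p) -> \bar R}) (f : T -> T).

Definition radon mu : Prop := forall K : set T, compact K -> mu K < +oo.

Definition invariant_measure f mu : Prop :=
  forall B : set (borel p), measurable B -> mu (f @^-1` B) = mu B.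

Definition ergodic f mu : Prop := invariant_measure f mu /\
  forall B : set (borel p), measurable B -> f @^-1` B = B ->
    mu B = 0 \/ mu (~` B) = 0.

Definition counting_measure : {measure set (borel p) -> \bar R} :=
  @counting (borel p) R.

Definition nonzero_invariant_radon f mu : Prop :=
  [/\ invariant_measure f mu, radon mu & mu [set: borel p] != 0].

End Measures.

(* The shift on a subset [Y]; the default value [z] of [insubd] is not used
   when [Y] is shift-invariant. *)
Definition Tshift_on (A : finType) (Y : set (fullshift A)) (z : Y) : Y :=
  insubd z (Tshift (\val z)).

Lemma Torbit_refl (A : finType) (x : fullshift A) : x \in Torbit x.
Proof. by apply/mem_set; exists 0; apply/funext => k; rewrite addr0. Qed.

Definition Torbit_base (A : finType) (x : fullshift A) : Torbit x :=
  exist _ x (Torbit_refl x).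

(* Main.v *)
(** The new letters of level [i] are D = A_i \ A_(i-1); N_D(w) is the number of
    occurrences of letters of D in w.  By primitivity, either N_D(sigma^k a) >= 2
    for all a in D, or D = {b} and b occurs once in sigma(b).

    In the first case X_i is the set of points of X_(sigma_i) containing a letter
    of D: it is open in X_(sigma_i), being dense and locally compact.  Every compact
    open subset S of X_i is visited by all points with a frequency f(S) relative to
    the visits to [D]; by a contraction argument for the ratios of occurrences in
    sigma^m(a) this frequency is uniform.  The map f is a content on compact open
    sets, sigma-additive by compactness, and extends to an invariant Radon measure
    with mu[D] = 1; integrating the uniform estimates shows nu(S) = f(S) nu[D] for
    every invariant Radon measure nu, whence uniqueness and ergodicity.  The total
    mass is finite iff |sigma^m(b)| / N_D(sigma^m(b)) is bounded, which is decided
    by weights built from Perron-Frobenius eigenvectors.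

    In the second case theta_i = 1 <= lambda_(i-1), and X_i is a single infinite
    orbit, all of whose points are isolated in X_i: either b, or some word outside
    L(sigma_(i-1)), occurs in such a point only at bounded mutual distances.  The
    invariant Radon measures on X_i are then the multiples of counting measure. *)

(* When the invariant measure of [X_i] is infinite, the frequency of a compact open set per unit of
   length vanishes; hence the normalisation by visits to D. Its price is an additive error at the
   ends of every segment, and such a constant cannot be integrated over a space of infinite measure.
   It is therefore charged only to the points that see a letter of D in the segment. Their measure
   is small compared with the length of the segment times nu[D], because a letter of D has many
   others at bounded distance. This is what the growth condition of the first case provides; a
   single letter b that never multiplies has no such neighbours, and counting measure on an isolated
   orbit takes over.

   The set [X_i] is known only as a complement of orbits in which every orbit is dense. Local
   compactness is the property that turns this into a description by letters. The contraction
   argument for the ratios, with error zero, also yields the Perron-Frobenius theory. *)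
Require Import Defs.
From HB Require Import structures.
From mathcomp Require Import all_boot all_order all_algebra.
From mathcomp Require Import all_classical all_reals all_analysis.
From mathcomp Require Import complex zify ring lra.

Import Order.TTheory GRing.Theory Num.Theory.
Import numFieldNormedType.Exports.
Local Open Scope classical_set_scope.
Local Open Scope ring_scope.

Set Implicit Arguments.
Unset Strict Implicit.
Unset Printing Implicit Defensive.

(** * Iterates of a substitution and its language *)

Section WordGeneralities.
Variables S T : eqType.
Implicit Types (f : S -> seq T) (t v : seq S) (s w x y : seq T).

Lemma cat_eq_split s1 s2 w1 w2 : s1 ++ s2 = w1 ++ w2 ->
  (size w1 <= size s1)%N ->
  s1 = w1 ++ drop (size w1) s1 :> seq T /\ w2 = drop (size w1) s1 ++ s2.
Proof.
move=> e le.
have e1 : take (size w1) s1 = w1.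
  by rewrite -(takel_cat s2 le) e take_size_cat.
split; first by rewrite -[in LHS](cat_take_drop (size w1) s1) e1.
have := e; rewrite -[X in X ++ s2 = _](cat_take_drop (size w1) s1) e1 -catA.
by move/eqP; rewrite eqseq_cat // => /andP[_ /eqP].
Qed.

Lemma prefix_flatten_map f t w s' M :
    {in t, forall a, (size (f a) <= M)%N} ->
    flatten (map f t) = w ++ s' ->
  exists v y, [/\ w = flatten (map f v) ++ y, prefix v t & (size y <= M)%N].
Proof.
elim: t w => [|a t IH] w hM e; rewrite /= in e.
  by exists [::], [::]; split => //; case: w e.
have [le|lt] := leqP (size (f a)) (size w); last first.
  exists [::], w; split => //.
  exact: leq_trans (ltnW lt) (hM _ (mem_head _ _)).
have [e1 e2] := cat_eq_split (esym e) le.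
have [|v0 [y0 [ev0 pv0 ly0]]] := IH _ _ e2.
  by move=> c ct; apply: hM; rewrite inE ct orbT.
exists (a :: v0), y0; split => //=; last by rewrite eqxx.
by rewrite {1}e1 ev0 catA.
Qed.

(** The factor is cut at block boundaries; one that is interior to a single block goes entirely into
    [x]. *)
Lemma infix_flatten_map f t w M :
    {in t, forall a, (size (f a) <= M)%N} -> infix w (flatten (map f t)) ->
  exists x v y, [/\ w = x ++ flatten (map f v) ++ y, infix v t,
    (size x <= M)%N & (size y <= M)%N].
Proof.
move=> hM /infixP[s [s' e]]; elim: t s hM e => [|a t IH] s hM e; rewrite /= in e.
  case: s w e => [|//] [|//] _.
  by exists [::], [::], [::].
have hM' : {in t, forall a, (size (f a) <= M)%N}.
  by move=> b bt; apply: hM; rewrite inE bt orbT.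
have hMa := hM _ (mem_head _ _).
have [le|lt] := leqP (size (f a)) (size s).
  have [_ e2] := cat_eq_split (esym e) le.
  have [x [v [y [-> vt lx ly]]]] := IH _ hM' e2.
  by exists x, v, y; split => //; apply: infix_trans vt (suffix_infix [:: a] t).
have [e1 e2] := cat_eq_split e (ltnW lt).
set f2 := drop (size s) (f a) in e1 e2.
have lf2 : (size f2 <= M)%N by rewrite size_drop (leq_trans (leq_subr _ _)).
have [le|lt2] := leqP (size f2) (size w); last first.
  exists w, [::], [::]; split; rewrite /= ?cats0 //.
  exact: leq_trans (ltnW lt2) lf2.
have [e3 e4] := cat_eq_split e2 le.
have [v [y [ev vt ly]]] := prefix_flatten_map hM' e4.
exists f2, v, y; split => //; first by rewrite {1}e3 ev.
by apply: infix_trans (prefixW vt) (suffix_infix [:: a] t).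
Qed.

Lemma flatten_map_split f t x d y : flatten (map f t) = x ++ d :: y ->
  exists t1 b t2 e1 e2, [/\ t = t1 ++ b :: t2, f b = e1 ++ d :: e2,
    x = flatten (map f t1) ++ e1 & y = e2 ++ flatten (map f t2)].
Proof.
elim: t x => [|a t IH] x /= e; first by case: x e.
have [le|lt] := leqP (size (f a)) (size x).
  have [e1 e2] := cat_eq_split (esym e) le.
  have [t1 [b [t2 [c1 [c2 [-> efb ex ->]]]]]] := IH _ e2.
  exists (a :: t1), b, t2, c1, c2; split => //=.
  by rewrite {1}e1 ex catA.
have [e1 e2] := cat_eq_split e (ltnW lt).
move: e1 e2; case ed : (drop (size x) (f a)) => [|c l].
  by move=> /(congr1 size); rewrite cats0 => ea; rewrite ea ltnn in lt.
move=> e1 [ec ey]; exists [::], a, t, x, l; split => //.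
by rewrite ec.
Qed.

End WordGeneralities.

Lemma sum_count (A : finType) (V : nmodType) (F : A -> V) (u : seq A) :
  \sum_(a <- u) F a = \sum_a F a *+ count_mem a u.
Proof.
elim: u => [|b u IH]; first by rewrite big_nil big1.
rewrite big_cons IH (bigD1 b) //= [RHS](bigD1 b) //= eqxx mulrnDr mulr1n addrA.
by congr (_ + _); apply: eq_bigr => a /negPf; rewrite eq_sym => ->.
Qed.

Section Iterates.
Variables (A : finType) (sigma : A -> seq A).
Implicit Types (u v w : seq A) (a b : A) (m n : nat).
Local Notation sw n := (iter n (subst_word sigma)).
Local Notation sp n := (subst_pow sigma n).

Lemma sw_cat n u v : sw n (u ++ v) = sw n u ++ sw n v.
Proof. by elim: n => //= n ->; rewrite /subst_word map_cat flatten_cat. Qed.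

Lemma swE n u : sw n u = flatten (map (sp n) u).
Proof.
elim: u => [|a u IH] /=; first by elim: n => //= n ->.
by rewrite -IH -sw_cat.
Qed.

Lemma spD m n a : sp (m + n) a = sw m (sp n a).
Proof. by rewrite /subst_pow iterD. Qed.

Lemma mem_sw n u a b : a \in u -> b \in sp n a -> b \in sw n u.
Proof. by move=> au ba; rewrite swE; apply/flatten_mapP; exists a. Qed.

Lemma infix_sp_sw n u a : a \in u -> infix (sp n a) (sw n u).
Proof.
by move=> /splitPr[p q]; rewrite -cat1s !sw_cat; exact: infix_infix.
Qed.

Lemma big_sw (V : nmodType) (W : A -> V) n u :
  \sum_(a <- sw n u) W a = \sum_(a <- u) \sum_(b <- sp n a) W b.
Proof. by rewrite swE big_flatten big_map. Qed.

Lemma count_sw (P : pred A) n u :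
  count P (sw n u) = \sum_(a <- u) count P (sp n a).
Proof. by rewrite swE count_flatten sumnE !big_map. Qed.

(** The maximum runs over all orders up to [m]: a word that comes from an iterate of order below [m]
    is then short as a whole and can be treated as a remainder. *)
Definition maxlen m := (\max_(j < m.+1) \max_a size (sp j a))%N.

Lemma leq_maxlen j m a : (j <= m)%N -> (size (sp j a) <= maxlen m)%N.
Proof.
rewrite -ltnS => jm; apply: leq_trans (leq_bigmax (Ordinal jm)).
exact: (leq_bigmax a).
Qed.

End Iterates.

Section Level.
Variables (A : finType) (sigma : A -> seq A) (B C : {set A}) (k : nat).
Local Notation D := (B :\: C)%SET.
Local Notation sw n := (iter n (subst_word sigma)).
Local Notation sp n := (subst_pow sigma n).
Local Notation nD := (count (mem D)).
Local Notation L := (lang sigma B).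
Hypothesis sB : forall a, a \in B -> word_on B (sigma a).
Implicit Types (u v w : seq A) (a b : A) (m n : nat).

Lemma sw_all n u : all (mem B) u -> all (mem B) (sw n u).
Proof.
elim: n => //= n IH /IH; set w := sw n u => hw.
apply/allP => b /flatten_mapP[a aw ba].
by have /andP[_ /allP] := sB (allP hw a aw); exact.
Qed.

Lemma sp_all n a : a \in B -> all (mem B) (sp n a).
Proof. by move=> aB; apply: sw_all; rewrite /= aB. Qed.

Lemma subst_word_size u : all (mem B) u ->
  (size u <= size (subst_word sigma u))%N.
Proof.
elim: u => //= a u IH /andP[aB uB]; rewrite /subst_word /= size_cat.
by rewrite -add1n leq_add ?IH // lt0n size_eq0; have /andP[] := sB aB.
Qed.

Lemma sw_size n u : all (mem B) u -> (size u <= size (sw n u))%N.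
Proof.
move=> uB; elim: n => //= n IH; apply: leq_trans IH _.
exact/subst_word_size/sw_all.
Qed.

Lemma sp_size_gt0 n a : a \in B -> (0 < size (sp n a))%N.
Proof. by move=> aB; have := @sw_size n [:: a]; rewrite /= aB; exact. Qed.

Lemma lang_infix u v : infix u v -> L v -> L u.
Proof.
by move=> uv [n [a [n0 aB va]]]; exists n, a; split=> //; exact: infix_trans va.
Qed.

Lemma lang_all w : L w -> all (mem B) w.
Proof.
move=> [n [a [_ aB /infixP[p [q e]]]]].
by have := sp_all n aB; rewrite e !all_cat => /and3P[].
Qed.

Lemma lang_sp n a : (0 < n)%N -> a \in B -> L (sp n a).
Proof. by exists n, a; rewrite infix_refl. Qed.

Lemma lang_decomp m w : L w -> exists x v y, [/\ w = x ++ sw m v ++ y,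
  all (mem B) v, (size x <= maxlen sigma m)%N & (size y <= maxlen sigma m)%N].
Proof.
move=> [n [a [n0 aB wa]]]; have [mn|nm] := leqP m n; last first.
  exists w, [::], [::]; split=> //; first by rewrite swE /= cats0.
  exact: leq_trans (size_infix wa) (leq_maxlen _ _ (ltnW nm)).
move: wa; rewrite -(subnKC mn) spD swE => /(infix_flatten_map (M := maxlen sigma m)).
case=> [b _|x [v [y [-> vt lx ly]]]]; first exact: leq_maxlen.
exists x, v, y; split=> //; first by rewrite swE.
apply/allP => b bv; apply: (allP (sp_all (n - m) aB)).
exact: mem_infix vt _ bv.
Qed.

(** The block of order [m] containing [d] has length at most [maxlen sigma m], so margins of that
    length enclose it. They also force the iterate containing the word to have order at least
    [m]. *)
Lemma lang_block m x d y : L (x ++ d :: y) ->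
    (maxlen sigma m <= size x)%N -> (maxlen sigma m <= size y)%N ->
  exists b, [/\ b \in B, infix (sp m b) (x ++ d :: y) & d \in sp m b].
Proof.
move=> [n [a [n0 aB wa]]] lx ly.
have mn : (m <= n)%N.
  rewrite leqNgt; apply/negP => /ltnW nm.
  have := leq_trans (size_infix wa) (leq_maxlen sigma a nm).
  by rewrite size_cat /= => h; have := leq_trans h lx; lia.
move: wa; rewrite -(subnKC mn) spD swE => /infixP[p [q]].
rewrite -!catA cat_cons catA => /flatten_map_split.
case=> t1 [b [t2 [e1 [e2 [et eb ex ey]]]]]; exists b.
have bB : b \in B.
  by apply: (allP (sp_all (n - m) aB)); rewrite et mem_cat mem_head orbT.
have lb := leq_maxlen sigma b (leqnn m).
have le : (size e1 + (size e2).+1 <= maxlen sigma m)%N.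
  by rewrite (leq_trans _ lb) // eb size_cat.
have le1 : (size e1 <= size x)%N by lia.
have le2 : (size e2 <= size y)%N by lia.
split => //; last by rewrite eb mem_cat mem_head orbT.
have [-> _] := cat_eq_split ey le2.
have : exists x', x = x' ++ e1.
  exists (take (size x - size e1) x).
  have := congr1 (drop (size p + size x - size e1)) ex.
  rewrite drop_cat ifF; last by apply/negbTE; rewrite -leqNgt; lia.
  rewrite [RHS]drop_size_cat; last first.
    by rewrite -size_cat ex size_cat addnK.
  rewrite (_ : (_ - _ - _ = size x - size e1)%N); last by lia.
  by move=> {2}<-; rewrite cat_take_drop.
case=> x' ->; rewrite eb -!catA.
apply/infixP; exists x', (drop (size e2) y); by rewrite -!catA.
Qed.

End Level.

Section NewLetters.
Variables (A : finType) (sigma : A -> seq A) (B C : {set A}) (k : nat).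
Local Notation D := (B :\: C)%SET.
Local Notation sw n := (iter n (subst_word sigma)).
Local Notation sp n := (subst_pow sigma n).
Local Notation nD := (count (mem D)).
Local Notation L := (lang sigma B).
Hypothesis CB : C \subset B.
Hypothesis sB : forall a, a \in B -> word_on B (sigma a).
Hypothesis sC : forall a, a \in C -> word_on C (sigma a).
Hypothesis k_gt0 : (0 < k)%N.
Hypothesis prim : forall a b, a \in D -> b \in B -> b \in sp k a.
Implicit Types (u v w : seq A) (a b : A) (m n : nat).

Lemma memDB a : a \in D -> a \in B.
Proof. by rewrite inE => /andP[]. Qed.

Lemma nD_all0 u : all (mem C) u -> nD u = 0%N.
Proof.
move=> uC; apply/eqP; rewrite -leqn0 leqNgt -has_count -all_predC.
by apply: sub_all uC => a /=; rewrite !inE => ->.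
Qed.

Lemma nD0_all u : all (mem B) u -> nD u = 0%N -> all (mem C) u.
Proof.
move=> uB /eqP; rewrite -leqn0 leqNgt -has_count -all_predC => h.
apply/allP => a au; move: (allP h a au) (allP uB a au) => /=.
by rewrite !inE negb_and negbK => /orP[//|/negP].
Qed.

Lemma nD_sp_C n a : a \in C -> nD (sp n a) = 0%N.
Proof. by move=> aC; apply/nD_all0/sp_all. Qed.

(** At multiples of [k] primitivity returns the letter [a]. If some [sp n a] had no letter of [D],
    it would be a word over [C], and so would all later iterates, among them that of order
    [k * n]. *)
Lemma nD_sp_pos n a : a \in D -> (0 < nD (sp n a))%N.
Proof.
move=> aD; have aB := memDB aD.
have kpos j : (0 < nD (sp (k * j) a))%N.
  rewrite -has_count; elim: j => [|j IH]; first by rewrite muln0 /= aD.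
  apply/hasP; exists a => //; have /hasP[b bu bD] := IH.
  by rewrite mulnS spD; apply: (mem_sw bu); apply: prim.
rewrite lt0n; apply/negP => /eqP n0; have := kpos n.
have -> : (k * n = (k * n - n) + n)%N by rewrite subnK // leq_pmull.
by rewrite spD nD_all0 //; apply/(sw_all sC)/nD0_all => //; exact: sp_all.
Qed.

Lemma big_D (V : nmodType) (F : A -> V) u : all (mem B) u ->
  {in C, forall a, F a = 0} ->
  \sum_(a <- u) F a = \sum_(a in D) F a *+ count_mem a u.
Proof.
move=> uB F0; rewrite sum_count [RHS]big_mkcond /=; apply: eq_bigr => a _.
rewrite inE; have [aC|aC] /= := boolP (a \in C); first by rewrite F0 ?mul0rn.
have [//|aB] := boolP (a \in B); rewrite (count_memPn _) //.
by apply: contra aB => /(allP uB).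
Qed.

Lemma nD_sw n u : all (mem B) u ->
  nD (sw n u) = (\sum_(a in D) nD (sp n a) * count_mem a u)%N.
Proof.
move=> uB; rewrite count_sw big_D //; last by move=> a; exact: nD_sp_C.
apply: eq_bigr => a _; elim: (count_mem a u) => [|j IH]; first by rewrite muln0.
by rewrite mulrS mulnS IH.
Qed.

Lemma lang_blockD m x d y : d \in D -> L (x ++ d :: y) ->
    (maxlen sigma m <= size x)%N -> (maxlen sigma m <= size y)%N ->
  exists2 b, b \in D & infix (sp m b) (x ++ d :: y).
Proof.
move=> dD Lx lx ly; have [b [bB bi db]] := lang_block sB Lx lx ly.
exists b => //; rewrite inE bB andbT; apply/negP => bC.
by have := allP (sp_all sC m bC) d db; move: dD; rewrite !inE => /andP[/negP].
Qed.

(** A block of order [n + k] over a letter of [D] contains [sp n a] for every [a] in [B], and such a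
    block surrounds each letter of [D] that has sufficient margins. *)
Lemma lang_dense w : L w -> exists m, forall x d y, d \in D ->
    L (x ++ d :: y) -> (m <= size x)%N -> (m <= size y)%N ->
  infix w (x ++ d :: y).
Proof.
move=> [n [a [_ aB wa]]]; exists (maxlen sigma (n + k)) => x d y dD Lx lx ly.
have [b bD bi] := lang_blockD dD Lx lx ly.
apply: infix_trans wa (infix_trans _ bi).
by rewrite spD; apply/infix_sp_sw/prim.
Qed.

Section Growth.
Hypothesis grow : forall a, a \in D -> (2 <= nD (sp k a))%N.

Lemma nD_sp_pow2 j a : a \in D -> (2 ^ j <= nD (sp (k * j) a))%N.
Proof.
elim: j a => [|j IH] a aD; first by rewrite muln0 /= aD.
rewrite mulnS addnC spD nD_sw; last exact/sp_all/memDB.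
apply: (@leq_trans (\sum_(b in D) 2 ^ j * count_mem b (sp k a))).
  rewrite -big_distrr /= expnSr leq_mul2l; apply/orP; right.
  apply: leq_trans (grow aD) _.
  have /= -> := @nD_sw 0 (sp k a); last exact/sp_all/memDB.
  by apply: leq_sum => b bD; rewrite bD mul1n.
by apply: leq_sum => b bD; rewrite leq_mul2r IH ?orbT.
Qed.

Lemma nD_sp_large J : exists N, forall n a, (N <= n)%N -> a \in D ->
  (J <= nD (sp n a))%N.
Proof.
(* A letter of [D] in the iterate of order [n - k * J] yields [2 ^ J] of them, more than [J]. *)
exists (k * J)%N => n a kJ aD; rewrite -(subnKC kJ) spD.
have /hasP[b bu bD] : has (mem D) (sp (n - k * J) a).
  by rewrite has_count nD_sp_pos.
have uB := sp_all sB (n - k * J) (memDB aD).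
apply: leq_trans (ltnW (ltn_expl J (ltnSn 1))) _.
apply: leq_trans (nD_sp_pow2 J bD) _.
rewrite nD_sw // (bigD1 b) //= -[X in (X <= _)%N]muln1.
by rewrite (leq_trans _ (leq_addr _ _)) // leq_mul2l -has_count has_pred1 bu orbT.
Qed.

End Growth.

End NewLetters.

(** * Convergence of iterated averages by contraction *)

Section Contraction.
Variables (R : realType) (I : finType) (P : pred I) (i0 : I).
Variables (r : nat -> I -> R) (e : nat -> R) (k : nat) (delta : R).
Hypothesis Pi0 : P i0.
Hypothesis delta_gt0 : 0 < delta.
Hypothesis e_small : forall eta, 0 < eta ->
  exists m0, forall m, (m0 <= m)%N -> e m <= eta.
Hypothesis averaging : forall m n a, P a -> exists p : I -> R,
  [/\ forall b, P b -> 0 <= p b, \sum_(b | P b) p b = 1,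
      `|r (m + n)%N a - \sum_(b | P b) p b * r m b| <= e m &
      n = k -> forall b, P b -> delta <= p b].

Let within m lo w := forall a, P a -> lo <= r m a <= lo + w.

(** In the average of the nonnegative distances to either end of the interval only the term of [i0]
    is kept. *)
Let avg_bounds (p : I -> R) m lo w : within m lo w ->
  (forall b, P b -> 0 <= p b) -> \sum_(b | P b) p b = 1 ->
  lo + p i0 * (r m i0 - lo) <= \sum_(b | P b) p b * r m b
    <= lo + w - p i0 * (lo + w - r m i0).
Proof.
move=> hw p0 p1.
have slo : \sum_(b | P b) p b * (r m b - lo) = \sum_(b | P b) p b * r m b - lo.
  under eq_bigr do rewrite mulrBr.
  by rewrite sumrB -mulr_suml p1 mul1r.
have shi : \sum_(b | P b) p b * (lo + w - r m b) =
    lo + w - \sum_(b | P b) p b * r m b.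
  under eq_bigr do rewrite mulrBr.
  by rewrite sumrB -mulr_suml p1 mul1r.
have h1 : p i0 * (r m i0 - lo) <= \sum_(b | P b) p b * (r m b - lo).
  rewrite (bigD1 i0) //= lerDl sumr_ge0 // => b /andP[Pb _].
  by rewrite mulr_ge0 ?p0 // subr_ge0; have /andP[] := hw _ Pb.
have h2 : p i0 * (lo + w - r m i0) <= \sum_(b | P b) p b * (lo + w - r m b).
  rewrite (bigD1 i0) //= lerDl sumr_ge0 // => b /andP[Pb _].
  by rewrite mulr_ge0 ?p0 // subr_ge0; have /andP[] := hw _ Pb.
by move: h1 h2; rewrite slo shi => h1 h2; apply/andP; split; lra.
Qed.

Let stays m n lo w : within m lo w -> within (m + n)%N (lo - e m) (w + 2 * e m).
Proof.
move=> hw a Pa; have [p [p0 p1 hp _]] := averaging m n Pa.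
have /andP[h1 h2] := avg_bounds hw p0 p1.
have /andP[g1 g2] := hw _ Pi0.
have q1 : 0 <= p i0 * (r m i0 - lo) by rewrite mulr_ge0 ?p0 ?subr_ge0.
have q2 : 0 <= p i0 * (lo + w - r m i0) by rewrite mulr_ge0 ?p0 ?subr_ge0.
by move: hp; rewrite ler_norml => /andP[u1 u2]; apply/andP; split; lra.
Qed.

(* Averaging with weights bounded below by [delta] contracts the oscillation by
   the factor [1 - delta], up to the error [e m]. *)
Let shrinks m lo w : within m lo w ->
  exists lo', within (m + k)%N lo' ((1 - delta) * w + 2 * e m).
Proof.
move=> hw; exists (lo + delta * (r m i0 - lo) - e m) => a Pa.
have [p [p0 p1 hp /(_ erefl) pd]] := averaging m k Pa.
have /andP[h1 h2] := avg_bounds hw p0 p1.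
have /andP[g1 g2] := hw _ Pi0.
have q1 : delta * (r m i0 - lo) <= p i0 * (r m i0 - lo).
  by rewrite ler_wpM2r ?pd ?subr_ge0.
have q2 : delta * (lo + w - r m i0) <= p i0 * (lo + w - r m i0).
  by rewrite ler_wpM2r ?pd ?subr_ge0.
by move: hp; rewrite ler_norml => /andP[u1 u2]; apply/andP; split; lra.
Qed.

Let narrow eta : 0 < eta -> exists m lo, within m lo (2 * eta) /\
  forall m', (m <= m')%N -> e m' <= eta.
Proof.
(* While the width exceeds [2 * eta], a contraction step removes at least [2 * eta * delta] and the
   error gives back at most [eta * delta]. *)
move=> eta0; pose eta' := Num.min eta (eta * delta / 2).
have eta'0 : 0 < eta' by rewrite lt_min eta0 divr_gt0 ?mulr_gt0.
have [m0 hm0] := e_small eta'0.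
have {}hm0 m : (m0 <= m)%N -> e m <= eta /\ 2 * e m <= eta * delta.
  by move=> /hm0; rewrite le_min => /andP[-> h]; split => //; lra.
pose w0 := \sum_(b | P b) `|r m0 b|.
have hw0 : within m0 (- w0) (2 * w0).
  move=> a Pa; have : `|r m0 a| <= w0.
    by rewrite /w0 (bigD1 a) //= lerDl sumr_ge0.
  by rewrite ler_norml => /andP[h1 h2]; apply/andP; split; lra.
have key j : exists m lo w, [/\ (m0 <= m)%N, within m lo w &
    w <= Num.max (2 * eta) (2 * w0 - j%:R * (eta * delta))].
  elim: j => [|j [m [lo [w [mm hw lw]]]]].
    exists m0, (- w0), (2 * w0); split => //.
    by rewrite mul0r subr0 le_max lexx orbT.
  have [w2|w2] := leP w (2 * eta).
    by exists m, lo, w; split => //; rewrite le_max w2.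
  have [lo' hlo'] := shrinks hw; have [_ em] := hm0 _ mm.
  exists (m + k)%N, lo', ((1 - delta) * w + 2 * e m); split => //.
    exact: leq_trans mm (leq_addr _ _).
  rewrite le_max; apply/orP; right.
  have wj : w <= 2 * w0 - j%:R * (eta * delta).
    by move: lw; rewrite le_max => /orP[h|//]; move: (le_lt_trans h w2); rewrite ltxx.
  have : delta * (2 * eta) <= delta * w by rewrite ler_wpM2l // ltW.
  by rewrite -natr1; lra.
(* After [J] steps, each with net gain [eta * delta], the initial width [2 * w0] is exhausted. *)
pose J := Num.bound (2 * w0 / (eta * delta)).
have [m [lo [w [mm hw lw]]]] := key J.
exists m, lo; split; last by move=> m' mm'; have [] := hm0 _ (leq_trans mm mm').
have ed : 0 < eta * delta by rewrite mulr_gt0.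
have : 2 * w0 - J%:R * (eta * delta) <= 0.
  rewrite subr_le0 -ler_pdivrMr //; apply/ltW/archi_boundP.
  by rewrite divr_ge0 ?(ltW ed) // mulr_ge0 // sumr_ge0.
move=> hJ; have w2 : w <= 2 * eta.
  by move: lw; rewrite le_max => /orP[//|h]; lra.
by move=> a Pa; have /andP[h1 h2] := hw _ Pa; apply/andP; split; lra.
Qed.

(** Once the interval is narrow it remains so at all later times: the error [e m] depends on the
    starting time [m], not on the number [n] of steps. *)
Lemma contraction_limit : exists f : R, forall eta, 0 < eta ->
  exists m0, forall m a, (m0 <= m)%N -> P a -> `|r m a - f| <= eta.
Proof.
have main eta : 0 < eta -> exists m0 lo, forall m a, (m0 <= m)%N -> P a ->
    lo <= r m a <= lo + eta.
  (* The width from [narrow] and the increase allowed by [stays] are at most [eta / 2] each. *)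
  move=> eta0; have eta4 : 0 < eta / 4 by lra.
  have [m [lo [hw he]]] := narrow eta4.
  exists m, (lo - e m) => m' a mm' Pa; rewrite -(subnKC mm').
  have := stays (m' - m) hw Pa; have := he _ (leqnn m).
  by move=> h1 /andP[h2 h3]; apply/andP; split; lra.
(* The limit is the supremum of the eventual lower bounds. *)
pose E := [set x : R | exists m0, forall m a, (m0 <= m)%N -> P a -> x <= r m a].
have Eub eta : 0 < eta -> exists m0 lo, [/\ E lo, ubound E (lo + eta) &
    forall m a, (m0 <= m)%N -> P a -> lo <= r m a <= lo + eta].
  move=> /main[m0 [lo h]]; exists m0, lo; split => //.
    by exists m0 => m a mm /(h m _ mm)/andP[].
  move=> x [m1 hx]; have := h (maxn m0 m1) i0 (leq_maxl _ _) Pi0.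
  by move=> /andP[_]; apply: le_trans; apply: hx => //; exact: leq_maxr.
have supE : has_sup E.
  have [m0 [lo [Elo Eu _]]] := Eub 1 ltr01.
  by split; [exists lo | exists (lo + 1)].
exists (sup E) => eta eta0; have [m0 [lo [Elo Eu h]]] := Eub eta eta0.
exists m0 => m a mm Pa; have /andP[h1 h2] := h m a mm Pa.
have h3 : lo <= sup E by apply: ub_le_sup => //; case: supE.
have h4 : sup E <= lo + eta by apply: ge_sup => //; case: supE.
by rewrite ler_norml; apply/andP; split; lra.
Qed.

End Contraction.

(** * Perron-Frobenius theory *)

(** A sum of inverses replaces the minimum; the summand 1 covers an empty [I]. *)
Lemma finite_lower_bound (R : realFieldType) (I : finType) (F : I -> R) :
  (forall i, 0 < F i) -> exists2 c, 0 < c & forall i, c <= F i.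
Proof.
move=> F0; have S0 : 0 <= \sum_i (F i)^-1.
  by apply: sumr_ge0 => i _; rewrite invr_ge0 ltW.
exists (1 + \sum_i (F i)^-1)^-1 => [|i]; first by rewrite invr_gt0; lra.
rewrite -[leRHS]invrK lef_pV2 ?posrE ?invr_gt0 //; last by lra.
have : (F i)^-1 <= \sum_i (F i)^-1.
  by rewrite (bigD1 i) //= lerDl sumr_ge0 // => j _; rewrite invr_ge0 ltW.
lra.
Qed.

Lemma finite_upper_bound (R : realFieldType) (I : finType) (F : I -> R) :
  exists2 c, 0 < c & forall i, F i <= c.
Proof.
have S0 : 0 <= \sum_i `|F i| by exact: sumr_ge0.
exists (1 + \sum_i `|F i|) => [|i]; first lra.
apply: le_trans (ler_norm _) _.
have : `|F i| <= \sum_i `|F i| by rewrite (bigD1 i) //= lerDl sumr_ge0.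
lra.
Qed.

Section PerronFrobenius.
Variables (R : realType) (I : finType) (M : I -> I -> R) (i0 : I) (k : nat).
Implicit Types (u v : I -> R) (a b : I).
Hypothesis M_ge0 : forall a b, 0 <= M a b.

Definition kernel_op u : I -> R := fun a => \sum_b M a b * u b.
Local Notation op := kernel_op.

Definition kernel_pow n a b : R := iter n op (fun c => (c == b)%:R) a.
Local Notation Mn := kernel_pow.

Hypothesis k_gt0 : (0 < k)%N.
Hypothesis Mk_gt0 : forall a b, 0 < Mn k a b.

Lemma iter_opE n u a : iter n op u a = \sum_b Mn n a b * u b.
Proof.
elim: n a => [|n IH] a.
  rewrite (bigD1 a) //= /kernel_pow /= eqxx mul1r big1 ?addr0 // => b.
  by rewrite eq_sym => /negPf->; rewrite mul0r.
rewrite iterS {1}/kernel_op; under eq_bigr do rewrite IH mulr_sumr.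
rewrite exchange_big /=; apply: eq_bigr => b _.
rewrite /kernel_op mulr_suml.
by apply: eq_bigr => c _; rewrite mulrA.
Qed.

Lemma iter_op_ge0 n u : (forall a, 0 <= u a) -> forall a, 0 <= iter n op u a.
Proof.
move=> u0; elim: n => //= n IH a.
by apply: sumr_ge0 => b _; rewrite mulr_ge0.
Qed.

Lemma kernel_pow_ge0 n a b : 0 <= Mn n a b.
Proof. by apply: iter_op_ge0 => c; rewrite ler0n. Qed.

Let row_pos a : exists c, 0 < M a c.
Proof.
apply/existsP; apply: contraT; rewrite negb_exists => /forallP h.
have := Mk_gt0 a i0; rewrite -(prednK k_gt0) /kernel_pow iterS /kernel_op big1 ?ltxx //.
move=> b _; have := h b; rewrite -leNgt => Mab.
by have -> : M a b = 0; [apply/le_anti; rewrite Mab M_ge0 | rewrite mul0r].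
Qed.

Let iter_op_gt0 n u : (forall a, 0 < u a) -> forall a, 0 < iter n op u a.
Proof.
move=> u0; elim: n => //= n IH a; have [c Mc] := row_pos a.
rewrite /kernel_op (bigD1 c) //= ltr_pwDl ?mulr_gt0 //.
by apply: sumr_ge0 => b _; rewrite mulr_ge0 // ltW.
Qed.

(** The offset [k] makes all values of [V n] comparable to the single number [s n], with constants
    independent of [n]. *)
Let E u n a : R := iter (k + n) op u a.
Let V n a : R := E (fun=> 1) n a.
Let s n : R := \sum_b iter n op (fun=> 1) b.

Let V_gt0 n a : 0 < V n a.
Proof. by apply: iter_op_gt0. Qed.

Let E_add u m n a : E u (m + n) a = \sum_b Mn n a b * E u m b.
Proof. by rewrite /E (addnC m) addnCA iterD iter_opE. Qed.

Let Mk_bounds : exists c d, [/\ 0 < c, 0 < d,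
  forall a b, c <= Mn k a b & forall a b, Mn k a b <= d].
Proof.
have [c c0 hc] := @finite_lower_bound R _ (fun p : I * I => Mn k p.1 p.2)
  (fun p => Mk_gt0 p.1 p.2).
have [d d0 hd] := @finite_upper_bound R _ (fun p : I * I => Mn k p.1 p.2).
by exists c, d; split=> // a b; [exact: (hc (a, b)) | exact: (hd (a, b))].
Qed.

Let V_bounds c d : (forall a b, c <= Mn k a b) -> (forall a b, Mn k a b <= d) ->
  forall n a, c * s n <= V n a <= d * s n.
Proof.
move=> hc hd n a; rewrite /V /E iterD iter_opE /s !mulr_sumr.
by apply/andP; split; apply: ler_sum => b _; rewrite ler_wpM2r // iter_op_ge0.
Qed.

(** The quotient at time [m + n] is an exact average of the quotients at time [m], with weights
    [Mn n a b * V m b / V (m + n) a]. *)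
Let ratio_cvg u : exists f : R, forall eta, 0 < eta ->
  exists m0, forall m a, (m0 <= m)%N -> true -> `|E u m a / V m a - f| <= eta.
Proof.
have [c [d [c0 d0 hc hd]]] := Mk_bounds; have hV := V_bounds hc hd.
have I0 : 0 < (#|I|)%:R :> R by rewrite ltr0n; apply/card_gt0P; exists i0.
(* For [n = k] the numerator of a weight is at least [c * (c * s m)] and its denominator at most
   [#|I| * d * (d * s m)]. *)
apply: (@contraction_limit R I xpredT i0 (fun m a => E u m a / V m a)
  (fun=> 0) k (c * c / (#|I|%:R * d * d))) => //.
- by rewrite !(divr_gt0, mulr_gt0).
- by move=> eta eta0; exists 0%N => m _; exact: ltW.
move=> m n a _; exists (fun b => Mn n a b * V m b / V (m + n) a); split.
- by move=> b _; rewrite divr_ge0 ?mulr_ge0 ?kernel_pow_ge0 // ltW.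
- by rewrite -mulr_suml -E_add divff // gt_eqF // V_gt0.
- rewrite [X in `|X|](_ : _ = 0) ?normr0 // E_add mulr_suml -sumrB big1 // => b _.
  by have := V_gt0 m b; have := V_gt0 (m + n) a => h1 h2; field; rewrite !gt_eqF.
move=> -> b _; have sm0 : 0 < s m.
  have := V_gt0 m b; have /andP[_] := hV m b => h1 h2.
  by rewrite -(pmulr_rgt0 _ d0); exact: lt_le_trans h1.
rewrite ler_pdivlMr //.
have hup : V (m + k) a <= #|I|%:R * d * (d * s m).
  rewrite /V E_add -mulrA [leRHS]mulr_natl -sumr_const; apply: ler_sum => b' _.
  apply: ler_pM; [exact: kernel_pow_ge0|exact/ltW/V_gt0|exact: hd|].
  by have /andP[] := hV m b'.
have hlo : c * (c * s m) <= Mn k a b * V m b.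
  apply: ler_pM; [exact: ltW|by rewrite mulr_ge0 // ltW|exact: hc|].
  by have /andP[] := hV m b.
apply: le_trans hlo; apply: (@le_trans _ _
  (c * c / (#|I|%:R * d * d) * (#|I|%:R * d * (d * s m)))).
  by rewrite ler_wpM2l // divr_ge0 ?mulr_ge0 // ltW.
rewrite le_eqVlt; apply/orP; left; apply/eqP; field.
by rewrite !gt_eqF.
Qed.

Let ell u : R := sval (cid (ratio_cvg u)).

Let ell_cvg u : (fun m => E u m i0 / V m i0) @ \oo --> ell u.
Proof.
apply/cvgrPdist_le => eta eta0; rewrite /ell; case: cid => f /= /(_ _ eta0)[m0 h].
by exists m0 => // m /= mm; rewrite distrC; exact: h.
Qed.

Let ell_unique u (x : R) :
  (fun m => E u m i0 / V m i0) @ \oo --> x -> ell u = x.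
Proof.
move=> h; transitivity (lim ((fun m => E u m i0 / V m i0) @ \oo)).
  by apply/esym/cvg_lim => //; exact: ell_cvg.
by apply/cvg_lim.
Qed.

Let ell_sum u : ell u = \sum_b ell (fun c => (c == b)%:R) * u b.
Proof.
apply: ell_unique.
rewrite (_ : (fun m => _) = (fun m =>
    \sum_b (E (fun c => (c == b)%:R) m i0 / V m i0 * u b))); last first.
  apply/funext => m; rewrite {1}/E iter_opE mulr_suml; apply: eq_bigr => b _.
  by rewrite /E -/(kernel_pow (k + m) i0 b) mulrAC.
apply: (@cvg_big _ _ +%R) => [|b _]; first by move=> p; exact: add_continuous.
by apply: cvgMl; exact: ell_cvg.
Qed.

(** [E (op u) m] is [E u m.+1], and [V m.+1] is [E (op (fun=> 1)) m]; so the quotient is a product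
    of two convergent quotients. *)
Let ell_op u : ell (op u) = ell (op (fun=> 1)) * ell u.
Proof.
apply: ell_unique.
rewrite (_ : (fun m => _) = (fun m =>
  (E (op (fun=> 1)) m i0 / V m i0) * (E u m.+1 i0 / V m.+1 i0))); last first.
  apply/funext => m; rewrite /E -!iterSr -!addnS -/(E u m.+1 i0).
  rewrite -/(E (fun=> 1) m.+1 i0) -/(V m.+1 i0).
  by have := V_gt0 m i0; have := V_gt0 m.+1 i0 => h1 h2; field; rewrite !gt_eqF.
apply: cvgM; first exact: ell_cvg.
have := @ell_cvg u; rewrite -(cvg_shiftn 1 (fun m => E u m i0 / V m i0)) /=.
by apply: cvg_trans; apply: near_eq_cvg; apply: nearW => m; rewrite addn1.
Qed.

(** The limit functional [ell] is linear, and composing it with [op] multiplies it by [t]: it is a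
    left eigenvector. On indicators it is at least [c / (#|I| * d)], hence positive. *)
Lemma perron_left : exists t (l : I -> R), [/\ 0 < t, forall a, 0 < l a &
  forall b, \sum_a l a * M a b = t * l b].
Proof.
have [c [d [c0 d0 hc hd]]] := Mk_bounds.
have I0 : 0 < (#|I|)%:R :> R by rewrite ltr0n; apply/card_gt0P; exists i0.
pose l b := ell (fun c => (c == b)%:R).
have l_gt0 b : 0 < l b.
  apply: (@lt_le_trans _ _ (c / (#|I|%:R * d))).
    by rewrite divr_gt0 // mulr_gt0.
  rewrite /l -(cvg_lim (@norm_hausdorff _ _) (@ell_cvg (fun c => (c == b)%:R))).
  apply: limr_ge; first by apply/cvg_ex; exists (l b); exact: ell_cvg.
  apply: nearW => m; rewrite ler_pdivlMr // mulrAC ler_pdivrMr ?mulr_gt0 //.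
  rewrite /V /E !(addnC k) !iterD !iter_opE.
  apply: (@le_trans _ _ (c * \sum_b' Mn m i0 b' * (#|I|%:R * d))).
    apply: ler_wpM2l; [exact: ltW|apply: ler_sum => b' _].
    rewrite ler_wpM2l ?kernel_pow_ge0 // iter_opE mulr_natl -sumr_const.
    by apply: ler_sum => b'' _; rewrite mulr1.
  rewrite -mulr_suml mulrA ler_wpM2r //; first by rewrite mulr_ge0 // ltW.
  rewrite mulr_sumr.
  apply: ler_sum => b' _; rewrite mulrC ler_wpM2l ?kernel_pow_ge0 //.
  exact: hc.
have lE u : ell u = \sum_b l b * u b by exact: ell_sum.
pose t := ell (op (fun=> 1)).
have t_gt0 : 0 < t.
  rewrite /t lE (bigD1 i0) //= ltr_pwDl //.
    by rewrite mulr_gt0 //; exact: (@iter_op_gt0 1).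
  by apply: sumr_ge0 => b _; rewrite mulr_ge0 ?(ltW (l_gt0 b)) //; apply: (@iter_op_ge0 1).
exists t, l; split=> // b; have := ell_op (fun c => (c == b)%:R).
rewrite -/t -/(l b) lE => <-; apply: eq_bigr => a _.
rewrite /kernel_op (bigD1 b) //= eqxx mulr1 big1 ?addr0 // => e /negPf->.
by rewrite mulr0.
Qed.

End PerronFrobenius.

(** Pairing the moduli of [w] with the right eigenvector [h] gives |z| <= t. In case of equality the
    moduli form a left eigenvector of the positive kernel [Mk], the triangle inequality is an
    equality there, and all [w a] share one phase; dividing it out shows that [z] is nonnegative. *)
Lemma perron_dominates (F : numClosedFieldType) (I : finType) (M Mk : I -> I -> F)
    (h w : I -> F) (t z : F) (k : nat) (i0 : I) :
  (forall a b, 0 <= M a b) -> (forall a b, 0 < Mk a b) ->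
  (forall a, 0 < h a) -> 0 < t ->
  (forall a, \sum_b M a b * h b = t * h a) ->
  (forall a, \sum_b Mk a b * h b = t ^+ k * h a) ->
  (forall b, \sum_a w a * M a b = z * w b) ->
  (forall b, \sum_a w a * Mk a b = z ^+ k * w b) ->
  w i0 != 0 -> z != t -> `|z| < t.
Proof.
move=> M0 Mk0 h0 t0 Mh Mkh wM wMk wi0 zt.
have S0 : 0 < \sum_a `|w a| * h a.
  rewrite (bigD1 i0) //= ltr_pwDl ?mulr_gt0 ?normr_gt0 //.
  by apply: sumr_ge0 => a _; rewrite mulr_ge0 // ltW.
have zle : `|z| <= t.
  rewrite -(ler_pM2r S0) mulr_sumr.
  apply: (@le_trans _ _ (\sum_b (\sum_a `|w a| * M a b) * h b)).
    apply: ler_sum => b _; rewrite mulrA -normrM -wM ler_wpM2r ?(ltW (h0 b)) //.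
    apply: le_trans (ler_norm_sum _ _ _) _; apply: ler_sum => a _.
    by rewrite normrM (ger0_norm (M0 a b)).
  under eq_bigr do rewrite mulr_suml.
  rewrite exchange_big mulr_sumr le_eqVlt; apply/orP; left; apply/eqP.
  apply: eq_bigr => a _; under eq_bigr do rewrite -mulrA.
  by rewrite -mulr_sumr Mh mulrCA.
rewrite lt_neqAle zle andbT; apply: contra zt => /eqP ezt.
have eq0 : \sum_b ((\sum_a `|w a| * Mk a b) - t ^+ k * `|w b|) * h b = 0.
  under eq_bigr do rewrite mulrBl mulr_suml.
  rewrite sumrB exchange_big /= -sumrB big1 // => a _.
  under eq_bigr do rewrite -mulrA.
  by rewrite -mulr_sumr Mkh mulrCA mulrA subrr.
have ge0 b : true -> 0 <= ((\sum_a `|w a| * Mk a b) - t ^+ k * `|w b|) * h b.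
  move=> _; rewrite mulr_ge0 ?(ltW (h0 b)) // subr_ge0 -ezt -normrX -normrM -wMk.
  apply: le_trans (ler_norm_sum _ _ _) _; apply: ler_sum => a _.
  by rewrite normrM (gtr0_norm (Mk0 a b)).
have eqb b : \sum_a `|w a| * Mk a b = t ^+ k * `|w b|.
  have /eqP : _ * h b = 0 := psumr_eq0P ge0 eq0 isT.
  by rewrite mulf_eq0 (gt_eqF (h0 b)) orbF subr_eq0 => /eqP.
have [|v /eqP v1 hv] := @normC_sum_eq F I predT (fun a => w a * Mk a i0).
  rewrite wMk normrM normrX ezt -eqb; apply: eq_bigr => a _.
  by rewrite normrM (gtr0_norm (Mk0 a i0)).
have {hv} wv a : w a = `|w a| * v.
  have := hv a isT; rewrite normrM (gtr0_norm (Mk0 a i0)) mulrAC => /mulIf; apply.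
  by rewrite gt_eqF.
have v0 : v != 0 by rewrite -normr_eq0 v1 oner_eq0.
have : z * `|w i0| = \sum_a `|w a| * M a i0.
  apply: (mulIf v0); rewrite -mulrA -wv -wM mulr_suml.
  by apply: eq_bigr => a _; rewrite {1}wv mulrAC.
move=> zw; have z0 : 0 <= z.
  rewrite -(@pmulr_lge0 _ `|w i0|) ?normr_gt0 // zw.
  by apply: sumr_ge0 => a _; rewrite mulr_ge0.
by rewrite -ezt ger0_norm.
Qed.

Section KernelPow.
Variables (R : realType) (I : finType).
Implicit Types (M : I -> I -> R) (a b : I).

Lemma kernel_powSr M n a b :
  kernel_pow M n.+1 a b = \sum_c kernel_pow M n a c * M c b.
Proof.
rewrite /kernel_pow iterSr iter_opE; apply: eq_bigr => c _.
congr (_ * _); rewrite /kernel_op (bigD1 b) //= eqxx mulr1 big1 ?addr0 // => d.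
by move=> /negPf->; rewrite mulr0.
Qed.

Lemma kernel_powS M n a b :
  kernel_pow M n.+1 a b = \sum_c M a c * kernel_pow M n c b.
Proof. by []. Qed.

Lemma kernel_pow_tr M n a b :
  kernel_pow (fun a b => M b a) n a b = kernel_pow M n b a.
Proof.
elim: n a b => [|n IH] a b; first by rewrite /kernel_pow /= eq_sym.
by rewrite kernel_powS kernel_powSr; apply: eq_bigr => c _; rewrite IH mulrC.
Qed.

Lemma kernel_pow_right M (h : I -> R) t : (forall a, \sum_b M a b * h b = t * h a) ->
  forall n a, \sum_b kernel_pow M n a b * h b = t ^+ n * h a.
Proof.
move=> Mh; elim=> [|n IH] a.
  rewrite (bigD1 a) //= /kernel_pow /= eqxx mul1r big1 ?addr0 ?mul1r // => b.
  by rewrite eq_sym => /negPf->; rewrite mul0r.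
rewrite exprS -mulrA mulrCA -Mh mulr_sumr.
under eq_bigr do rewrite kernel_powS mulr_suml.
rewrite exchange_big /=; apply: eq_bigr => c _.
by under eq_bigr do rewrite -mulrA; rewrite -mulr_sumr IH mulrCA.
Qed.

Lemma kernel_pow_left (F : numFieldType) (f : {rmorphism R -> F}) M (w : I -> F) z :
  (forall b, \sum_a w a * f (M a b) = z * w b) ->
  forall n b, \sum_a w a * f (kernel_pow M n a b) = z ^+ n * w b.
Proof.
move=> wM; elim=> [|n IH] b.
  rewrite (bigD1 b) //= /kernel_pow /= eqxx rmorph1 mulr1 big1 ?addr0 ?mul1r //.
  by move=> a /negPf->; rewrite rmorph0 mulr0.
under eq_bigr do rewrite kernel_powSr rmorph_sum mulr_sumr.
rewrite exchange_big /= exprSr -mulrA -wM mulr_sumr; apply: eq_bigr => c _.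
rewrite mulrA -IH mulr_suml; apply: eq_bigr => a _.
by rewrite rmorphM mulrA.
Qed.

End KernelPow.

Lemma dominant_eigenvalue_uniq (R : realType) (m : nat) (Q : 'M[R]_m) (s t : R) :
  dominant_eigenvalue Q s -> dominant_eigenvalue Q t -> s = t.
Proof.
move=> [s0 es hs] [t0 et ht]; apply/eqP; apply: contraT => st.
have cast r : eigenvalue Q r -> eigenvalue (map_mx (real_complex R) Q) r%:C%C.
  move=> /eigenvalueP[v vQ v0]; apply/eigenvalueP; exists (map_mx (real_complex R) v).
    by rewrite -map_mxM vQ map_mxZ.
  by rewrite map_mx_eq0.
have := hs _ (cast _ et); have := ht _ (cast _ es).
rewrite !(inj_eq (@complexI _)) st eq_sym st !ger0_norm ?lecR ?(ltW s0) ?(ltW t0) //.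
by move=> /(_ isT) h1 /(_ isT) h2; have := lt_trans h1 h2; rewrite ltxx.
Qed.

(** [eigenvalue] refers to row vectors and is witnessed by the left eigenvector [l]; the right one,
    [h], comes from the transpose and serves for domination and for the weights below. Pairing the
    two shows that their eigenvalues agree. *)
Lemma dominant_eigenvalue_exists (R : realType) (m : nat) (Q : 'M[R]_m)
    (i0 : 'I_m) (k : nat) :
  (forall a b, 0 <= Q a b) -> (0 < k)%N -> (forall a b, 0 < kernel_pow Q k a b) ->
  exists t (h : 'I_m -> R), [/\ dominant_eigenvalue Q t, forall a, 0 < h a &
    forall a, \sum_b Q a b * h b = t * h a].
Proof.
move=> Q0 k0 Qk; have [t [l [t0 l0 lQ]]] := perron_left i0 Q0 k0 Qk.
have [||s [h [s0 h0 Qh]]] := @perron_left R _ (fun a b => Q b a) i0 k _ k0.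
- by move=> a b; exact: Q0.
- by move=> a b; rewrite kernel_pow_tr.
have {}Qh a : \sum_b Q a b * h b = s * h a.
  by rewrite -Qh; apply: eq_bigr => b _; rewrite mulrC.
have est : s = t.
  have lh : \sum_a l a * h a != 0.
    rewrite gt_eqF // (bigD1 i0) //= ltr_pwDl ?mulr_gt0 //.
    by apply: sumr_ge0 => a _; rewrite mulr_ge0 // ltW.
  apply: (mulIf lh); rewrite !mulr_sumr.
  under eq_bigr do rewrite mulrCA -Qh mulr_sumr.
  rewrite exchange_big /=; apply: eq_bigr => b _.
  by rewrite mulrA -lQ mulr_suml; apply: eq_bigr => a _; rewrite mulrA.
rewrite {s s0}est in Qh.
exists t, h; split => //; split => //.
  apply/eigenvalueP; exists (\row_b l b).
    by apply/rowP => b; rewrite !mxE -lQ; apply: eq_bigr => a _; rewrite mxE.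
  by apply/eqP => /rowP/(_ i0); rewrite !mxE => /eqP; rewrite gt_eqF.
move=> z /eigenvalueP[v vQ /eqP v0] zt.
have [a va] : exists a, v 0 a != 0.
  apply/existsP; apply: contra_notT v0; rewrite negb_exists => /forallP v0.
  by apply/rowP => a; rewrite mxE; apply/eqP; have := v0 a; rewrite negbK.
have vM b : \sum_a v 0 a * real_complex R (Q a b) = z * v 0 b.
  have /rowP/(_ b) := vQ; rewrite !mxE => <-.
  by apply: eq_bigr => c _; rewrite mxE.
apply: (@perron_dominates _ _ (fun a b => (Q a b)%:C%C)
  (fun a b => (kernel_pow Q k a b)%:C%C) (fun a => (h a)%:C%C) (v 0) _ _ k a) => //.
- by move=> b c; rewrite lecR.
- by move=> b c; rewrite ltcR.
- by move=> b; rewrite ltcR.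
- by rewrite ltcR.
- move=> b; rewrite -[RHS](rmorphM (real_complex R)) -Qh rmorph_sum.
  by apply: eq_bigr => c _; rewrite rmorphM.
- move=> b; rewrite -(rmorphXn (real_complex R)) -[RHS](rmorphM (real_complex R)).
  rewrite -(kernel_pow_right Qh) rmorph_sum.
  by apply: eq_bigr => c _; rewrite rmorphM.
- exact: (kernel_pow_left vM).
Qed.

(** * Eigenvalues and the length of iterates *)

Section Weights.
Variables (R : realType) (A : finType) (sigma : A -> seq A) (n : nat)
  (Ac : nat -> {set A}).
Hypothesis hpc : primitive_components sigma n Ac.
Local Notation sw n := (iter n (subst_word sigma)).
Local Notation sp n := (subst_pow sigma n).
Local Notation Dl i := (Ac i :\: Ac i.-1)%SET.
Local Notation th := (theta sigma Ac R).
Implicit Types (i j m : nat) (a b : A) (u : seq A) (W : A -> R).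

Lemma Ac_sub i : (1 <= i <= n)%N -> Ac i.-1 \subset Ac i.
Proof.
case: i => [|[|i]] //= hi; first by rewrite (pc_bottom hpc) finset.sub0set.
by apply: proper_sub; apply: (pc_chain hpc).
Qed.

Lemma Ac_stable i a : (1 <= i <= n)%N -> a \in Ac i -> word_on (Ac i) (sigma a).
Proof. exact: (pc_stable hpc). Qed.

Lemma Ac_stable_pred i a : (1 <= i <= n)%N -> a \in Ac i.-1 ->
  word_on (Ac i.-1) (sigma a).
Proof.
case: i => [|[|i]] //= hi; first by rewrite (pc_bottom hpc) inE.
by apply: Ac_stable; rewrite /= ltnW.
Qed.

Lemma Ac_pred_mem i a b : (1 <= i <= n)%N -> a \in Ac i.-1 -> b \in sigma a ->
  b \in Ac i.-1.
Proof. by move=> hi /(Ac_stable_pred hi)/andP[_ /allP]; exact. Qed.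

Lemma Ac_new i : (1 <= i <= n)%N -> exists a, a \in Dl i.
Proof.
case: i => [|[|i]] //= hi.
  have /set0Pn[a aA] := pc_first hpc; exists a.
  by rewrite (pc_bottom hpc) !inE.
have /properP[_ [a a1 a2]] := pc_chain hpc (hi : (1 <= i.+1 < n)%N).
by exists a; rewrite inE a1 a2.
Qed.

Lemma Ac_mono i j : (i <= j <= n)%N -> Ac i \subset Ac j.
Proof.
elim: j => [|j IH]; first by rewrite leqn0 => /andP[/eqP->].
move=> /andP[]; rewrite leq_eqVlt => /predU1P[-> _|ij jn]; first exact: subxx.
apply: (fintype.subset_trans (IH _)); last exact: (@Ac_sub j.+1).
by rewrite -ltnS ij ltnW.
Qed.

(** The eigenvector is extended by 0, so that a sum over the whole word [sigma a] sees the new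
    letters only. *)
Lemma theta_eigenvector i : (1 <= i <= n)%N -> exists h : A -> R,
  [/\ 0 < th i, forall a, a \in Dl i -> 0 < h a,
      forall a, a \notin Dl i -> h a = 0 &
      forall a, a \in Dl i -> \sum_(b <- sigma a) h b = th i * h a].
Proof.
move=> hi; have [a0 a0D] := Ac_new hi.
have [k k0 prim] := pc_primitive hpc.
have sB a := @Ac_stable i a hi; have sC a := @Ac_stable_pred i a hi.
have CB := Ac_sub hi.
pose Q := comp_matrix sigma Ac R i.
have Qpow m p q : kernel_pow Q m p q =
    (count_mem (enum_val q) (sp m (enum_val p)))%:R.
  elim: m p => [|m IH] p.
    rewrite /kernel_pow /= (inj_eq enum_val_inj); congr (_%:R).
    by rewrite addn0.
  rewrite kernel_powS /subst_pow iterSr /subst_word /= cats0.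
  rewrite -/(subst_word sigma) count_sw natr_sum.
  rewrite (big_D (C := Ac i.-1) (B := Ac i)).
  - rewrite [RHS]big_enum_val; apply: eq_bigr => r _.
    by rewrite IH mxE mulrC mulr_natr.
  - by have /andP[] := sB _ (memDB (enum_valP p)).
  - move=> a aC; rewrite (count_memPn _) //.
    have := enum_valP q; rewrite inE => /andP[+ _]; apply: contra => qa.
    exact: (allP (sp_all sC m aC)).
have [||t [h [dt h0 hQ]]] :=
    @dominant_eigenvalue_exists R _ Q (enum_rank_in a0D a0) k _ k0.
- by move=> p q; rewrite mxE ler0n.
- move=> p q; rewrite Qpow ltr0n -has_count has_pred1.
  apply: (prim i) => //; first exact: enum_valP.
  exact: memDB (enum_valP q).
(* [theta] is a chosen value; uniqueness of the dominant eigenvalue identifies it. *)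
have -> : th i = t.
  rewrite /theta; apply: (dominant_eigenvalue_uniq (Q := Q)) => //.
  by have := @xgetPex R 0 [set t | dominant_eigenvalue Q t]; apply; exists t.
exists (fun a => if a \in Dl i then h (enum_rank_in a0D a) else 0).
split=> [|a ->|a /negPf->|a aD] //; first by case: dt.
rewrite aD -hQ (big_D (C := Ac i.-1) (B := Ac i)).
- rewrite [LHS]big_enum_val; apply: eq_bigr => r _.
  by rewrite enum_valP enum_valK_in mxE enum_rankK_in // mulrC mulr_natr.
- by have /andP[] := sB _ (memDB aD).
- by move=> b bC; rewrite inE bC.
Qed.

Lemma sum_letters_le W1 W2 u : (forall a, a \in u -> W1 a <= W2 a) ->
  \sum_(a <- u) W1 a <= \sum_(a <- u) W2 a.
Proof.
move=> h; rewrite big_seq [leRHS]big_seq; exact: ler_sum.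
Qed.

Lemma theta_iter i (h : A -> R) : (1 <= i <= n)%N ->
  (forall a, a \notin Dl i -> h a = 0) ->
  (forall a, a \in Dl i -> \sum_(b <- sigma a) h b = th i * h a) ->
  forall m u, all (mem (Ac i)) u ->
    \sum_(b <- sw m u) h b = th i ^+ m * \sum_(b <- u) h b.
Proof.
move=> hi h0 hh; elim=> [|m IH] u uB; first by rewrite mul1r.
rewrite iterSr IH; last by apply: (sw_all (fun a => @Ac_stable i a hi) 1).
rewrite exprSr -mulrA; congr (_ * _); rewrite (big_sw sigma h 1) mulr_sumr.
apply: eq_big_seq => a au; rewrite /subst_pow /= /subst_word /= cats0.
have [aD|aD] := boolP (a \in Dl i); first exact: hh.
rewrite h0 // mulr0 big_seq big1 // => b ba; apply: h0.
have aC : a \in Ac i.-1.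
  have aB : a \in Ac i := allP uB _ au.
  by move: aD; rewrite inE negb_and negbK aB orbF.
by rewrite inE (Ac_pred_mem hi aC ba).
Qed.

(** Induction on the levels, adding [K * h] for the eigenvector [h] of the new level: its growth
    rate is below [t], and for large [K] the difference pays for the old letters in [sigma a]. *)
Lemma subdominant_weight j (t : R) : (j <= n)%N -> 0 < t ->
  (forall l, (1 <= l <= j)%N -> th l < t) ->
  exists W : A -> R, [/\ forall a, a \in Ac j -> 0 < W a,
    forall a, a \notin Ac j -> W a = 0 &
    forall a, a \in Ac j -> \sum_(b <- sigma a) W b <= t * W a].
Proof.
elim: j => [|j IH] jn t0 ht.
  by exists (fun=> 0); split=> // a; rewrite (pc_bottom hpc) inE.
have [l hl|W [W0 W1 Wt]] := IH (ltnW jn) t0.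
  by apply: ht; move: hl; lia.
have hj : (1 <= j.+1 <= n)%N by [].
have [h [thj h0 h1 hth]] := theta_eigenvector hj.
have d0 : 0 < t - th j.+1 by rewrite subr_gt0 ht // leqnn.
have [K K0 hK] := finite_upper_bound
  (fun a => (\sum_(b <- sigma a) W b) / ((t - th j.+1) * h a)).
exists (fun a => W a + K * h a); split=> [a aj|a aj|a aj].
- have [aC|aC] := boolP (a \in Ac j).
    by rewrite h1 ?mulr0 ?addr0 ?W0 // inE aC.
  by rewrite W1 // add0r mulr_gt0 // h0 // inE aC.
- rewrite W1 ?h1 ?mulr0 ?addr0 //; first by rewrite inE (negPf aj) andbF.
  by apply: contra aj => /(fintype.subsetP (Ac_sub hj)).
rewrite big_split -mulr_sumr /=.
have [aC|aC] := boolP (a \in Ac j).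
  rewrite [X in _ + K * X]big_seq [X in _ + K * X]big1; last first.
    by move=> b ba; apply: h1; rewrite inE (Ac_pred_mem hj aC ba).
  by rewrite h1 ?mulr0 ?addr0 ?Wt // inE aC.
have aD : a \in Dl j.+1 by rewrite inE aC.
rewrite hth // W1 // add0r.
have := hK a; rewrite ler_pdivrMr; last by rewrite mulr_gt0 ?h0.
by rewrite mulrBl mulrBr -(mulrCA t); lra.
Qed.

(** The weight [W] of old letters reproduces itself at a rate at most [t], strictly between
    [lambda_max] and [theta], while the weight [h] of new letters grows exactly by [theta]. So [W]
    stays below a multiple of [h], even with the contribution of new letters at each step. *)
Lemma length_ratio_bounded i : (1 <= i <= n)%N ->
  lambda_max sigma Ac R i.-1 < th i ->
  exists c : R, forall m b, b \in Dl i ->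
    (size (sp m b))%:R <= c * (count (mem (Dl i)) (sp m b))%:R.
Proof.
move=> hi lth; have [h [th0 h0 h1 hth]] := theta_eigenvector hi.
have CB := Ac_sub hi.
have l0 : 0 <= lambda_max sigma Ac R i.-1 by apply: bigmax_ge_id.
pose t := (lambda_max sigma Ac R i.-1 + th i) / 2.
have t0 : 0 < t by rewrite /t; lra.
have tth : t < th i by rewrite /t; lra.
have [||W [W0 W1 Wt]] := @subdominant_weight i.-1 t _ t0.
- by move: hi; lia.
- move=> l hl; apply: (@le_lt_trans _ _ (lambda_max sigma Ac R i.-1)).
    rewrite /lambda_max (@le_bigmax_seq _ _ _ _ _ l) //.
    by rewrite mem_index_iota; move: hl; lia.
  by rewrite /t; lra.
have d0 : 0 < th i - t by rewrite subr_gt0.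
have [K K0 hK] := finite_upper_bound
  (fun a => (\sum_(b <- sigma a) W b) / ((th i - t) * h a)).
(* One step preserves the inequality, since [t * K + K * (th i - t)] is [th i * K]. *)
have WG m b : b \in Dl i ->
    \sum_(a <- sp m b) W a <= K * \sum_(a <- sp m b) h a.
  move=> bD; elim: m => [|m IH].
    rewrite /subst_pow /= !big_seq1 W1; first by rewrite mulr_ge0 ?ltW ?h0.
    by move: bD; rewrite inE => /andP[].
  have uB := sp_all (fun a => @Ac_stable i a hi) m (memDB bD).
  have -> : sp m.+1 b = sw 1 (sp m b) by [].
  rewrite (theta_iter hi h1 hth) // expr1 (big_sw sigma W 1).
  apply: (@le_trans _ _ (\sum_(a <- sp m b) (t * W a + K * (th i - t) * h a))).
    apply: sum_letters_le => a au; rewrite /subst_pow /= /subst_word /= cats0.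
    have [aC|aC] := boolP (a \in Ac i.-1).
      by rewrite h1 ?mulr0 ?addr0 ?Wt // inE aC.
    have aB : a \in Ac i := allP uB _ au.
    have aD : a \in Dl i by rewrite inE aC.
    have := hK a; rewrite ler_pdivrMr; last by rewrite mulr_gt0 ?h0.
    by rewrite W1 // mulr0 add0r mulrA.
  rewrite big_split -!mulr_sumr /=.
  have : t * (\sum_(a <- sp m b) W a) <= t * (K * \sum_(a <- sp m b) h a).
    by rewrite ler_wpM2l // ltW.
  by lra.
have [|c c0 hc] := @finite_lower_bound R A
  (fun a => if a \in Ac i then W a + h a else 1).
  move=> a; case: ifPn => // aB; have [aC|aC] := boolP (a \in Ac i.-1).
    by rewrite h1 ?addr0 ?W0 // inE aC.
  by rewrite W1 // add0r h0 // inE aC.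
have [d dd hd] := finite_upper_bound h.
exists ((K + 1) * d / c) => m b bD.
have uB := sp_all (fun a => @Ac_stable i a hi) m (memDB bD).
have e1 : c * (size (sp m b))%:R <= \sum_(a <- sp m b) (W a + h a).
  rewrite -sum1_size natr_sum mulr_sumr; apply: sum_letters_le => a au.
  by have aB : a \in Ac i := allP uB _ au; have := hc a; rewrite aB mulr1.
have e2 : \sum_(a <- sp m b) h a <= d * (count (mem (Dl i)) (sp m b))%:R.
  rewrite -sum1_count natr_sum mulr_sumr [leRHS]big_mkcond /=.
  apply: sum_letters_le => a au; case: ifPn => [_|/h1-> //].
  by rewrite mulr1.
have e3 := WG m b bD.
rewrite mulrAC ler_pdivlMr // mulrC; apply: le_trans e1 _.
rewrite big_split /=; apply: (@le_trans _ _ ((K + 1) * \sum_(a <- sp m b) h a)).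
  by lra.
by rewrite -mulrA ler_wpM2l // addr_ge0 // ltW.
Qed.

(** Some level [j] below [i] has a [theta] at least as large. Its weight [H] grows at least as fast
    as the weight [G] of the new letters and in addition receives a fixed proportion of [G] every
    [k] steps; so H / G grows at least linearly, even when the rates are equal. *)
Lemma length_ratio_unbounded i (c : R) : (1 <= i <= n)%N ->
  th i <= lambda_max sigma Ac R i.-1 ->
  exists m, forall b, b \in Dl i ->
    c * (count (mem (Dl i)) (sp m b))%:R <= (size (sp m b))%:R.
Proof.
move=> hi lth; have [g [th0 g0 g1 gth]] := theta_eigenvector hi.
have [j hj tj] : exists2 j, (1 <= j < i)%N & th i <= th j.
  apply: contrapT => hn; move: lth; rewrite leNgt => /negP; apply.
  rewrite /lambda_max big_nat; apply: bigmax_lt => // j hj.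
  rewrite ltNge; apply/negP => tj; apply: hn; exists j => //.
  by move: hj hi; lia.
have hj' : (1 <= j <= n)%N by move: hj hi; lia.
have ji : (j <= i.-1 <= n)%N by move: hj hi; clear; lia.
have [h [thj0 h0 h1 hth]] := theta_eigenvector hj'.
have h_ge0 a : 0 <= h a.
  by have [aD|aD] := boolP (a \in Dl j); [apply/ltW/h0 | rewrite h1].
have [k k0 prim] := pc_primitive hpc.
have [a0 a0D] := Ac_new hj'.
have a0i : a0 \in Ac i.
  by apply: (fintype.subsetP (@Ac_mono j i _)) (memDB a0D); move: hj hi; lia.
have a0C : a0 \in Ac i.-1.
  by apply: (fintype.subsetP (@Ac_mono j i.-1 _)) (memDB a0D); move: hj hi; lia.
have [d d0 hd] := finite_upper_bound g.
(* In [k] steps a new letter produces [a0], whose weight is at least [del] times the weight of that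
   letter. *)
pose del := h a0 / d.
have del0 : 0 < del by rewrite divr_gt0 // h0.
pose H u := \sum_(a <- u) h a; pose G u := \sum_(a <- u) g a.
have step u : th j ^+ k * H u + del * G u <= H (sw k u).
  rewrite /H /G (big_sw sigma h k) !mulr_sumr -big_split /=.
  apply: sum_letters_le => a _.
  have [aD|aD] := boolP (a \in Dl i).
    rewrite h1; last first.
      move: aD; rewrite !inE => /andP[aC _]; apply/negP => /andP[_ aj].
      by move/negP: aC; apply; apply: (fintype.subsetP (@Ac_mono j i.-1 _)) aj; rewrite ji.
    rewrite mulr0 add0r; apply: (@le_trans _ _ (h a0)).
      rewrite /del mulrAC ler_pdivrMr // ler_wpM2l //.
    have /splitPr[p q] := prim i a a0 hi aD a0i.
    rewrite big_cat big_cons /= addrCA lerDl addr_ge0 //; exact: sumr_ge0.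
  rewrite g1 // mulr0 addr0.
  have [aDj|aDj] := boolP (a \in Dl j); last first.
    by rewrite h1 // mulr0; apply: sumr_ge0.
  rewrite (theta_iter hj' h1 hth) ?big_seq1 //=.
  by rewrite (memDB aDj).
pose Th := th i ^+ k.
have Th0 : 0 < Th by rewrite exprn_gt0.
have Thj : Th <= th j ^+ k by apply: lerXn2r => //; rewrite nnegrE ltW.
(* This is H / G >= m del / Th, written without quotients. *)
have HG m b : b \in Dl i ->
    m%:R * del * G (sp (k * m) b) <= H (sp (k * m) b) * Th.
  move=> bD; elim: m => [|m IH].
    by rewrite muln0 !mul0r mulr_ge0 ?(ltW Th0) // /H sumr_ge0.
  have uB := sp_all (fun a => @Ac_stable i a hi) (k * m) (memDB bD).
  rewrite mulnS spD; set u := sp (k * m) b in uB IH *.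
  have -> : G (sw k u) = Th * G u by rewrite /G (theta_iter hi g1 gth).
  apply: le_trans (_ : (th j ^+ k * H u + del * G u) * Th <= _); last first.
    by rewrite ler_wpM2r ?step // ltW.
  have Hu : 0 <= H u by exact: sumr_ge0.
  have q1 : Th * (m%:R * del * G u) <= Th * (H u * Th) by rewrite ler_wpM2l // ltW.
  have q2 : Th * (H u * Th) <= th j ^+ k * (H u * Th).
    by rewrite ler_wpM2r // mulr_ge0 // ltW.
  by rewrite -natr1; lra.
have [|e e0 he] := @finite_lower_bound R A (fun a => if a \in Dl i then g a else 1).
  by move=> a; case: ifPn => // /g0.
have [f f0 hf] := finite_upper_bound h.
pose K := del * e / (f * Th).
have K0 : 0 < K by rewrite divr_gt0 // mulr_gt0.
pose m := Num.bound (`|c| / K).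
exists (k * m)%N => b bD; set u := sp _ b.
have e1 : e * (count (mem (Dl i)) u)%:R <= G u.
  rewrite -sum1_count natr_sum mulr_sumr big_mkcond /=.
  apply: sum_letters_le => a au; have := he a; case: ifPn => [_|/g1-> _ //].
  by rewrite mulr1.
have e2 : H u <= f * (size u)%:R.
  rewrite -sum1_size natr_sum mulr_sumr; apply: sum_letters_le => a au.
  by rewrite mulr1.
have e3 := HG m b bD; rewrite -/u in e3.
have cm : c <= m%:R * K.
  apply: le_trans (ler_norm _) _; rewrite -ler_pdivrMr //.
  by apply/ltW/archi_boundP; rewrite divr_ge0 // ltW.
apply: (@le_trans _ _ (m%:R * K * (count (mem (Dl i)) u)%:R)).
  by rewrite ler_wpM2r.
have fTh : 0 < f * Th by rewrite mulr_gt0.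
rewrite /K [X in X * _]mulrA mulrAC ler_pdivrMr //.
apply: (@le_trans _ _ (m%:R * del * G u)).
  by rewrite (mulrA m%:R) -[leLHS]mulrA ler_wpM2l // mulr_ge0 // ltW.
by apply: le_trans e3 _; rewrite [leRHS]mulrA mulrC mulrC ler_wpM2r ?(ltW Th0) // mulrC.
Qed.

(** Otherwise the weight of [sp m a0] would tend to 0, although this word always contains a letter
    of the component, of weight at least [e]. *)
Lemma theta_ge1 i : (1 <= i <= n)%N -> 1 <= th i.
Proof.
move=> hi; have [h [th0 h0 h1 hth]] := theta_eigenvector hi.
have h_ge0 a : 0 <= h a.
  by have [aD|aD] := boolP (a \in Dl i); [apply/ltW/h0 | rewrite h1].
have [a0 a0D] := Ac_new hi.
have [|e e0 he] := @finite_lower_bound R A (fun a => if a \in Dl i then h a else 1).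
  by move=> a; case: ifPn => // /h0.
rewrite leNgt; apply/negP => th1.
have [k k0 prim] := pc_primitive hpc.
have lb m : e <= th i ^+ m * h a0.
  have := theta_iter hi h1 hth m (u := [:: a0]).
  rewrite big_seq1 /= (memDB a0D) => <- //.
  have : (0 < count (mem (Dl i)) (sp m a0))%N.
    apply: (nD_sp_pos (k := k)) => //.
    - by move=> a; exact: Ac_stable.
    - by move=> a; exact: Ac_stable_pred.
    - by move=> a b; exact: prim.
  rewrite -has_count => /hasP[b]; rewrite /subst_pow => /splitPr[p q] bD.
  rewrite big_cat big_cons /= addrCA.
  have {}bD : b \in Dl i := bD.
  apply: (@le_trans _ _ (h b)); first by have := he b; rewrite bD.
  by rewrite lerDl addr_ge0 // sumr_ge0.
have := cvg_geometric (h a0) (_ : `|th i| < 1); rewrite gtr0_norm // => /(_ th1).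
move=> /cvgrPdist_lt/(_ e e0)[m _ /(_ m (leqnn m))] /=.
rewrite sub0r normrN /geometric /= mulrC ger0_norm; last first.
  by rewrite mulr_ge0 // exprn_ge0 // ltW.
by rewrite ltNge lb.
Qed.

End Weights.

(** * Frequencies of words *)

Lemma leq_count_in (T : eqType) (P Q : pred T) (s : seq T) :
  (forall x, x \in s -> P x -> Q x) -> (count P s <= count Q s)%N.
Proof.
elim: s => //= x s IH h; apply: leq_add; last first.
  by apply: IH => y ys; apply: h; rewrite inE ys orbT.
by case Px : (P x) => //; rewrite (h x) ?mem_head.
Qed.

Lemma count_infix (T : eqType) (P : pred T) (s t : seq T) : infix s t ->
  (count P s <= count P t)%N.
Proof. by move=> /infixP[u [v ->]]; rewrite !count_cat addnCA leq_addr. Qed.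

Lemma iota_shift m n : iota m n = map (addn m) (iota 0 n).
Proof. by rewrite -iotaDl addn0. Qed.

Section Occurrences.
Variables (A : finType) (d0 : A) (w : seq A) (o : nat).
Implicit Types (u v : seq A) (i j : nat).

(* [fits u j]: the letters of [w], placed so that its [o]-th letter sits at
   position [j], agree with [u] wherever they fall inside [u]. *)
Definition fits u j := [forall i : 'I_(size w), (o <= j + i)%N ==>
  (j + i - o < size u)%N ==> (nth d0 u (j + i - o) == nth d0 w i)].

Definition inside u j := (o <= j)%N && (j - o + size w <= size u)%N.

(* Occurrences are counted by the position of their [o]-th letter. [occ_out]
   also counts those truncated by the ends of [u]: it is subadditive under
   concatenation, [occ_in] is superadditive, and they differ by at most
   [size w]. *)
Definition occ_out u := count (fits u) (iota 0 (size u)).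
Definition occ_in u := count (fun j => inside u j && fits u j) (iota 0 (size u)).

Lemma fitsP u j : reflect (forall i, (i < size w)%N -> (o <= j + i)%N ->
  (j + i - o < size u)%N -> nth d0 u (j + i - o) = nth d0 w i) (fits u j).
Proof.
apply: (iffP forallP) => h i.
  by move=> iw h1 h2; have := h (Ordinal iw); rewrite /= h1 h2 => /eqP.
by apply/implyP => h1; apply/implyP => h2; apply/eqP; exact: h.
Qed.

Lemma occ_out_cat u v : (occ_out (u ++ v) <= occ_out u + occ_out v)%N.
Proof.
rewrite /occ_out size_cat iotaD count_cat add0n (iota_shift (size u)) count_map.
apply: leq_add; apply: leq_count_in => j; rewrite mem_iota => /= hj /fitsP h.
  apply/fitsP => i iw h1 h2; rewrite -h ?nth_cat ?h2 ?size_cat //.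
  exact: leq_trans h2 (leq_addr _ _).
apply/fitsP => i iw h1 h2; rewrite -h //; last by rewrite size_cat; lia.
  by rewrite nth_cat ifF; [congr nth; lia|lia].
by lia.
Qed.

Lemma occ_in_cat u v : (occ_in u + occ_in v <= occ_in (u ++ v))%N.
Proof.
rewrite /occ_in size_cat iotaD count_cat add0n (iota_shift (size u)) count_map.
apply: leq_add; apply: leq_count_in => j; rewrite mem_iota => /= hj
  /andP[/andP[h1 h2] /fitsP h]; apply/andP; split.
- by rewrite /inside h1 size_cat; lia.
- apply/fitsP => i iw g1 g2; have lt : (j + i - o < size u)%N by lia.
  by rewrite nth_cat lt h.
- by rewrite /inside size_cat; lia.
- apply/fitsP => i iw g1 g2; rewrite nth_cat ifF; last by lia.
  rewrite (_ : (_ - _ - _ = j + i - o)%N); last by lia.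
  by rewrite h //; lia.
Qed.

Lemma occ_in_le u : (occ_in u <= occ_out u)%N.
Proof. by apply: sub_count => j /andP[]. Qed.

Hypothesis ow : (o < size w)%N.

(** A truncated occurrence has its marked letter among the first [o] or the last [size w - o.+1]
    positions. *)
Lemma occ_out_le u : (occ_out u <= occ_in u + size w)%N.
Proof.
set c := (size w - o.+1)%N.
pose P1 j := (j < o)%N; pose P2 j := (size u <= j + c)%N.
have h1 : (count P1 (iota 0 (size u)) <= o)%N.
  rewrite -size_filter -[leqRHS](size_iota 0).
  apply: uniq_leq_size; first by rewrite filter_uniq ?iota_uniq.
  by move=> j; rewrite mem_filter !mem_iota /P1 => /andP[-> _].
have h2 : (count P2 (iota 0 (size u)) <= c)%N.
  rewrite -size_filter -[leqRHS](size_iota (size u - c)).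
  apply: uniq_leq_size; first by rewrite filter_uniq ?iota_uniq.
  by move=> j; rewrite mem_filter !mem_iota /P2; lia.
apply: (@leq_trans (occ_in u + (o + c))); last by rewrite leq_add2l; lia.
apply: leq_trans (leq_add (leqnn _) (leq_add h1 h2)).
rewrite /occ_in /occ_out -!size_filter -!sum1_size !big_filter.
rewrite (big_mkcond (fits u)) (big_mkcond P1) (big_mkcond P2).
rewrite [X in (_ <= X + _)%N]big_mkcond -!big_split /=.
apply: leq_sum => j _; rewrite /inside /P1 /P2.
case: (fits u j) => //; rewrite andbT.
by case: ifP; case: ifP; case: ifP => //; lia.
Qed.

Lemma occ_out_flatten (ss : seq (seq A)) :
  (occ_out (flatten ss) <= \sum_(s <- ss) occ_out s)%N.
Proof.
elim: ss => [|s ss IH]; first by rewrite big_nil.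
by rewrite big_cons; apply: leq_trans (occ_out_cat _ _) _; rewrite leq_add2l.
Qed.

Lemma occ_in_flatten (ss : seq (seq A)) :
  (\sum_(s <- ss) occ_in s <= occ_in (flatten ss))%N.
Proof.
elim: ss => [|s ss IH]; first by rewrite big_nil.
by rewrite big_cons; apply: leq_trans (occ_in_cat _ _); rewrite leq_add2l.
Qed.

Lemma occ_out_count (P : pred A) u : P (nth d0 w o) ->
  (occ_out u <= count P u)%N.
Proof.
move=> Pw; have -> : count P u = count (fun j => P (nth d0 u j)) (iota 0 (size u)).
  by rewrite -{1}(mkseq_nth d0 u) count_map.
apply: leq_count_in => j; rewrite mem_iota add0n /= => ju /fitsP h.
by have := h o ow; rewrite leq_addl addnK ju => ->.
Qed.

End Occurrences.

Section WordFrequency.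
Variables (R : realType) (A : finType) (sigma : A -> seq A) (B C : {set A}) (k : nat).
Local Notation D := (B :\: C)%SET.
Local Notation sw n := (iter n (subst_word sigma)).
Local Notation sp n := (subst_pow sigma n).
Local Notation nD := (count (mem D)).
Local Notation L := (lang sigma B).
Hypothesis sB : forall a, a \in B -> word_on B (sigma a).
Hypothesis sC : forall a, a \in C -> word_on C (sigma a).
Hypothesis k_gt0 : (0 < k)%N.
Hypothesis prim : forall a b, a \in D -> b \in B -> b \in sp k a.
Hypothesis grow : forall a, a \in D -> (2 <= nD (sp k a))%N.
Variables (a0 : A) (d0 : A) (w : seq A) (o : nat).
Hypothesis a0D : a0 \in D.
Hypothesis ow : (o < size w)%N.
Hypothesis woD : nth d0 w o \in D.
Local Notation oi := (occ_in d0 w o).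
Local Notation oo := (occ_out d0 w o).

Let oo_C u : all (mem C) u -> oo u = 0%N.
Proof.
move=> uC; apply/eqP; rewrite -leqn0.
by apply: leq_trans (occ_out_count ow (P := mem D) _ woD) _; rewrite nD_all0.
Qed.

Let natr_big_D (F : A -> nat) u : all (mem B) u -> (forall a, a \in C -> F a = 0%N) ->
  ((\sum_(a <- u) F a)%N)%:R = \sum_(a in D) (F a)%:R * (count_mem a u)%:R :> R.
Proof.
move=> uB F0; rewrite natr_sum (big_D (C := C) uB); last by move=> a /F0->.
by apply: eq_bigr => a _; rewrite mulr_natr.
Qed.

Let occ_sw m u : all (mem B) u ->
  \sum_(b in D) (oi (sp m b))%:R * (count_mem b u)%:R <= (oi (sw m u))%:R :> R /\
  (oo (sw m u))%:R <=
    \sum_(b in D) ((oi (sp m b))%:R + (size w)%:R) * (count_mem b u)%:R :> R.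
Proof.
move=> uB; split.
  rewrite -(@natr_big_D (fun b => oi (sp m b))) //.
    by rewrite ler_nat swE; apply: leq_trans (occ_in_flatten _ _ _ _); rewrite big_map.
  move=> a aC; apply/eqP; rewrite -leqn0 -(@oo_C (sp m a)) ?sp_all //.
  exact: occ_in_le.
apply: (@le_trans _ _ (\sum_(b in D) (oo (sp m b))%:R * (count_mem b u)%:R)).
  rewrite -(@natr_big_D (fun b => oo (sp m b))) //.
    by rewrite ler_nat swE; apply: leq_trans (occ_out_flatten _ _ _ _) _; rewrite big_map.
  by move=> a aC; rewrite oo_C // sp_all.
apply: ler_sum => b _; rewrite ler_wpM2r // -natrD ler_nat.
exact: occ_out_le.
Qed.

Let nD_swR m u : all (mem B) u ->
  (nD (sw m u))%:R = \sum_(b in D) (nD (sp m b))%:R * (count_mem b u)%:R :> R.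
Proof.
by move=> uB; rewrite count_sw natr_big_D // => a aC; exact: nD_sp_C.
Qed.

Let nD_pos m b : b \in D -> 0 < (nD (sp m b))%:R :> R.
Proof. by move=> bD; rewrite ltr0n; exact: (nD_sp_pos sB sC k_gt0 prim). Qed.

(** With the offset [k] the numbers of new letters in [sp (m + k) b] are comparable for all [b] in
    [D], uniformly in [m]; this bounds the weights in [averaging] from below. The error [e m]
    accounts for occurrences across block boundaries, at most [size w] per block. *)
Let r m b : R := (oi (sp (m + k) b))%:R / (nD (sp (m + k) b))%:R.
Let e m : R := (size w)%:R * \sum_(b in D) (nD (sp (m + k) b))%:R^-1.

Let e_small eta : 0 < eta -> exists m0, forall m, (m0 <= m)%N -> e m <= eta.
Proof.
move=> eta0; pose x : R := (size w)%:R * #|D|%:R / eta.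
have x0 : 0 <= x by rewrite divr_ge0 ?mulr_ge0 // ltW.
have [N hN] := nD_sp_large sB sC k_gt0 prim grow (Num.bound x).+1.
exists N => m Nm; rewrite /e.
apply: (@le_trans _ _ ((size w)%:R * \sum_(b in D) ((Num.bound x).+1)%:R^-1)).
  rewrite ler_wpM2l //; apply: ler_sum => b bD.
  rewrite lef_pV2 ?posrE ?nD_pos // ler_nat hN //.
  exact: leq_trans Nm (leq_addr _ _).
rewrite sumr_const -[X in _ * X]mulr_natl mulrA ler_pdivrMr ?ltr0n //.
rewrite [leRHS]mulrC -ler_pdivrMr //; apply: ltW.
by apply: (lt_le_trans (archi_boundP x0)); rewrite ler_nat.
Qed.

Let averaging m n a : a \in D -> exists p : A -> R,
  [/\ forall b, b \in D -> 0 <= p b, \sum_(b in D) p b = 1,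
      `|r (m + n)%N a - \sum_(b in D) p b * r m b| <= e m &
      n = k -> forall b, b \in D -> (maxlen sigma (k + k))%:R^-1 <= p b].
Proof.
move=> aD; set u := sp n a.
have uB : all (mem B) u by apply: (sp_all sB); exact: memDB aD.
have eu : sp (m + n + k) a = sw (m + k) u by rewrite addnAC spD.
have Npos := nD_pos (m + n + k) aD; rewrite eu nD_swR // in Npos.
set N := \sum_(b in D) _ in Npos.
exists (fun b => (nD (sp (m + k) b))%:R * (count_mem b u)%:R / N); split.
- by move=> b bD; rewrite divr_ge0 ?mulr_ge0 // ltW.
- by rewrite -mulr_suml divff // gt_eqF.
- have -> : \sum_(b in D) (nD (sp (m + k) b))%:R * (count_mem b u)%:R / N * r m b
      = (\sum_(b in D) (oi (sp (m + k) b))%:R * (count_mem b u)%:R) / N.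
    rewrite mulr_suml; apply: eq_bigr => b bD; rewrite /r.
    by have := nD_pos (m + k) bD => h; field; rewrite !gt_eqF.
  rewrite {1}/r eu nD_swR // -/N -mulrBl normrM (gtr0_norm (x := N^-1)) ?invr_gt0 //.
  rewrite ler_pdivrMr //; have [h1 h2] := occ_sw (m + k) uB.
  rewrite ger0_norm ?subr_ge0 //.
  have h3 : (oi (sw (m + k) u))%:R <= (oo (sw (m + k) u))%:R :> R.
    by rewrite ler_nat occ_in_le.
  have h4 : \sum_(b in D) ((oi (sp (m + k) b))%:R + (size w)%:R) * (count_mem b u)%:R
     = \sum_(b in D) (oi (sp (m + k) b))%:R * (count_mem b u)%:R +
       \sum_(b in D) (size w)%:R * (count_mem b u)%:R :> R.
    by rewrite -big_split; apply: eq_bigr => b _; rewrite mulrDl.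
  rewrite h4 in h2.
  apply: (@le_trans _ _ (\sum_(b in D) (size w)%:R * (count_mem b u)%:R)).
    by rewrite lerBlDl; apply: le_trans h2.
  rewrite mulr_sumr; apply: ler_sum => b bD.
  rewrite mulrA ler_wpM2r // -[leLHS]mulr1 /e -!mulrA ler_wpM2l //.
  rewrite (bigD1 b) //= mulrDl mulVf ?gt_eqF ?nD_pos // lerDl.
  by rewrite mulr_ge0 // sumr_ge0 // => c _; rewrite invr_ge0.
move=> nk b bD.
(* Since [sp k b] contains every letter of [D], there are at least [S] new letters in
   [sp (m + k) b], while [sp (m + k + k) a] has at most [S * maxlen sigma (k + k)]. *)
pose S := (\sum_(c in D) nD (sp m c))%N.
have lo : (S <= nD (sp (m + k) b))%N.
  rewrite spD (nD_sw sC) ?(sp_all sB) ?(memDB bD) //; apply: leq_sum => c cD.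
  rewrite -[X in (X <= _)%N]muln1 leq_mul2l -has_count has_pred1.
  by rewrite prim ?orbT // (memDB cD).
have up : (nD (sp (m + k + k) a) <= S * maxlen sigma (k + k))%N.
  rewrite -addnA spD (nD_sw sC) ?(sp_all sB) ?(memDB aD) //.
  rewrite big_distrl /=; apply: leq_sum => c cD; rewrite leq_mul2l.
  by rewrite (leq_trans (count_size _ _)) ?leq_maxlen ?orbT.
have NE : N = (nD (sp (m + k + k) a))%:R.
  have -> : sp (m + k + k) a = sw (m + k) u by rewrite -eu nk.
  by rewrite nD_swR.
have l0 : 0 < (maxlen sigma (k + k))%:R :> R.
  rewrite ltr0n; apply: leq_trans (leq_maxlen sigma a (leqnn (k + k))).
  by apply: (sp_size_gt0 sB); exact: memDB aD.
rewrite ler_pdivlMr // mulrC ler_pdivrMr // NE -!natrM ler_nat.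
apply: leq_trans up _; rewrite leq_mul2r; apply/orP; right.
apply: leq_trans lo _; rewrite -[X in (X <= _)%N]muln1 leq_mul2l.
by rewrite -has_count has_pred1 /u nk prim ?orbT // (memDB bD).
Qed.

(** A word of the language is, up to two short ends, a concatenation of blocks of one large order
    [M], on which the ratios are within [eps] of [f]; only the ends enter the constant [c]. *)
Lemma word_frequency : exists2 f : R, 0 <= f & forall eps, 0 < eps ->
  exists c : R, 0 <= c /\ forall u, L u ->
    (oo u)%:R <= (f + eps) * (nD u)%:R + c /\
    f * (nD u)%:R <= (oi u)%:R + eps * (nD u)%:R + c.
Proof.
have l0 : 0 < (maxlen sigma (k + k))%:R^-1 :> R.
  rewrite invr_gt0 ltr0n; apply: leq_trans (leq_maxlen sigma a0 (leqnn (k + k))).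
  by apply: (sp_size_gt0 sB); exact: memDB a0D.
have [f hf] := @contraction_limit R A (mem D) a0 r e k _ a0D l0 e_small averaging.
have r01 m b : b \in D -> 0 <= r m b <= 1.
  move=> bD; rewrite divr_ge0 // ler_pdivrMr ?nD_pos // mul1r ler_nat.
  by rewrite (leq_trans (occ_in_le _ _ _ _)) // occ_out_count.
have f0 : 0 <= f.
  rewrite leNgt; apply/negP => fn; have f2 : 0 < - f / 2 by lra.
  have [m hm] := hf _ f2; have := hm m a0 (leqnn m) a0D.
  by have /andP[h1 h2] := r01 m a0 a0D; rewrite ler_norml => /andP[h3 h4]; lra.
have f1 : f <= 1.
  rewrite leNgt; apply/negP => fn; have f2 : 0 < (f - 1) / 2 by lra.
  have [m hm] := hf _ f2; have := hm m a0 (leqnn m) a0D.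
  by have /andP[h1 h2] := r01 m a0 a0D; rewrite ler_norml => /andP[h3 h4]; lra.
exists f => // eps eps0; have eps2 : 0 < eps / 2 by lra.
have [m1 hm1] := hf _ eps2; have [m2 hm2] := e_small eps2.
pose m := maxn m1 m2; pose M := (m + k)%N.
have hr b : b \in D -> `|r m b - f| <= eps / 2 by apply: hm1; exact: leq_maxl.
have he : e m <= eps / 2 by apply: hm2; exact: leq_maxr.
have hb b : b \in D ->
    (oi (sp M b))%:R + (size w)%:R <= (f + eps) * (nD (sp M b))%:R /\
    f * (nD (sp M b))%:R <= (oi (sp M b))%:R + eps * (nD (sp M b))%:R.
  move=> bD; have p := nD_pos M bD; have := hr b bD.
  have -> : (oi (sp M b))%:R = r m b * (nD (sp M b))%:R.
    by rewrite /r -/M mulfVK // gt_eqF.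
  rewrite ler_norml => /andP[h1 h2].
  have hw : (size w)%:R <= eps / 2 * (nD (sp M b))%:R.
    rewrite -ler_pdivrMr //; apply: le_trans he; rewrite /e ler_wpM2l //.
    rewrite (bigD1 b) //= -/M lerDl.
    by apply: sumr_ge0 => c _; rewrite invr_ge0.
  split; first by have : r m b * (nD (sp M b))%:R <= (f + eps / 2) * (nD (sp M b))%:R;
    [by rewrite ler_pM2r //; lra | lra].
  by rewrite -mulrDl ler_pM2r //; lra.
pose Lam : R := (maxlen sigma M)%:R.
(* Each end has at most [Lam] occurrences and at most [Lam] new letters, also after multiplication
   by [f], since f <= 1. *)
exists (2 * Lam); split; first by rewrite mulr_ge0.
move=> u Lu; have [x [v [y [-> vB lx ly]]]] := lang_decomp sB M Lu.
rewrite !count_cat !natrD.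
have [h1 h2] := occ_sw M vB; set N := (nD (sw M v))%:R.
have {}h1 : f * N <= (oi (sw M v))%:R + eps * N.
  apply: le_trans (lerD h1 (lexx _)); rewrite /N nD_swR // !mulr_sumr -big_split.
  apply: ler_sum => b bD; have [_ hb2] := hb b bD.
  by rewrite /= !mulrA -mulrDl ler_wpM2r.
have {}h2 : (oo (sw M v))%:R <= (f + eps) * N.
  apply: le_trans h2 _; rewrite /N nD_swR // mulr_sumr.
  by apply: ler_sum => b bD; have [hb1 _] := hb b bD; rewrite mulrA ler_wpM2r.
have ub (t : seq A) : (size t <= maxlen sigma M)%N ->
    (nD t)%:R <= Lam :> R /\ (oo t)%:R <= Lam :> R.
  move=> lt; have h : (nD t <= maxlen sigma M)%N := leq_trans (count_size _ _) lt.
  have h' := leq_trans (occ_out_count ow (P := mem D) t woD) h.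
  by rewrite /Lam !ler_nat h h'.
have [a2 a4] := ub x lx; have [b2 b4] := ub y ly.
have N0 : 0 <= N by [].
have fx : f * (nD x)%:R <= Lam.
  by apply: le_trans a2; rewrite ler_piMl.
have fy : f * (nD y)%:R <= Lam.
  by apply: le_trans b2; rewrite ler_piMl.
have g1 : 0 <= eps * (nD x)%:R by rewrite mulr_ge0 // ltW.
have g2 : 0 <= eps * (nD y)%:R by rewrite mulr_ge0 // ltW.
have g3 : 0 <= f * (nD x)%:R by rewrite mulr_ge0.
have g4 : 0 <= f * (nD y)%:R by rewrite mulr_ge0.
have c1 : (oo (x ++ sw M v ++ y))%:R <= (oo x)%:R + (oo (sw M v))%:R + (oo y)%:R :> R.
  rewrite -!natrD ler_nat; apply: leq_trans (occ_out_cat _ _ _ _ _) _.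
  by rewrite -addnA leq_add2l occ_out_cat.
have c2 : (oi (sw M v))%:R <= (oi (x ++ sw M v ++ y))%:R :> R.
  rewrite ler_nat; apply: leq_trans (occ_in_cat _ _ _ _ _).
  apply: leq_trans (leq_addl _ _); apply: leq_trans (occ_in_cat _ _ _ _ _).
  exact: leq_addr.
by rewrite -/N in h1 h2 *; split; lra.
Qed.

End WordFrequency.

(** * Frequencies of visits to sets of points *)

Section Points.
Variable A : finType.
Implicit Types (z : fullshift A) (s c : int) (L m : nat) (w : seq A) (P : pred A)
  (S : set (fullshift A)).

Definition sh z c : fullshift A := fun k : int => z (k + c).

Definition seg z s L : seq A := [seq (z (s + k%:Z) : A) | k <- iota 0 L].

Definition visits S z s L := count (fun j : nat => `[< S (sh z (s + j%:Z)) >]) (iota 0 L).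

Lemma sh0 z : sh z 0 = z.
Proof. by apply/funext => k; rewrite /sh addr0. Qed.

Lemma shD z c1 c2 : sh (sh z c1) c2 = sh z (c2 + c1).
Proof. by apply/funext => k; rewrite /sh addrA. Qed.

Lemma size_seg z s L : size (seg z s L) = L.
Proof. by rewrite size_map size_iota. Qed.

Lemma nth_seg d z s L i : (i < L)%N -> nth d (seg z s L) i = z (s + i%:Z).
Proof. by move=> iL; rewrite (nth_map 0%N) ?size_iota // nth_iota. Qed.

Lemma seg_cat z s L1 L2 : seg z s (L1 + L2) = seg z s L1 ++ seg z (s + L1%:Z) L2.
Proof.
rewrite /seg iotaD map_cat add0n (iota_shift L1) -map_comp; congr (_ ++ _).
by apply: eq_map => j /=; rewrite PoszD addrA.
Qed.

Lemma seg_sh z c s L : seg (sh z c) s L = seg z (s + c) L.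
Proof. by apply: eq_map => j; rewrite /sh addrAC. Qed.

Lemma window_seg z m : window z m = seg z (- m%:Z) m.*2.+1.
Proof. by apply: eq_map => j; rewrite addrC. Qed.

Lemma seg_eqP z z' s s' L :
  seg z s L = seg z' s' L <-> forall i, (i < L)%N -> z (s + i%:Z) = z' (s' + i%:Z).
Proof.
split=> [e i iL|h].
  by have := congr1 (fun u => nth (z 0) u i) e; rewrite !nth_seg.
by apply/eq_in_map => j; rewrite mem_iota => /h.
Qed.

Lemma windowP z z' m :
  window z m = window z' m <-> forall k : int, (`|k| <= m)%N -> z k = z' k.
Proof.
rewrite !window_seg; split=> [/seg_eqP h k km|h].
  have := h (absz (k + m%:Z)) _.
  have -> : (- m%:Z + (absz (k + m%:Z))%:Z)%R = k by lia.
  by apply; lia.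
by apply/seg_eqP => i im; apply: h; lia.
Qed.

Lemma window_le z z' m m' : (m <= m')%N -> window z m' = window z' m' ->
  window z m = window z' m.
Proof.
by move=> mm /windowP h; apply/windowP => k km; apply: h; exact: leq_trans mm.
Qed.

Lemma infix_seg z s L s' L' : s <= s' -> s' + L'%:Z <= s + L%:Z ->
  infix (seg z s' L') (seg z s L).
Proof.
move=> h1 h2; pose a := absz (s' - s); pose b := (L - (a + L'))%N.
have eL : L = (a + (L' + b))%N by rewrite /b /a; lia.
have es : s' = s + a%:Z by rewrite /a; lia.
by rewrite eL seg_cat -es seg_cat infix_infix.
Qed.

Lemma seg_of_infix z s L w : infix w (seg z s L) -> exists s',
  [/\ w = seg z s' (size w), s <= s' & s' + (size w)%:Z <= s + L%:Z].
Proof.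
move=> /infixP[p [q e]].
have eL : L = (size p + (size w + size q))%N.
  by have := congr1 size e; rewrite size_seg !size_cat.
exists (s + (size p)%:Z); rewrite eL in e *.
split; [|by rewrite lerDl|by rewrite !PoszD; lia].
move: e; rewrite !seg_cat => /eqP; rewrite eqseq_cat ?size_seg // => /andP[_].
by rewrite eqseq_cat ?size_seg // => /andP[/eqP-> _].
Qed.

Lemma count_seg_shift P z s d L :
  (count P (seg z (s + d%:Z) L) <= count P (seg z s L) + d)%N /\
  (count P (seg z s L) <= count P (seg z (s + d%:Z) L) + d)%N.
Proof.
have e1 : count P (seg z s (d + L)) =
    (count P (seg z s d) + count P (seg z (s + d%:Z) L))%N.
  by rewrite seg_cat count_cat.
have e2 : count P (seg z s (d + L)) =
    (count P (seg z s L) + count P (seg z (s + L%:Z) d))%N.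
  by rewrite addnC seg_cat count_cat.
have l1 := count_size P (seg z s d); have l2 := count_size P (seg z (s + L%:Z) d).
by rewrite !size_seg in l1 l2; split; lia.
Qed.

Lemma count_seg_shiftz P z s c L :
  (count P (seg z (s + c) L) <= count P (seg z s L) + `|c|)%N.
Proof.
case: (intP c) => [|d|d].
- by rewrite addr0 addn0.
- by have [] := count_seg_shift P z s d.+1 L.
- have [_] := count_seg_shift P z (s - d.+1%:Z) d.+1 L.
  by rewrite subrK abszN.
Qed.

Lemma visits_cat S z s L1 L2 :
  visits S z s (L1 + L2) = (visits S z s L1 + visits S z (s + L1%:Z) L2)%N.
Proof.
rewrite /visits iotaD count_cat add0n (iota_shift L1) count_map; congr (_ + _)%N.
by apply: eq_count => j /=; rewrite PoszD addrA.
Qed.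

Lemma visits_sh S c z s L :
  visits [set z | S (sh z c)] z s L = visits S z (s + c) L.
Proof.
by apply: eq_count => j /=; rewrite shD addrC addrAC.
Qed.

Lemma count_seg_visits P z s L :
  count P (seg z s L) = visits [set z | P (z 0)] z s L.
Proof.
rewrite /seg count_map; apply: eq_count => j /=.
by rewrite asboolb /sh add0r.
Qed.

End Points.

Section Frequencies.
Variables (R : realType) (A : finType) (sigma : A -> seq A) (B C : {set A}) (k : nat).
Local Notation D := (B :\: C)%SET.
Local Notation sw n := (iter n (subst_word sigma)).
Local Notation sp n := (subst_pow sigma n).
Local Notation nD := (count (mem D)).
Local Notation Lg := (lang sigma B).
Local Notation XS := (subshift sigma B).
Implicit Types (z : fullshift A) (s c : int) (L m : nat) (w : seq A)
  (S : set (fullshift A)).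

Lemma lang_seg z s L : XS z -> Lg (seg z s L).
Proof.
move=> Xz; have := Xz (absz s + L).+1 isT; apply: lang_infix.
by rewrite window_seg; apply: infix_seg; lia.
Qed.

Lemma subshift_sh z c : XS z -> XS (sh z c).
Proof. by move=> Xz i i0; rewrite window_seg seg_sh; exact: lang_seg. Qed.

(* [S] is visited with density [f] relative to the visits to the letters of
   [D], uniformly over all segments of all points. *)
Definition freq S (f : R) := 0 <= f /\ forall eps, 0 < eps ->
  exists c : R, 0 <= c /\ forall z s L, XS z ->
    (visits S z s L)%:R <= (f + eps) * (nD (seg z s L))%:R + c /\
    f * (nD (seg z s L))%:R <= (visits S z s L)%:R + eps * (nD (seg z s L))%:R + c.

Lemma freq_ext S1 S2 f : (forall z, XS z -> (S1 z <-> S2 z)) ->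
  freq S1 f -> freq S2 f.
Proof.
move=> h [f0 hf]; split=> // eps eps0; have [c [c0 hc]] := hf _ eps0.
exists c; split=> // z s L Xz; have := hc z s L Xz.
suff -> : visits S2 z s L = visits S1 z s L by [].
apply: eq_count => j /=; apply: asbool_equiv_eq; split => g.
  by apply/(h _ (subshift_sh _ Xz)).
by apply/(h _ (subshift_sh _ Xz)).
Qed.

Lemma freq_set0 : freq set0 0.
Proof.
split=> // eps eps0; exists 0; split=> // z s L _; rewrite /visits.
rewrite (eq_count (a2 := pred0)); last by move=> j /=; rewrite asboolF.
by rewrite count_pred0 add0r addr0 mul0r mulr_ge0 //= ?add0r ?addr0 ?mulr_ge0 // ltW.
Qed.

Lemma freq_D : freq [set z | z 0 \in D] 1.
Proof.
split=> // eps eps0; exists 0; split=> // z s L _.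
rewrite -(count_seg_visits (mem D)) mul1r mulrDl mul1r !addr0.
by rewrite lerDl mulr_ge0 // ltW.
Qed.

Lemma freq_union S1 S2 f1 f2 : S1 `&` S2 = set0 -> freq S1 f1 -> freq S2 f2 ->
  freq (S1 `|` S2) (f1 + f2).
Proof.
move=> S12 [f10 h1] [f20 h2]; split=> [|eps eps0]; first exact: addr_ge0.
have eps2 : 0 < eps / 2 by lra.
have [c1 [c10 hc1]] := h1 _ eps2; have [c2 [c20 hc2]] := h2 _ eps2.
exists (c1 + c2); split=> [|z s L Xz]; first exact: addr_ge0.
have -> : visits (S1 `|` S2) z s L = (visits S1 z s L + visits S2 z s L)%N.
  rewrite /visits -count_predUI -[LHS]addn0; congr (_ + _)%N.
    by apply: eq_count => j /=; exact: asbool_or.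
  rewrite (eq_count (a2 := pred0)) ?count_pred0 // => j /=.
  apply/negbTE/negP => /andP[/asboolP a /asboolP b].
  by have : (S1 `&` S2) (sh z (s + j%:Z)) by []; rewrite S12.
have [a1 a2] := hc1 z s L Xz; have [b1 b2] := hc2 z s L Xz.
by rewrite natrD; split; lra.
Qed.

Lemma freq_shift S f c : freq S f -> freq [set z | S (sh z c)] f.
Proof.
move=> [f0 hf]; split=> // eps eps0; have [e [e0 he]] := hf _ eps0.
pose a : R := (`|c|%N)%:R.
have a0 : 0 <= a by [].
have fa : 0 <= f * a by rewrite mulr_ge0.
have ea : 0 <= eps * a by rewrite mulr_ge0 // ltW.
exists (e + f * a + eps * a); split=> [|z s L Xz]; first by rewrite !addr_ge0.
rewrite visits_sh; have [h1 h2] := he z (s + c) L Xz.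
have := count_seg_shiftz (mem D) z s c L.
have := count_seg_shiftz (mem D) z (s + c) (- c) L.
rewrite addrK abszN -!(ler_nat R) !natrD -/a.
set N := _%:R; set M := _%:R => l1 l2.
have q1 : f * M <= f * (N + a) by rewrite ler_wpM2l.
have q2 : eps * M <= eps * (N + a) by rewrite ler_wpM2l // ltW.
have q3 : f * N <= f * (M + a) by rewrite ler_wpM2l.
by move: h1 h2; rewrite -/N -/M => h1 h2; split; lra.
Qed.

Hypothesis sB : forall a, a \in B -> word_on B (sigma a).
Hypothesis sC : forall a, a \in C -> word_on C (sigma a).
Hypothesis k_gt0 : (0 < k)%N.
Hypothesis prim : forall a b, a \in D -> b \in B -> b \in sp k a.
Hypothesis grow : forall a, a \in D -> (2 <= nD (sp k a))%N.

Lemma freq_cylinder (d0 : A) w o : (o < size w)%N -> nth d0 w o \in D ->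
  exists f, freq [set z | seg z (- o%:Z) (size w) = w] f.
Proof.
move=> ow woD; have [f f0 hf] := word_frequency R sB sC k_gt0 prim grow woD ow woD.
exists f; split=> // eps eps0; have [c [c0 hc]] := hf _ eps0.
exists c; split=> // z s L Xz; have [h1 h2] := hc _ (lang_seg s L Xz).
set u := seg z s L in h1 h2 *.
set S := [set z | _]; have SE j : S (sh z (s + j%:Z)) <->
    forall i, (i < size w)%N -> z (s + j%:Z - o%:Z + i%:Z) = nth d0 w i.
  rewrite /S /= seg_sh; split => [e i iw|h].
    by rewrite -e nth_seg // [in LHS]addrAC; congr (z _); lia.
  apply: (@eq_from_nth _ d0); rewrite size_seg // => i iw; rewrite nth_seg // -h //.
  by congr (z _); lia.
have l1 : (visits S z s L <= occ_out d0 w o u)%N.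
  rewrite /visits /occ_out size_seg; apply: leq_count_in => j.
  rewrite mem_iota add0n => /= jL /asboolP/SE h; apply/fitsP => i iw g1 g2.
  rewrite size_seg in g2; rewrite nth_seg // -h //; congr (z _); lia.
have l2 : (occ_in d0 w o u <= visits S z s L)%N.
  rewrite /visits /occ_in size_seg; apply: leq_count_in => j.
  rewrite mem_iota add0n => /= jL /andP[/andP[g1 g2] /fitsP h].
  apply/asboolP/SE => i iw; rewrite size_seg in g2.
  have := h i iw; rewrite size_seg => <-; [|lia|lia].
  by rewrite nth_seg; [congr (z _); lia|lia].
move: l1 l2; rewrite -!(ler_nat R) => l1 l2.
by split; lra.
Qed.

Lemma freq_window m w : has (mem D) w -> size w = m.*2.+1 ->
  exists f, freq [set z | window z m = w] f.
Proof.
move=> wD sw; have [d0 _] : exists d0 : A, true by case: w wD {sw} => // a; exists a.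
(* The first new letter of [w] is the marked one; a shift then moves the origin back to the centre
   of the window. *)
have ow : (find (mem D) w < size w)%N by rewrite -has_find.
have [f hf] := @freq_cylinder d0 w _ ow (nth_find d0 wD).
exists f; have := freq_shift ((find (mem D) w)%:Z - m%:Z) hf.
apply: freq_ext => z _ /=; rewrite seg_sh window_seg sw.
by have -> : - (find (mem D) w)%:Z + ((find (mem D) w)%:Z - m%:Z) = - m%:Z by lia.
Qed.

Lemma freq_windows m (W : seq (seq A)) : uniq W ->
  (forall w, w \in W -> has (mem D) w /\ size w = m.*2.+1) ->
  exists f, freq [set z | window z m \in W] f.
Proof.
elim: W => [|w W IH] /= => [_ _|/andP[wW uW] hW].
  by exists 0; apply: freq_ext freq_set0 => z _; rewrite /= in_nil.
have [|f hf] := IH uW; first by move=> v vW; apply: hW; rewrite inE vW orbT.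
have [wD sw] := hW w (mem_head _ _); have [g hg] := freq_window wD sw.
exists (g + f); apply: freq_ext (freq_union _ hg hf).
  move=> z _ /=; rewrite inE; split => [[->|->]|/orP[/eqP|]]; rewrite ?eqxx ?orbT //.
    by left.
  by right.
by apply/seteqP; split => // z [/= zw]; rewrite zw (negPf wW).
Qed.

Definition near_D m z := has (mem D) (window z m).

(** Such a set is a finite disjoint union of cylinders over windows that contain a new letter. *)
Lemma freq_local m S :
  (forall z z', XS z -> XS z' -> window z m = window z' m -> S z -> S z') ->
  (forall z, XS z -> S z -> near_D m z) -> exists f, freq S f.
Proof.
move=> Sloc SD.
pose good (w : seq A) := `[< exists z, [/\ XS z, S z & window z m = w] >].
pose W := [seq w <- [seq val t | t : (m.*2.+1).-tuple A] | good w].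
have [||f hf] := @freq_windows m W.
- by rewrite filter_uniq // map_inj_uniq ?enum_uniq //; exact: val_inj.
- move=> w; rewrite mem_filter => /andP[/asboolP[z [Xz Sz <-]] _].
  by rewrite window_seg size_seg -window_seg; split=> //; exact: SD.
exists f; apply: freq_ext hf => z Xz /=; rewrite mem_filter; split.
  move=> /andP[/asboolP[z' [Xz' Sz' e]] _]; exact: Sloc Sz'.
move=> Sz; apply/andP; split; first by apply/asboolP; exists z.
have sz : size (window z m) == m.*2.+1 by rewrite window_seg size_seg.
by apply/mapP; exists (Tuple sz) => //; rewrite mem_enum.
Qed.

(** A new letter of a point lies in a block [sp M b] with [b] in [D], and for large [M] all these
    blocks have [K] new letters. *)
Lemma many_D K : exists L0 : nat, forall z (j : int), XS z -> z j \in D ->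
  (K <= nD (seg z (j - L0%:Z) L0.*2.+1))%N.
Proof.
have [M hM] := nD_sp_large sB sC k_gt0 prim grow K.
exists (maxlen sigma M) => z j Xz zj; set L0 := maxlen sigma M.
have eL : L0.*2.+1 = (L0 + (1 + L0))%N by lia.
have e : seg z (j - L0%:Z) L0.*2.+1 =
    seg z (j - L0%:Z) L0 ++ z j :: seg z (j + 1) L0.
  by rewrite eL !seg_cat subrK /= addr0.
have := lang_seg (j - L0%:Z) L0.*2.+1 Xz; rewrite e => Lz.
have [||b bD bi] := lang_blockD sB sC (m := M) zj Lz; rewrite ?size_seg //.
apply: leq_trans (hM M b (leqnn M) bD) _.
by have /infixP[p [q ->]] := bi; rewrite !count_cat; lia.
Qed.

Lemma point_dense z w (j : int) : XS z -> z j \in D -> Lg w ->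
  exists s, w = seg z s (size w).
Proof.
move=> Xz zj /(lang_dense sB sC prim)[m hm].
have eL : m.*2.+1 = (m + (1 + m))%N by lia.
have e : seg z (j - m%:Z) m.*2.+1 = seg z (j - m%:Z) m ++ z j :: seg z (j + 1) m.
  by rewrite eL !seg_cat subrK /= addr0.
have := lang_seg (j - m%:Z) m.*2.+1 Xz; rewrite e => Lz.
have := hm _ _ _ zj Lz; rewrite !size_seg => /(_ (leqnn _) (leqnn _)).
by rewrite -e => /seg_of_infix[s [-> _ _]]; exists s; rewrite size_seg.
Qed.

Section Comparison.
Variables (z0 : fullshift A) (j0 : int).
Hypotheses (Xz0 : XS z0) (z0D : z0 j0 \in D).

(** The inequality is read off along segments of [z0] with arbitrarily many new letters, against
    which the additive constants are negligible. *)
Lemma freq_sum_le (I : Type) (r : seq I) (F : I -> set (fullshift A)) (fF : I -> R)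
    S f : freq S f -> (forall i, freq (F i) (fF i)) ->
  (forall z, XS z -> S z -> exists2 i, List.In i r & F i z) ->
  f <= \sum_(i <- r) fF i.
Proof.
move=> [f0 hf] hF cover; rewrite leNgt; apply/negP => lt.
set g := \sum_(i <- r) fF i in lt.
(* One [eps] for each set of the cover and one for [S] use up half of the gap. *)
pose eps := (f - g) / (2 * (1 + (size r)%:R)).
have sr : 0 <= (size r)%:R :> R by [].
have eps0 : 0 < eps by rewrite divr_gt0 ?subr_gt0 // mulr_gt0 // ltr_pwDl.
have hsum : exists c : R, forall z s L, XS z ->
    \sum_(i <- r) (visits (F i) z s L)%:R <=
      (g + (size r)%:R * eps) * (nD (seg z s L))%:R + c.
  rewrite /g; elim: (r) => [|i t [c IH]].
    by exists 0 => z s L _; rewrite !big_nil !mul0r !addr0 mul0r.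
  have [_ /(_ _ eps0)[ci [ci0 hci]]] := hF i.
  exists (c + ci) => z s L Xz; rewrite !big_cons /= -natr1.
  by have := IH z s L Xz; have [+ _] := hci z s L Xz; lra.
have [c1 hc1] := hsum; have [c2 [c20 hc2]] := hf _ eps0.
have key s L : (f - g) / 2 * (nD (seg z0 s L))%:R <= c1 + c2.
  have le : (visits S z0 s L)%:R <= \sum_(i <- r) (visits (F i) z0 s L)%:R :> R.
    rewrite -natr_sum ler_nat /visits; elim: (iota 0 L) => //= j t IH.
    under eq_bigr do rewrite /=.
    rewrite big_split /=; apply: leq_add => //.
    case: asboolP => // Sj; have [i ir Fi] := cover _ (subshift_sh _ Xz0) Sj.
    elim: (r) ir => //= i' r' IH' [->|/IH' h]; rewrite big_cons.
      by case: asboolP.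
    exact: leq_trans h (leq_addl _ _).
  have := hc1 z0 s L Xz0; have [_] := hc2 z0 s L Xz0.
  have e : (size r)%:R * eps = (f - g) / 2 - eps.
    by rewrite /eps; field; rewrite gt_eqF // ltr_pwDl.
  rewrite e; lra.
pose K := (Num.bound ((c1 + c2) / ((f - g) / 2))).
have [L0 hL0] := many_D K.
have fg : 0 < (f - g) / 2 by rewrite divr_gt0 ?subr_gt0.
have h1 := key (j0 - L0%:Z) L0.*2.+1; have h2 := hL0 z0 j0 Xz0 z0D.
have : (f - g) / 2 * K%:R <= c1 + c2.
  by apply: le_trans h1; rewrite ler_wpM2l ?ler_nat // ltW.
rewrite mulrC -ler_pdivlMr // leNgt => /negP; apply.
apply: archi_boundP; apply: divr_ge0; last exact: ltW.
by apply: le_trans (key 0 0%N); rewrite mulr0.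
Qed.

Lemma freq_le S1 S2 f1 f2 : freq S1 f1 -> freq S2 f2 ->
  (forall z, XS z -> S1 z -> S2 z) -> f1 <= f2.
Proof.
move=> h1 h2 h12.
have := @freq_sum_le unit [:: tt] (fun=> S2) (fun=> f2) S1 f1 h1 (fun=> h2).
rewrite big_seq1; apply => z Xz /(h12 _ Xz) ?.
by exists tt => //; left.
Qed.

Lemma freq_uniq S f1 f2 : freq S f1 -> freq S f2 -> f1 = f2.
Proof.
by move=> h1 h2; apply/le_anti; rewrite (freq_le h1 h2) ?(freq_le h2 h1).
Qed.

End Comparison.

End Frequencies.

(** * Topology of subshifts *)

(** Otherwise the differences of [K] and [O m] generate a filter with a cluster point in [K], which
    lies in some [O m]. *)
Lemma compact_increasing (T : topologicalType) (K : set T) (O : nat -> set T) :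
  compact K -> (forall m, open (O m)) ->
  (forall m n, (m <= n)%N -> O m `<=` O n) ->
  K `<=` \bigcup_m O m -> exists m, K `<=` O m.
Proof.
move=> cK oO mO KO; apply: contrapT => hn.
pose F := filter_from [set: nat] (fun m => K `\` O m).
have PF : ProperFilter F.
  apply: filter_from_proper; last first.
    move=> m _; apply: contrapT => /set0P/negP; rewrite negbK => /eqP h.
    by apply: hn; exists m; rewrite -setD_eq0.
  apply: filter_from_filter; first by exists 0%N.
  move=> i j _ _; exists (maxn i j) => // x [Kx Ox]; split; split=> // h; apply: Ox.
    by apply: mO h; exact: leq_maxl.
  by apply: mO h; exact: leq_maxr.
have [|x [Kx clx]] := cK F PF; first by exists 0%N => // x [].
have [m _ Omx] := KO x Kx.
have [|y [[_ nO] Oy]] := clx (K `\` O m) (O m) _ (open_nbhs_nbhs (conj (oO m) Omx)).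
  by exists m.
exact: nO.
Qed.

Section Topology.
Variable A : finType.
Implicit Types (z : fullshift A) (m : nat) (S : set (fullshift A)).

Lemma nbhs_coord z (k : int) : nbhs z [set z' : fullshift A | z' k = z k].
Proof.
have := @proj_continuous int (fun=> discrete_topology A) k z [set a | a = z k].
apply; exact: (@discrete_set1 (discrete_topology A) (z k)).
Qed.

Lemma nbhs_windowP z (P : set (fullshift A)) :
  nbhs z P <-> exists m, forall z', window z' m = window z m -> P z'.
Proof.
split=> [Pz|[m hm]]; last first.
  have h (s : seq int) : nbhs z [set z' : fullshift A | {in s, forall k, z' k = z k}].
    elim: s => [|k s IH]; first by apply: filterS filterT => z' _ k.
    apply: filterS (filterI (nbhs_coord z k) IH) => z' [/= e1 e2] l.
    by rewrite inE => /orP[/eqP->//|/e2].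
  apply: filterS (h [seq i%:Z - m%:Z | i <- iota 0 m.*2.+1]) => z' e.
  apply: hm; apply/windowP => k km; apply: e; apply/mapP.
  by exists (absz (k + m%:Z)); rewrite ?mem_iota; lia.
pose F := filter_from [set: nat] (fun m => [set z' | window z' m = window z m]).
suff : F --> z by move=> /(_ P Pz)[m _ h]; exists m.
have FF : Filter F.
  apply: filter_from_filter; first by exists 0%N.
  move=> i j _ _; exists (maxn i j) => // x /= e; split; move: e; apply: window_le.
    exact: leq_maxl.
  exact: leq_maxr.
apply/cvg_sup => k Q [_ [[V oV <-] /= Vz VQ]].
exists (absz k) => // z' /windowP/(_ k (leqnn _)) e.
by apply: VQ; rewrite /= /proj e.
Qed.

Definition local m S := forall z z', window z m = window z' m -> S z -> S z'.

Lemma local_open m S : local m S -> open S.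
Proof.
move=> lS; rewrite openE => z Sz; apply/nbhs_windowP; exists m => z' e.
exact: lS (esym e) Sz.
Qed.

Lemma local_closed m S : local m S -> closed S.
Proof.
move=> lS z clz; have [|z' [Sz' e]] := clz [set z' | window z' m = window z m].
  by apply/nbhs_windowP; exists m.
exact: lS e Sz'.
Qed.

Lemma compact_fullshift : compact [set: fullshift A].
Proof.
have := @tychonoff int (fun=> discrete_topology A) (fun=> setT).
rewrite (_ : [set f | _] = setT); last by apply/seteqP; split.
apply=> _; apply: finite_compact; exact: (@finite_finset A).
Qed.

Lemma closed_subshift sigma (B : {set A}) : closed (subshift sigma B).
Proof.
move=> z clz i i0; have [|z' [Xz' /= <-]] := clz [set z' | window z' i = window z i].
  by apply/nbhs_windowP; exists i.
exact: Xz'.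
Qed.

Lemma compact_local sigma (B : {set A}) m S : local m S ->
  compact (subshift sigma B `&` S).
Proof.
move=> lS; apply: (subclosed_compact _ compact_fullshift) => //.
by apply: closedI; [exact: closed_subshift | exact: local_closed lS].
Qed.

Section Subspace.
Variable Y : set (fullshift A).
Implicit Types y : Y.

Lemma nbhs_subP y (P : set Y) : nbhs y P <->
  exists m, forall y', window (\val y') m = window (\val y) m -> P y'.
Proof.
split=> [[_ [[V oV <-] /= Vy VP]]|[m hm]].
  have /nbhs_windowP[m hm] : nbhs (\val y) V by exact: open_nbhs_nbhs.
  by exists m => y' /hm Vy'; exact: VP.
exists [set y' | window (\val y') m = window (\val y) m]; split => //.
exists [set z | window z m = window (\val y) m] => //.
by apply: (@local_open m) => z z' /= <-.
Qed.

Lemma local_open_sub m (S : set Y) :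
  (forall y y', window (\val y) m = window (\val y') m -> S y -> S y') -> open S.
Proof.
move=> lS; exists [set z | exists2 y, S y & window (\val y) m = window z m].
  by apply: (@local_open m) => z z' e [y Sy ey]; exists y; rewrite ?ey.
by apply/seteqP; split => [y [y' Sy' e]|y Sy]; [exact: lS e Sy'|exists y].
Qed.

Lemma compact_preimage_val S : S `<=` Y -> compact S -> compact (\val @^-1` S : set Y).
Proof.
move=> SY cS F PF FS.
have PG : ProperFilter ((\val : Y -> fullshift A) @ F) by exact: fmap_proper_filter.
have [|z [Sz clz]] := cS ((\val : Y -> fullshift A) @ F) PG; first exact: FS.
exists (exist _ z (mem_set (SY _ Sz))); split => // P Q FP /nbhs_subP[m hm].
have [||z' [[y Py <-] e]] := clz (\val @` P) [set z' | window z' m = window z m].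
- by rewrite /fmap /=; apply: filterS FP => y Py; exists y.
- by apply/nbhs_windowP; exists m.
by exists y; split => //; apply: hm.
Qed.

(** Compact sets are closed: windows of one fixed radius distinguish all points of [K] from a given
    point outside. *)
Lemma compact_borel (p : Y) (K : set Y) : compact K -> measurable (K : set (borel p)).
Proof.
move=> cK; rewrite -[K]setCK; apply: (@measurableC _ (borel p)).
apply: sub_sigma_algebra; rewrite openE => y nKy; apply/nbhs_subP.
have [|||m hm] := @compact_increasing Y K
  (fun m => [set y' | window (\val y') m <> window (\val y) m]) cK.
- by move=> m; apply: (@local_open_sub m) => y1 y2 /= ->.
- by move=> m n mn y' /= h /(window_le mn).
- move=> y' Ky'; apply: contrapT => h; apply: nKy; suff <- : y' = y by [].
  apply: val_inj; apply/funext => j; apply: contrapT => yj; apply: h.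
  by exists (absz j) => // /windowP/(_ j (leqnn _)).
by exists m => y' e /hm; exact.
Qed.

End Subspace.

End Topology.

Section CompactOpenRing.
Variables (A : finType) (D : {set A}) (Y : set (fullshift A)).
Implicit Types (S : set Y) (m : nat).

Definition local_sub m S := forall y y' : Y,
  window (\val y) m = window (\val y') m -> S y -> S y'.

Definition near_sub m : set Y := [set y | has (mem D) (window (\val y) m)].

(** Bounding the distance to a letter of [D] is what gives compactness: it keeps the set away from
    the points of the subshift without new letters. *)
Definition compact_open_ring : set (set Y) :=
  [set S | exists m, local_sub m S /\ S `<=` near_sub m].

Lemma local_sub_le m m' S : (m <= m')%N -> local_sub m S -> local_sub m' S.
Proof. by move=> mm lS y y' /(window_le mm); exact: lS. Qed.

Lemma near_sub_le m m' : (m <= m')%N -> near_sub m `<=` near_sub m'.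
Proof.
move=> mm y /hasP[a aw aD]; apply/hasP; exists a => //; move: aw.
by apply: mem_infix; rewrite !window_seg; apply: infix_seg; lia.
Qed.

Lemma near_sub_local m : local_sub m (near_sub m).
Proof. by move=> y y' e; rewrite /near_sub /mkset e. Qed.

Lemma near_sub_ring m : compact_open_ring (near_sub m).
Proof. by exists m; split=> //; exact: near_sub_local. Qed.

Lemma compact_open_ring_both S1 S2 : compact_open_ring S1 -> compact_open_ring S2 ->
  exists m, [/\ local_sub m S1, S1 `<=` near_sub m, local_sub m S2 &
    S2 `<=` near_sub m].
Proof.
move=> [m1 [l1 n1]] [m2 [l2 n2]]; exists (maxn m1 m2).
have h1 := leq_maxl m1 m2; have h2 := leq_maxr m1 m2; split.
- exact: local_sub_le l1.
- exact: subset_trans n1 (near_sub_le h1).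
- exact: local_sub_le l2.
- exact: subset_trans n2 (near_sub_le h2).
Qed.

Lemma compact_open_ring0 : compact_open_ring set0.
Proof. by exists 0%N; split. Qed.

Lemma compact_open_ringI : setI_closed compact_open_ring.
Proof.
move=> S1 S2 h1 h2; have [m [l1 n1 l2 n2]] := compact_open_ring_both h1 h2.
exists m; split=> [y y' e [/(l1 _ _ e) ? /(l2 _ _ e) ?] //|y [/n1]//].
Qed.

Lemma compact_open_ring_open S : compact_open_ring S -> open S.
Proof. by move=> [m [lS _]]; exact: local_open_sub lS. Qed.

Lemma near_sub_mem (y : Y) (j : int) : (\val y : fullshift A) j \in D ->
  near_sub (absz j) y.
Proof.
move=> yj; apply/hasP; exists ((\val y : fullshift A) j) => //.
rewrite window_seg; apply/mapP; exists (absz (j + `|j|%N%:Z)); first by rewrite mem_iota; lia.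
by congr ((\val y : fullshift A) _); lia.
Qed.

Lemma compact_open_semiD : semi_setD_closed compact_open_ring.
Proof.
move=> S1 S2 h1 h2; have [m [l1 n1 l2 n2]] := compact_open_ring_both h1 h2.
have h : compact_open_ring (S1 `\` S2).
  exists m; split=> [y y' e [/(l1 _ _ e) ? n]|y [/n1]//]; split => // h.
  by apply: n; exact: l2 (esym e) h.
exists [set S1 `\` S2]; split.
- exact: finite_set1.
- by move=> _ ->.
- by rewrite bigcup_set1.
- by move=> i j -> ->.
Qed.

End CompactOpenRing.

(* A copy of [Y] carrying the ring of compact open sets, to which the extension
   theorem for contents applies. *)
Definition ring_type (A : finType) (D : {set A}) (Y : set (fullshift A)) (p : Y) :
  Type := Y.

HB.instance Definition _ (A : finType) (D : {set A}) (Y : set (fullshift A)) (p : Y) :=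
  Choice.copy (ring_type D p) Y.
HB.instance Definition _ (A : finType) (D : {set A}) (Y : set (fullshift A)) (p : Y) :=
  isPointed.Build (ring_type D p) p.
HB.instance Definition _ (A : finType) (D : {set A}) (Y : set (fullshift A)) (p : Y) :=
  @isSemiRingOfSets.Build default_measure_display (ring_type D p)
    (@compact_open_ring A D Y) (@compact_open_ring0 A D Y)
    (@compact_open_ringI A D Y) (@compact_open_semiD A D Y).

(** * Integration of inequalities between weighted sums of indicators *)

Section WeightedSums.
Local Open Scope ereal_scope.
Context d (T : measurableType d) (R : realType).
Variable mu : {measure set T -> \bar R}.
Implicit Types s t : seq (R * set T).

Let term (x : R * set T) : T -> R := fun y => (x.1 * \1_(x.2) y)%R.

Let term_ge0 x y : (0 <= x.1)%R -> (0 <= term x y)%R.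
Proof. by move=> x0; rewrite mulr_ge0. Qed.

Let measurable_term x : measurable x.2 -> measurable_fun setT (term x).
Proof. by move=> mx; apply: measurable_realfun.measurable_funM => //; exact: measurable_realfun.measurable_indic. Qed.

Let wsum s : T -> R := fun y => (\sum_(x <- s) term x y)%R.

Let wsum_ge0 s y : (forall x, List.In x s -> 0 <= x.1)%R -> (0 <= wsum s y)%R.
Proof.
rewrite /wsum; elim: s => [|z s IH] h; first by rewrite big_nil.
rewrite big_cons addr_ge0 ?term_ge0 //; first by apply: h; left.
by apply: IH => x xs; apply: h; right.
Qed.

Let measurable_wsum s : (forall x, List.In x s -> measurable x.2) ->
  measurable_fun setT (wsum s).
Proof.
rewrite /wsum; elim: s => [|z s IH] h.
  by under eq_fun do rewrite big_nil; exact: measurable_cst.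
under eq_fun do rewrite big_cons.
apply: measurable_realfun.measurable_funD; first by apply: measurable_term; apply: h; left.
by apply: IH => x xs; apply: h; right.
Qed.

Let integral_wsum s : (forall x, List.In x s -> 0 <= x.1)%R ->
  (forall x, List.In x s -> measurable x.2) ->
  \int[mu]_y (wsum s y)%:E = \sum_(x <- s) x.1%:E * mu x.2.
Proof.
elim: s => [|x s IH] s0 sm.
  rewrite /wsum; under eq_integral do rewrite big_nil.
  by rewrite integral0 big_nil.
have x0 : (0 <= x.1)%R by apply: s0; left.
have mx : measurable x.2 by apply: sm; left.
have s0' z : List.In z s -> (0 <= z.1)%R by move=> zs; apply: s0; right.
have sm' z : List.In z s -> measurable z.2 by move=> zs; apply: sm; right.
have e y : (wsum (x :: s) y)%:E = (term x y)%:E + (wsum s y)%:E.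
  by rewrite /wsum big_cons EFinD.
under eq_integral do rewrite e.
rewrite ge0_integralD //; last 4 first.
- by move=> y _; rewrite lee_fin term_ge0.
- by apply/measurable_realfun.measurable_EFinP; exact: measurable_term.
- by move=> y _; rewrite lee_fin wsum_ge0.
- by apply/measurable_realfun.measurable_EFinP; exact: measurable_wsum.
rewrite IH // big_cons; congr (_ + _).
under eq_integral do rewrite /term EFinM.
by rewrite ge0_integralZl ?integral_indic ?setIT //; exact/measurable_realfun.measurable_EFinP/measurable_realfun.measurable_indic.
Qed.

Lemma weighted_measure_le s t :
  (forall x, List.In x s \/ List.In x t -> 0 <= x.1)%R ->
  (forall x, List.In x s \/ List.In x t -> measurable x.2) ->
  (forall y, \sum_(x <- s) x.1 * \1_(x.2) y <= \sum_(x <- t) x.1 * \1_(x.2) y)%R ->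
  \sum_(x <- s) x.1%:E * mu x.2 <= \sum_(x <- t) x.1%:E * mu x.2.
Proof.
move=> c0 mF h.
have hs0 x : List.In x s -> (0 <= x.1)%R by move=> ?; apply: c0; left.
have ht0 x : List.In x t -> (0 <= x.1)%R by move=> ?; apply: c0; right.
have hsm x : List.In x s -> measurable x.2 by move=> ?; apply: mF; left.
have htm x : List.In x t -> measurable x.2 by move=> ?; apply: mF; right.
rewrite -!integral_wsum //; apply: ge0_le_integral => //.
- by move=> y _; rewrite lee_fin wsum_ge0.
- by apply/measurable_realfun.measurable_EFinP; exact: measurable_wsum.
- by apply/measurable_realfun.measurable_EFinP; exact: measurable_wsum.
- by move=> y _; rewrite lee_fin; exact: h.
Qed.

End WeightedSums.

(** In the application [s] and [v] are the measures of [S] and [base_set], and [e] that of the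
    points seeing a new letter in a segment of length about [L]. The order of the choices matters:
    [K] after [c], so that c <= eps K, and [L] after [c2]. Then c e <= 2 eps L v, and division by
    [L] gives |s - f v| <= 3 eps v. *)
Lemma limit_comparison (R : realType) (s f v : R) : 0 <= v ->
  (forall eps, 0 < eps -> exists c : R, 0 <= c /\ forall K : nat, exists c2 : R,
     forall L : nat, exists e : R, [/\ 0 <= e, K%:R * e <= (L%:R + c2) * v,
       L%:R * s <= L%:R * ((f + eps) * v) + c * e &
       L%:R * (f * v) <= L%:R * s + L%:R * (eps * v) + c * e]) ->
  s = f * v.
Proof.
move=> v0 h.
have key eps : 0 < eps -> `|s - f * v| <= 3 * eps * v.
  move=> eps0; have [c [c0 hc]] := h _ eps0.
  have [K [K0 cK]] : exists K : nat, (0 < K)%N /\ c <= eps * K%:R.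
    exists (Num.bound (c / eps)).+1; split=> //.
    rewrite mulrC -ler_pdivrMr //; apply: ltW.
    apply: lt_le_trans (archi_boundP (divr_ge0 c0 (ltW eps0))) _.
    by rewrite ler_nat.
  have [c2 hc2] := hc K.
  pose L := (Num.bound `|c2|).+1.
  have cL : c2 <= L%:R.
    apply: le_trans (ler_norm _) _; apply: ltW.
    by apply: lt_le_trans (archi_boundP (normr_ge0 _)) _; rewrite ler_nat.
  have [e [e0 he h1 h2]] := hc2 L.
  have L0 : 0 < L%:R :> R by rewrite ltr0n.
  have K0R : 0 < K%:R :> R by rewrite ltr0n.
  have q1 : c * e <= eps * (2 * L%:R * v).
    apply: (@le_trans _ _ (eps * K%:R * e)); first by rewrite ler_wpM2r.
    rewrite -mulrA ler_wpM2l ?(ltW eps0) //; apply: le_trans he _.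
    by rewrite ler_wpM2r //; lra.
  rewrite -(ler_pM2l L0) -{1}(gtr0_norm L0) -normrM ler_norml mulrBr.
  by apply/andP; split; lra.
apply/eqP; rewrite -subr_eq0 -normr_le0; apply/ler_addgt0Pr => eta eta0.
(* The denominator has [v + 1] because [v] may vanish. *)
rewrite add0r; pose eps := eta / (3 * (v + 1)).
have v1 : 0 < v + 1 by rewrite ltr_wpDl.
have eps0 : 0 < eps by rewrite divr_gt0 // mulr_gt0.
apply: le_trans (key _ eps0) _.
have -> : 3 * eps * v = eta * (v / (v + 1)).
  by rewrite /eps; field; rewrite gt_eqF.
rewrite -[leRHS]mulr1 ler_wpM2l ?(ltW eta0) // ler_pdivrMr // mul1r.
by rewrite lerDl.
Qed.

(** * The invariant measure when the new letters multiply *)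

Lemma mem_seg (A : finType) (z : fullshift A) s L c : c \in seg z s L ->
  exists2 i, (i < L)%N & c = z (s + i%:Z).
Proof.
move=> h; have [i iL e] := nthP c h; rewrite size_seg in iL.
by exists i => //; rewrite -e nth_seg.
Qed.

Section ComponentMeasure.
Variables (R : realType) (A : finType) (sigma : A -> seq A) (B C : {set A}) (k : nat).
Local Notation D := (B :\: C)%SET.
Local Notation sp n := (subst_pow sigma n).
Local Notation nD := (count (mem D)).
Local Notation XS := (subshift sigma B).
Hypothesis sB : forall a, a \in B -> word_on B (sigma a).
Hypothesis sC : forall a, a \in C -> word_on C (sigma a).
Hypothesis k_gt0 : (0 < k)%N.
Hypothesis prim : forall a b, a \in D -> b \in B -> b \in sp k a.
Hypothesis grow : forall a, a \in D -> (2 <= nD (sp k a))%N.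
Variables (Y : set (fullshift A)) (p : Y).
Hypothesis YE : Y = [set z | XS z /\ exists j : int, z j \in D].
Local Notation T := (@Tshift_on A Y).
Local Notation ring := (@compact_open_ring A D Y).
Local Notation near := (@near_sub A D Y).
Implicit Types (y : Y) (z : fullshift A) (S : set Y).

Lemma componentP z : Y z -> XS z /\ exists j : int, z j \in D.
Proof. by rewrite YE. Qed.

Lemma component_subshift y : XS (\val y).
Proof. by have [] := componentP (set_valP y). Qed.

Lemma component_letter y : exists j : int, (\val y : fullshift A) j \in D.
Proof. by have [] := componentP (set_valP y). Qed.

Lemma component_intro z (j : int) : XS z -> z j \in D -> Y z.
Proof. by move=> Xz zj; rewrite YE; split => //; exists j. Qed.

Lemma val_Tshift y : \val (T y) = sh (\val y) 1.
Proof.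
rewrite /Tshift_on val_insubd.
have -> : Tshift (\val y) = sh (\val y) 1 by [].
have [j yj] := component_letter y.
rewrite mem_set //; apply: (@component_intro _ (j - 1)).
  exact/subshift_sh/component_subshift.
by rewrite /sh subrK.
Qed.

Lemma val_iter_Tshift j y : \val (iter j T y) = sh (\val y) j%:Z.
Proof.
elim: j => [|j IH]; first by rewrite sh0.
by rewrite iterS val_Tshift IH shD.
Qed.

Lemma ring_preimage S : ring S -> ring (T @^-1` S).
Proof.
move=> [m [lS nS]]; exists m.+1; split.
  move=> y y' e; apply: lS; rewrite !val_Tshift; apply/windowP => l lm.
  by rewrite /sh; move/windowP : e; apply; lia.
move=> y Sy; have : has (mem D) (window (\val (T y)) m) by exact: nS.
rewrite val_Tshift window_seg seg_sh => /hasP[a aw aD]; apply/hasP; exists a => //.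
by move: aw; rewrite window_seg; apply: mem_infix; apply: infix_seg; lia.
Qed.

Lemma ring_preimage_iter j S : ring S -> ring (iter j T @^-1` S).
Proof. by elim: j S => // j IH S rS; exact: (IH (T @^-1` S) (ring_preimage rS)). Qed.

(** An open set is the countable union, over [m], of the sets of its points that see a new letter in
    the window of radius [m] and whose cylinder of that radius lies in the open set. *)
Lemma borel_ring : @measurable _ (borel p) = <<s ring >>.
Proof.
rewrite eqEsubset; split; apply: smallest_sub; try exact: smallest_sigma_algebra.
  move=> O oO; have -> : O = \bigcup_m [set y | near_sub D m y /\
      forall y', window (\val y') m = window (\val y) m -> O y'].
    apply/seteqP; split=> [y Oy|y [m _ [_ h]]]; last exact: h.
    have /nbhs_subP[m1 hm1] : nbhs y O by exact: open_nbhs_nbhs.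
    have [j /near_sub_mem yj] := component_letter y.
    exists (maxn m1 (absz j)) => //; split.
      exact: (near_sub_le (leq_maxr _ _)).
    move=> y' e; apply: hm1; apply: window_le e; exact: leq_maxl.
  apply: sigma_algebra_bigcup => m.
  apply: sub_sigma_algebra; exists m; split=> [y y' e [h1 h2]|y []//]; split.
    exact: near_sub_local e h1.
  by move=> y'' e'; apply: h2; rewrite e' e.
move=> S rS; apply: sub_sigma_algebra; exact: compact_open_ring_open rS.
Qed.

Lemma ring_measurable S : ring S -> measurable (S : set (borel p)).
Proof. by move=> rS; rewrite borel_ring; exact: sub_sigma_algebra. Qed.

Lemma measurable_preimage (U : set (borel p)) :
  measurable U -> measurable (T @^-1` U : set (borel p)).
Proof.
move=> mU; have : measurable_fun setT (T : borel p -> borel p).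
  apply: (@measurability _ _ (borel p) (borel p) setT T ring borel_ring) => _ [S rS <-]; rewrite setTI.
  by apply: ring_measurable; exact: ring_preimage.
by move=> /(_ measurableT U mU); rewrite setTI.
Qed.

Lemma image_valE S y : (\val @` S) (\val y) <-> S y.
Proof. by split=> [[y' Sy' /val_inj <-]|Sy] //; exists y. Qed.

Lemma freq_ring S : ring S -> exists f : R, freq sigma B C (\val @` S) f.
Proof.
move=> [m [lS nS]]; apply: (freq_local R sB sC k_gt0 prim grow (m := m)).
  move=> z z' Xz Xz' e [y Sy yz].
  have : has (mem D) (window z' m) by rewrite -e -yz; exact: nS.
  rewrite window_seg => /hasP[a /mapP[j _ ->] jD].
  have Yz' := component_intro Xz' jD.
  by exists (exist _ z' (mem_set Yz')) => //; apply: lS Sy; rewrite /= -e -yz.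
by move=> z Xz [y Sy <-]; exact: nS.
Qed.

Lemma ring_compact S : ring S -> compact S.
Proof.
move=> [m [lS nS]].
pose S' := [set z | exists2 y, S y & window (\val y) m = window z m].
have -> : S = \val @^-1` (XS `&` S').
  apply/seteqP; split=> [y Sy|y [_ [y' Sy' e]]]; last exact: lS e Sy'.
  by split; [exact: component_subshift | exists y].
apply: compact_preimage_val.
  move=> z [Xz [y Sy e]].
  have : has (mem D) (window z m) by rewrite -e; exact: nS.
  by rewrite window_seg => /hasP[a /mapP[j _ ->] jD]; exact: component_intro jD.
by apply: (compact_local (m := m)) => z z' e [y Sy ey]; exists y; rewrite ?ey.
Qed.

Definition base_set : set Y := [set y | (\val y : fullshift A) 0 \in D].

Lemma base_set_ring : ring base_set.
Proof.
exists 0%N; split=> [y y' /windowP/(_ 0 (leqnn _)) e|y]; first by rewrite /base_set /= e.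
exact: near_sub_mem.
Qed.

Lemma image_base_set z : XS z -> (\val @` base_set) z <-> z 0 \in D.
Proof.
move=> Xz; split=> [[y h <-] //|z0].
by exists (exist _ z (mem_set (component_intro Xz z0))).
Qed.

Lemma visits_iter S y (a L : nat) : visits (\val @` S) (\val y) a L =
  count (fun j => `[< S (iter (a + j) T y) >]) (iota 0 L).
Proof.
apply: eq_count => j /=; apply: asbool_equiv_eq.
by rewrite -PoszD -val_iter_Tshift; exact: image_valE.
Qed.

Lemma count_iter y (a L : nat) : nD (seg (\val y) a L) =
  count (fun j => `[< base_set (iter (a + j) T y) >]) (iota 0 L).
Proof.
rewrite (count_seg_visits (mem D)); apply: eq_count => j /=.
by apply: asbool_equiv_eq; rewrite /base_set /= val_iter_Tshift PoszD.
Qed.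

Section InvariantMeasures.
Variable nu : {measure set (borel p) -> \bar R}.
Hypothesis nu_inv : invariant_measure T nu.
Hypothesis nu_radon : radon nu.

Lemma invariant_iter j S : ring S -> nu (iter j T @^-1` S) = nu S.
Proof.
elim: j S => // j IH S rS; have := IH _ (ring_preimage rS).
have -> : iter j T @^-1` (T @^-1` S) = iter j.+1 T @^-1` S by [].
by move=> ->; apply: nu_inv; exact: ring_measurable.
Qed.

Lemma radon_fin S : ring S -> nu S \is a fin_num.
Proof.
by move=> /ring_compact /nu_radon h; rewrite ge0_fin_numE.
Qed.

Let sum_indic (q : R) (F : nat -> set Y) y (L : nat) :
  \sum_(x <- [seq (q, F j) | j <- iota 0 L]) x.1 * \1_(x.2) y =
  q * (count (fun j => `[< F j y >]) (iota 0 L))%:R.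
Proof.
rewrite big_map /=; elim: (iota 0 L) => [|j s IH]; first by rewrite big_nil mulr0.
rewrite big_cons IH /= natrD mulrDr; congr (_ * _ + _).
Qed.

Let sum_measure (q : R) (F : nat -> set Y) (v : \bar R) (L : nat) :
  (forall j, nu (F j) = v) -> v \is a fin_num ->
  (\sum_(x <- [seq (q, F j) | j <- iota 0 L]) x.1%:E * nu x.2)%E =
  (L%:R * (q * fine v))%:E.
Proof.
move=> h vf; rewrite big_map /=.
rewrite (eq_bigr (fun=> (q * fine v)%:E)); last by move=> j _; rewrite h EFinM fineK.
by rewrite sumEFin big_const_seq count_predT size_iota iter_addr_0 mulr_natl.
Qed.

Lemma in_map_pair (q : R) (F : nat -> set Y) s (x : R * set Y) :
  List.In x [seq (q, F j) | j <- s] -> x.1 = q /\ exists j, x.2 = F j.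
Proof.
elim: s => //= j s IH [<-|/IH //]; by split => //; exists j.
Qed.

(* Integrate the bounds of [freq] over orbit segments of length [L]. The constant
   [c] only matters on the set [E] of points seeing a letter of [D]; as such a
   letter has [K] others within distance [L0], [K * nu E] is at most
   [(L + const) * nu base_set], so that this term is negligible. *)
Lemma invariant_freq S (f : R) : ring S -> freq sigma B C (\val @` S) f ->
  nu S = (f%:E * nu base_set)%E.
Proof.
move=> rS [f0 hf]; have nuS := radon_fin rS; have nuD := radon_fin base_set_ring.
have [m [lS nS]] := rS.
rewrite -(fineK nuS) -(fineK nuD) -EFinM; congr EFin.
apply: limit_comparison => [|eps eps0]; first exact: fine_ge0.
have [c [c0 hc]] := hf _ eps0; exists c; split=> // K.
have [L0 hL0] := many_D sB sC k_gt0 prim grow K.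
exists (L0.*2 + m.*2).+1%:R => L.
(* Starting at [L0] leaves the [K] letters around a new letter at nonnegative positions, those
   reached by iterates of [T]. *)
pose E : set Y := [set y | has (mem D) (seg (\val y) L0 (L + m.*2))].
have rE : ring E.
  exists (L0 + (L + m.*2))%N; split=> [y y' /windowP e|y].
    rewrite /E /= (_ : seg (\val y') _ _ = seg (\val y) L0 (L + m.*2)) //.
    by apply/seg_eqP => i il; rewrite e //; lia.
  rewrite /E /= => /hasP[a ay aD]; apply/hasP; exists a => //.
  by move: ay; rewrite window_seg; apply: mem_infix; apply: infix_seg; lia.
have nuE := radon_fin rE.
(* The windows of radius [m] centred at [a], ..., [a + L - 1] stay inside the segment that defines
   [E]. *)
pose a := (m + L0)%N.
pose G j : set Y := iter j T @^-1` base_set.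
have nuG j : nu (G j) = nu base_set by apply: invariant_iter; exact: base_set_ring.
have mG j : measurable (G j : set (borel p)).
  by apply: ring_measurable; apply: ring_preimage_iter; exact: base_set_ring.
pose F j : set Y := iter (a + j) T @^-1` S.
have nuF j : nu (F j) = nu S by exact: invariant_iter.
have mF j : measurable (F j : set (borel p)).
  by apply: ring_measurable; exact: ring_preimage_iter.
have mE : measurable (E : set (borel p)) by exact: ring_measurable.
have notE y : ~ E y -> visits (\val @` S) (\val y) a L = 0%N /\
    nD (seg (\val y) a L) = 0%N.
  move=> nE; split.
    rewrite visits_iter; apply/eqP; rewrite -leqn0 leqNgt -has_count.
    apply/hasPn => j; rewrite mem_iota => /= jL; apply/asboolP => /nS.
    rewrite /near_sub /mkset val_iter_Tshift window_seg seg_sh => /hasP[b bw bD].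
    apply: nE; apply/hasP; exists b => //; move: bw.
    by apply: mem_infix; apply: infix_seg; rewrite /a; move: jL; clear; lia.
  apply/eqP; rewrite -leqn0 leqNgt -has_count; apply/negP => /hasP[b bw bD].
  apply: nE; apply/hasP; exists b => //; move: bw.
  by apply: mem_infix; apply: infix_seg; rewrite /a; clear; lia.
have indE y : \1_E y = (`[< E y >])%:R :> R.
  by rewrite indicE; case: asboolP => h; [rewrite mem_set|rewrite memNset].
exists (fine (nu E)); split; first exact: fine_ge0.
- have := @weighted_measure_le _ (borel p) R nu [:: (K%:R, E)]
    [seq (1, G j) | j <- iota 0 (L + (L0.*2 + m.*2).+1)].
  rewrite big_seq1 /= (sum_measure 1 _ nuG nuD) -(fineK nuE) -EFinM lee_fin natrD mul1r.
  apply.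
  + by move=> x [[<-//|//]|/in_map_pair[-> _]].
  + by move=> x [[<-//|//]|/in_map_pair[_ [j ->]]].
  + move=> y; rewrite big_seq1 sum_indic mul1r /= indE; case: asboolP => [Ey|_]; last first.
      by rewrite mulr0.
    rewrite mulr1 ler_nat -(count_iter y 0).
    move: Ey => /hasP[b /mapP[j jl ->] jD].
    apply: leq_trans (hL0 _ _ (component_subshift y) jD) _.
    move: jl; rewrite mem_iota => /andP[_ jl].
    by apply/count_infix/infix_seg; move: jl; clear; lia.
- have := @weighted_measure_le _ (borel p) R nu [seq (1, F j) | j <- iota 0 L]
    ([seq (f + eps, G (a + j)%N) | j <- iota 0 L] ++ [:: (c, E)]).
  rewrite big_cat big_seq1 (sum_measure 1 _ nuF nuS) /=.
  rewrite (sum_measure (f + eps) _ (fun j => nuG (a + j)%N) nuD) -(fineK nuE) -EFinM -EFinD lee_fin mul1r.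
  apply.
  + move=> x [/in_map_pair[-> _] //|/List.in_app_iff[/in_map_pair[-> _]|[<-//|//]]].
    by rewrite addr_ge0 // ltW.
  + move=> x [/in_map_pair[_ [j ->]] //|/List.in_app_iff[/in_map_pair[_ [j ->]]//|[<-//|//]]].
  + move=> y; rewrite big_cat big_seq1 !sum_indic mul1r /= indE.
    rewrite -(visits_iter S) -(count_iter y a); have [h1 _] := hc _ a L (component_subshift y).
    case: asboolP => [_|/notE[-> ->]]; first by rewrite mulr1.
    by rewrite !mulr0 addr0.
- have := @weighted_measure_le _ (borel p) R nu [seq (f, G (a + j)%N) | j <- iota 0 L]
    ([seq (1, F j) | j <- iota 0 L] ++
     ([seq (eps, G (a + j)%N) | j <- iota 0 L] ++ [:: (c, E)])).
  rewrite !big_cat big_seq1 (sum_measure 1 _ nuF nuS) /=.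
  rewrite (sum_measure f _ (fun j => nuG (a + j)%N) nuD).
  rewrite (sum_measure eps _ (fun j => nuG (a + j)%N) nuD) -(fineK nuE) -EFinM -!EFinD lee_fin mul1r addrA.
  apply.
  + move=> x [/in_map_pair[-> _] //|/List.in_app_iff[/in_map_pair[-> _]//|]].
    by move=> /List.in_app_iff[/in_map_pair[-> _]|[<-//|//]]; exact: ltW.
  + move=> x [/in_map_pair[_ [j ->]] //|/List.in_app_iff[/in_map_pair[_ [j ->]]//|]].
    by move=> /List.in_app_iff[/in_map_pair[_ [j ->]]|[<-//|//]].
  + move=> y; rewrite !big_cat big_seq1 !sum_indic mul1r /= indE.
    rewrite -(visits_iter S) -(count_iter y a); have [_ h2] := hc _ a L (component_subshift y).
    case: asboolP => [_|/notE[-> ->]]; first by rewrite mulr1 addrA.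
    by rewrite !mulr0 !addr0.
Qed.

End InvariantMeasures.

Section Extension.
Let z0 : fullshift A := \val p.
Let j0 : int := sval (cid (component_letter p)).
Let Xz0 : XS z0 := component_subshift p.
Let z0D : z0 j0 \in D := svalP (cid (component_letter p)).

Let freq_le := freq_le (R := R) sB sC k_gt0 prim grow Xz0 z0D.
Let freq_sum_le := freq_sum_le (R := R) sB sC k_gt0 prim grow Xz0 z0D.
Let freq_uniq := freq_uniq (R := R) sB sC k_gt0 prim grow Xz0 z0D.

Definition ring_content (S : set (ring_type D p)) : \bar R :=
  (xget 0 [set f : R | freq sigma B C (\val @` (S : set Y)) f])%:E.

Lemma ring_contentE S (f : R) : freq sigma B C (\val @` S) f -> ring_content S = f%:E.
Proof.
move=> hf; rewrite /ring_content; congr EFin; apply: (freq_uniq _ hf).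
by have := @xgetPex R 0 [set f : R | freq sigma B C (\val @` S) f]; apply; exists f.
Qed.

Lemma ring_content_ge0 S : (0 <= ring_content S)%E.
Proof.
rewrite /ring_content lee_fin; case: xgetP => [f -> [f0 _]|_] //.
Qed.

Lemma freq_bigU (F : nat -> set Y) (f : nat -> R) n :
  trivIset setT F -> (forall i, freq sigma B C (\val @` F i) (f i)) ->
  freq sigma B C (\val @` (\big[setU/set0]_(i < n) F i)) (\sum_(i < n) f i).
Proof.
move=> tF hf; elim: n => [|n IH].
  by rewrite !big_ord0 image_set0; exact: freq_set0.
rewrite !big_ord_recr /= image_setU; apply: freq_union => //.
apply/seteqP; split=> // z [[y Fy <-] [y' Fny /val_inj e]]; move: Fy; rewrite -e.
rewrite -bigcup_mkord => -[i /= ilt Fi].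
have /trivIsetP/(_ i n I I) := tF; rewrite neq_ltn ilt => /(_ isT) h.
by have : (F i `&` F n) y' by []; rewrite h.
Qed.

Lemma ring_content_additive : measure_function.semi_additive ring_content.
Proof.
move=> F n mF tF mU; have hf i := cid (freq_ring (mF i)).
rewrite (@ring_contentE _ _ (@freq_bigU F (fun i => sval (hf i)) n tF (fun i => svalP (hf i)))).
by rewrite -sumEFin; apply: eq_bigr => i _; rewrite (ring_contentE (svalP (hf i))).
Qed.

(** Members of the ring are compact and open, so a countable cover has a finite subcover, to which
    the comparison of frequencies applies. *)
Lemma ring_content_subadditive : measurable_subset_sigma_subadditive ring_content.
Proof.
move=> S F mF mS SF; have hf i := cid (freq_ring (mF i)).
have [f fS] := freq_ring mS; rewrite (ring_contentE fS).
have [|||m hm] := @compact_increasing Y S (fun m => \bigcup_(i < m) F i)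
  (ring_compact mS).
- by move=> m; apply: bigcup_open => i _; exact: compact_open_ring_open (mF i).
- by move=> m m' mm x [i /= im Fi]; exists i => //=; exact: leq_trans mm.
- by move=> x /SF[i _ Fi]; exists i.+1 => //; exists i => //=.
apply: (@le_trans _ _ (\sum_(0 <= i < m) ring_content (F i))%E); last first.
  by apply: nneseries_lim_ge => i _ _; exact: ring_content_ge0.
rewrite (eq_bigr (fun i => (sval (hf i))%:E)); last first.
  by move=> i _; rewrite (ring_contentE (svalP (hf i))).
rewrite sumEFin lee_fin; apply: (freq_sum_le fS (fun i => svalP (hf i))).
move=> z _ [y /hm[i im Fi] <-]; exists i; last by exists y.
move: im; rewrite /= /index_iota subn0 => im.
have : i \in iota 0 m by rewrite mem_iota.
by elim: (iota 0 m) => //= j s IH; rewrite inE => /predU1P[->|/IH]; [left|right].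
Qed.

Lemma exists_component_measure : exists mu : {measure set (borel p) -> \bar R},
  forall S f, ring S -> freq sigma B C (\val @` S) f -> mu S = f%:E.
Proof.
pose M0 : {content set (ring_type D p) -> \bar R} := HB.pack ring_content
  (isContent.Build _ _ _ ring_content ring_content_ge0 ring_content_additive).
pose M : {measure set (ring_type D p) -> \bar R} := HB.pack ring_content M0
  (Content_SigmaSubAdditive_isMeasure.Build _ _ _ M0 ring_content_subadditive).
(* The Caratheodory extension lives on the sigma-algebra generated by the ring, which is the Borel
   one by [borel_ring]; the same function is repackaged on [borel p]. *)
pose mu0 : set (borel p) -> \bar R := measure_extension M.
have mu00 : mu0 set0 = 0%E by exact: (measure0 (measure_extension M)).
have mu0_ge0 U : (0 <= mu0 U)%E by exact: (measure_ge0 (measure_extension M)).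
have mE (U : set (borel p)) : measurable U ->
    measurable (U : set (g_sigma_algebraType (@measurable _ (ring_type D p)))).
  by rewrite borel_ring.
have mu0_sigma : semi_sigma_additive mu0.
  move=> F mF tF mU; apply: (@measure_semi_sigma_additive _ _ _ (measure_extension M)) => //.
    by move=> i; exact: mE.
  exact: mE.
pose mu : {measure set (borel p) -> \bar R} :=
  HB.pack mu0 (isMeasure.Build _ _ _ mu0 mu00 mu0_ge0 mu0_sigma).
exists mu => S f rS fS; rewrite -(ring_contentE fS).
exact: (@measurable_mu_extE _ _ _ M).
Qed.

Lemma ring_unique (m1 m2 : {measure set (borel p) -> \bar R}) :
  (forall S, ring S -> m1 S = m2 S) -> (forall S, ring S -> (m1 S < +oo)%E) ->
  forall U, measurable U -> m1 U = m2 U.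
Proof.
move=> h fin.
apply: (@measure_unique _ R (borel p) (ring : set (set (borel p)))
  (near : nat -> set (borel p)) borel_ring).
- exact: compact_open_ringI.
- by move=> i; exact: near_sub_ring.
- apply/seteqP; split=> // y _; have [j yj] := component_letter y.
  by exists (absz j) => //; exact: near_sub_mem yj.
- exact: h.
- by move=> i; apply: fin; exact: near_sub_ring.
Qed.

Lemma freq_preimage S (f : R) : freq sigma B C (\val @` S) f ->
  freq sigma B C (\val @` (T @^-1` S)) f.
Proof.
move=> /(freq_shift 1); apply: freq_ext => z Xz; split.
  move=> [y Sy e]; have [j yj] := component_letter y.
  have zj : z (j + 1) \in D by move: yj; rewrite e.
  exists (exist _ z (mem_set (component_intro Xz zj))) => //=.
  have -> // : T (exist _ z (mem_set (component_intro Xz zj))) = y.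
  by apply: val_inj; rewrite val_Tshift -e.
by move=> [y /= Sy <-]; exists (T y) => //; rewrite val_Tshift.
Qed.

Lemma preimage_measure (mu : {measure set (borel p) -> \bar R}) :
  exists nu : {measure set (borel p) -> \bar R}, forall U, nu U = mu (T @^-1` U).
Proof.
have mT : measurable_fun setT (T : borel p -> borel p).
  by move=> _ U mU; rewrite setTI; exact: measurable_preimage.
by exists (measure_function_pushforward__canonical__measure_function_Measure mu mT).
Qed.

Lemma freq_base_set : freq sigma B C (\val @` base_set) (1 : R).
Proof.
apply: freq_ext (freq_D _ _ _ _) => z Xz; split=> [h|]; first exact/image_base_set.
by move=> /(image_base_set Xz).
Qed.

(* A block [sp m0 b] with [b] in [D] lies entirely within [maxlen m0] of a
   letter of [D]. *)
Lemma visits_near m0 z v s L : XS z -> all (mem B) v ->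
  seg z s L = iter m0 (subst_word sigma) v ->
  (\sum_(b <- v | b \in D) size (sp m0 b) <=
    visits (\val @` near (maxlen sigma m0)) z s L)%N.
Proof.
move=> Xz; elim: v s L => [|b v IH] s L vB e; first by rewrite big_nil.
move: vB => /= /andP[bB vB].
have eL : L = (size (sp m0 b) + size (iter m0 (subst_word sigma) v))%N.
  have := congr1 size e; rewrite size_seg -cat1s sw_cat size_cat => {1}->.
  by [].
move: e; rewrite -cat1s sw_cat eL seg_cat => /eqP.
rewrite eqseq_cat ?size_seg // => /andP[/eqP e1 /eqP e2].
rewrite big_cons visits_cat; have := IH _ _ vB e2.
case: ifP => bD h; last exact: leq_trans h (leq_addl _ _).
apply: leq_add => //; rewrite /visits.
rewrite (_ : count _ _ = size (iota 0 (size (sp m0 b)))); first by rewrite size_iota.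
apply/eqP; rewrite -all_count; apply/allP => j; rewrite mem_iota add0n => /= jl.
apply/asboolP.
have [i il iD] : exists2 i, (i < size (sp m0 b))%N & z (s + i%:Z) \in D.
  have h0 : has (mem D) (seg z s (size (sp m0 b))).
    by rewrite e1 has_count; exact: (nD_sp_pos sB sC k_gt0 prim).
  by have /hasP[c /mem_seg[i il ->] iD] := h0; exists i.
have lm := leq_maxlen sigma b (leqnn m0).
have zD : sh z (s + j%:Z) (i%:Z - j%:Z) \in D.
  by rewrite /sh (_ : _ + _ = s + i%:Z) //; lia.
pose y : Y := exist (fun z' => z' \in Y) _ (mem_set (component_intro (subshift_sh (s + j%:Z) Xz) zD)).
exists y => //; apply: near_sub_le (near_sub_mem (y := y) zD).
by move: il jl lm; clear; lia.
Qed.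

(** Along the word [sp N.+1 a0], which occurs in [z0], there are at most as many visits as letters,
    hence at most [c] times the number of new letters. *)
Lemma near_freq_bounded (c : R) :
  (forall m b, b \in D -> (size (sp m b))%:R <= c * (nD (sp m b))%:R) ->
  forall M f, freq sigma B C (\val @` near M) f -> f <= c + 1.
Proof.
move=> hc M f [f0 hf]; have [e [e0 he]] := hf 1 ltr01.
rewrite leNgt; apply/negP => lt; pose del := f - (c + 1).
have del0 : 0 < del by rewrite subr_gt0.
have [N hN] := nD_sp_large sB sC k_gt0 prim grow (Num.bound (e / del)).+1.
have a0D := z0D; set a0 := z0 j0 in a0D.
have [s es] := point_dense sB sC k_gt0 prim Xz0 z0D
  (lang_sp sigma (ltn0Sn N) (memDB a0D)).
have [_ h] := he z0 s (size (sp N.+1 a0)) Xz0.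
rewrite -es in h; have h1 := hc N.+1 a0 a0D.
have h2 : (visits (\val @` near M) z0 s (size (sp N.+1 a0)))%:R <=
    (size (sp N.+1 a0))%:R :> R.
  by rewrite ler_nat -[leqRHS](size_iota 0) count_size.
have h3 := hN N.+1 a0 (leqnSn _) a0D.
have h4 : del * (nD (sp N.+1 a0))%:R <= e by rewrite /del; lra.
have : e < del * (nD (sp N.+1 a0))%:R.
  rewrite mulrC -ltr_pdivrMr //.
  apply: lt_le_trans (archi_boundP (divr_ge0 e0 (ltW del0))) _.
  by rewrite ler_nat ltnW.
by rewrite ltNge h4.
Qed.

(** All positions in a block [sp m0 b] with [b] in [D] are visits, and these blocks contain all new
    letters of the word; so there are at least [c] times as many visits as new letters. *)
Lemma near_freq_unbounded (c : R) (m0 : nat) : 0 <= c ->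
  (forall b, b \in D -> c * (nD (sp m0 b))%:R <= (size (sp m0 b))%:R) ->
  forall f, freq sigma B C (\val @` near (maxlen sigma m0)) f -> c <= f + 1.
Proof.
move=> c0 hc f [f0 hf]; have eps2 : 0 < 1 / 2 :> R by lra.
have [e [e0 he]] := hf _ eps2.
rewrite leNgt; apply/negP => lt; pose del := c - (f + 1 / 2).
have del0 : 0 < del by rewrite /del; lra.
have [N hN] := nD_sp_large sB sC k_gt0 prim grow (Num.bound (e / del)).+1.
have a0D := z0D; set a0 := z0 j0 in a0D.
set n := (m0 + N.+1)%N.
have n0 : (0 < n)%N by rewrite /n addnS.
have [s es] := point_dense sB sC k_gt0 prim Xz0 z0D
  (lang_sp sigma n0 (memDB a0D)).
have [h _] := he z0 s (size (sp n a0)) Xz0.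
rewrite -es in h.
have uB := sp_all sB N.+1 (memDB a0D).
have esw : seg z0 s (size (sp n a0)) = iter m0 (subst_word sigma) (sp N.+1 a0).
  by rewrite -es spD.
have h1 := visits_near Xz0 uB esw.
have h2 : c * (nD (sp n a0))%:R <=
    (visits (\val @` near (maxlen sigma m0)) z0 s (size (sp n a0)))%:R.
  apply: (@le_trans _ _ ((\sum_(b <- sp N.+1 a0 | b \in D) size (sp m0 b))%N)%:R).
    rewrite natr_sum /n spD count_sw natr_sum mulr_sumr [leRHS]big_mkcond /=.
    rewrite big_seq [leRHS]big_seq; apply: ler_sum => b bu.
    case: ifPn => [/hc //|bD].
    have bC : b \in C.
      have bB : b \in B := allP uB _ bu.
      by move: bD; rewrite inE bB andbT negbK.
    by rewrite (nD_sp_C _ sC) // mulr0.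
  by rewrite ler_nat.
have h3 := hN n a0 (leq_trans (leqnSn N) (leq_addl _ _)) a0D.
have h4 : del * (nD (sp n a0))%:R <= e by rewrite /del; lra.
have : e < del * (nD (sp n a0))%:R.
  rewrite mulrC -ltr_pdivrMr //.
  apply: lt_le_trans (archi_boundP (divr_ge0 e0 (ltW del0))) _.
  by rewrite ler_nat ltnW.
by rewrite ltNge h4.
Qed.

Theorem component_measure : exists mu : {measure set (borel p) -> \bar R},
  [/\ nonzero_invariant_radon T mu,
      (forall nu : {measure set (borel p) -> \bar R},
        nonzero_invariant_radon T nu ->
        exists2 c : R, 0 < c & forall U, measurable U -> nu U = (c%:E * mu U)%E),
      ergodic T mu,
      ((exists c : R, forall m b, b \in D ->
          (size (sp m b))%:R <= c * (nD (sp m b))%:R) ->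
        (mu setT < +oo)%E) &
      ((forall c : R, exists m, forall b, b \in D ->
          c * (nD (sp m b))%:R <= (size (sp m b))%:R) ->
        mu setT = +oo%E)].
Proof.
have [mu hmu] := exists_component_measure; exists mu.
have mu_fin S : ring S -> (mu S < +oo)%E.
  by move=> rS; have [f hf] := freq_ring rS; rewrite (hmu _ _ rS hf) ltry.
have mu_inv : invariant_measure T mu.
  (* The image measure agrees with [mu] on the ring, because frequencies are invariant under the
     shift. *)
  move=> U mU; have [nu hnu] := preimage_measure mu; rewrite -hnu.
  apply: ring_unique mU => S rS; rewrite hnu; have [f hf] := freq_ring rS.
    rewrite (hmu _ _ (ring_preimage rS) (freq_preimage hf)).
    by rewrite (hmu _ _ rS hf).
  by rewrite (hmu _ _ (ring_preimage rS) (freq_preimage hf)) ltry.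
have cover : \bigcup_m near m = [set: Y].
  apply/seteqP; split=> // y _; have [j yj] := component_letter y.
  by exists (absz j) => //; exact: near_sub_mem yj.
have mu_radon : radon mu.
  move=> K cK; have [|||m hm] := @compact_increasing Y K near cK.
  - by move=> m; apply: compact_open_ring_open; exact: near_sub_ring.
  - by move=> m m'; exact: near_sub_le.
  - by rewrite cover.
  apply: (@le_lt_trans _ _ (mu (near m))).
    apply: le_measure; rewrite ?inE //; first exact: compact_borel.
    by apply: ring_measurable; exact: near_sub_ring.
  by apply: mu_fin; exact: near_sub_ring.
have mu_base : mu base_set = 1%E := hmu _ _ base_set_ring freq_base_set.
have mu_nz : mu [set: borel p] != 0%E.
  rewrite gt_eqF //; apply: (@lt_le_trans _ _ (mu base_set)); first by rewrite mu_base lte01.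
  by apply: le_measure; rewrite ?inE //; exact: ring_measurable base_set_ring.
have uniq (nu : {measure set (borel p) -> \bar R}) :
    nonzero_invariant_radon T nu ->
    exists2 c : R, 0 < c & forall U, measurable U -> nu U = (c%:E * mu U)%E.
  move=> [nu_inv nu_radon nu_nz].
  have nuD := radon_fin nu_radon base_set_ring.
  have c0 : 0 <= fine (nu base_set) by exact: fine_ge0.
  have hE U : measurable U -> nu U = ((fine (nu base_set))%:E * mu U)%E.
    move=> mU; rewrite -[RHS]/(mscale (NngNum c0) mu U).
    apply: ring_unique mU => S rS; have [f hf] := freq_ring rS.
      rewrite -[RHS]/(mscale (NngNum c0) mu S) /mscale (hmu _ _ rS hf) (invariant_freq nu_inv nu_radon rS hf).
      by rewrite muleC fineK.
    rewrite (invariant_freq nu_inv nu_radon rS hf) -(fineK nuD) -EFinM.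
    by rewrite ltry.
  exists (fine (nu base_set)) => //.
  rewrite lt_neqAle c0 andbT eq_sym; apply: contra nu_nz => /eqP c00.
  by rewrite hE // c00 mul0e.
split => //.
- split => // U mU TU.
  (* Ergodicity follows from uniqueness: the restriction of [mu] to an invariant set [U] of positive
     measure is a positive multiple of [mu], yet it vanishes on the complement of [U]. *)
  pose nu : {measure set (borel p) -> \bar R} := mrestr mu mU.
  have [h|h] := eqVneq (mu U) 0%E; first by left.
  right; have [|c c0 hc] := uniq nu.
    split.
    + move=> V mV; rewrite /nu /= /mrestr -{1}TU -preimage_setI.
      by apply: mu_inv; exact: measurableI.
    + move=> K cK; apply: (@le_lt_trans _ _ (mu K)); last exact: mu_radon.
      apply: le_measure; rewrite ?inE //; last exact: compact_borel.
      by apply: measurableI => //; exact: compact_borel.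
    + by rewrite /nu /= /mrestr setTI.
  have := hc _ (measurableC mU); rewrite /nu /= /mrestr setICl measure0 => /esym/eqP.
  by rewrite mule_eq0 eqe gt_eqF //= => /eqP.
(* The total mass is the limit of the frequencies of the sets [near m], all at most [c + 1]. *)
- move=> [c hc]; apply: (@le_lt_trans _ _ (c + 1)%:E); last by rewrite ltry.
  have mn m : measurable (near m : set (borel p)).
    by apply: ring_measurable; exact: near_sub_ring.
  have nd : {homo near : n m / (n <= m)%N >-> (n <= m)%O}.
    by move=> n m nm; apply/subsetPset; exact: near_sub_le.
  have := @nondecreasing_cvg_mu _ (borel p) R mu near mn _ nd.
  rewrite cover => /(_ measurableT) cv; rewrite -(cvg_lim _ cv) //.
  apply: lime_le; first by apply/cvg_ex; exists (mu setT).
  apply: nearW => m /=; have [f hf] := freq_ring (@near_sub_ring A D Y m).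
  by rewrite (hmu _ _ (@near_sub_ring A D Y m) hf) lee_fin (near_freq_bounded hc hf).
- move=> hc; apply/eqyP => r r0; have [m0 hm0] := hc (r + 1).
  have [f hf] := freq_ring (@near_sub_ring A D Y (maxlen sigma m0)).
  have := near_freq_unbounded _ hm0 hf; rewrite (addr_ge0 (ltW r0) ler01) => /(_ isT) rf.
  apply: (@le_trans _ _ (mu (near (maxlen sigma m0)))).
    by rewrite (hmu _ _ (@near_sub_ring A D Y _) hf) lee_fin; lra.
  apply: le_measure; rewrite ?inE //.
  by apply: ring_measurable; exact: near_sub_ring.
Qed.

End Extension.

End ComponentMeasure.

(** * Counting measure on an orbit *)

Section ShiftOrbit.
Variables (R : realType) (A : finType) (Y : set (fullshift A)) (q : fullshift A).
Hypothesis YE : Y = Torbit q.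
Local Notation T := (@Tshift_on A Y).
Implicit Types (y : Y) (S : set Y) (s : int).

Lemma orbit_mem s : Y (sh q s).
Proof. by rewrite YE; exists s. Qed.

Definition orbit_point s : Y := exist (fun z => z \in Y) (sh q s) (mem_set (orbit_mem s)).

Lemma orbit_pointP y : exists s, y = orbit_point s.
Proof.
have : Torbit q (\val y) by rewrite -YE; exact: set_valP.
by move=> [s e]; exists s; exact: val_inj.
Qed.

Lemma Tshift_orbit_point s : T (orbit_point s) = orbit_point (s + 1).
Proof.
apply: val_inj; rewrite /Tshift_on val_insubd.
have -> : Tshift (\val (orbit_point s)) = sh q (s + 1).
  by apply/funext => j; rewrite /Tshift /= /sh -addrA [1 + s]addrC.
by rewrite mem_set //; exact: orbit_mem.
Qed.

Lemma Tshift_orbit_inj : injective T.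
Proof.
move=> y1 y2; have [s1 ->] := orbit_pointP y1; have [s2 ->] := orbit_pointP y2.
rewrite !Tshift_orbit_point => /(congr1 \val) /= e; apply: val_inj => /=.
apply/funext => j; have := congr1 (fun z : fullshift A => z (j - 1)) e.
by rewrite /sh [s1 + 1]addrC [s2 + 1]addrC !addrA !subrK.
Qed.

Lemma image_preimage_orbit S : T @` (T @^-1` S) = S.
Proof.
apply: image_preimage; apply/seteqP; split=> // y _.
have [s ->] := orbit_pointP y; exists (orbit_point (s - 1)) => //.
by rewrite Tshift_orbit_point subrK.
Qed.

Lemma counting_preimage S : counting (T @^-1` S) = counting S :> \bar R.
Proof.
have e : (T @^-1` S #= S)%card.
  rewrite card_eq_sym -{1}(image_preimage_orbit S); apply: inj_card_eq.
  by move=> y1 y2 _ _; exact: Tshift_orbit_inj.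
have fe := eq_finite_set e.
rewrite /counting; have [fS|nfS] := pselect (finite_set S); last first.
  by rewrite !asboolF // fe.
have fTS : finite_set (T @^-1` S) by rewrite fe.
rewrite !asboolT //; congr (_%:R%:E).
exact: (elimT (fcard_eq fTS fS) e).
Qed.

Lemma invariant_orbit_set S : T @^-1` S = S -> S = set0 \/ S = setT.
Proof.
move=> TS; have h s : S (orbit_point s) <-> S (orbit_point (s + 1)).
  by rewrite -Tshift_orbit_point -{1}TS.
have h0 s : S (orbit_point s) <-> S (orbit_point 0).
  elim/int_ind: s => [|m IH|m IH] //; first by rewrite -IH intS addrC -h.
  by rewrite h -IH; suff -> : - m.+1%:Z + 1 = - m%:Z by []; lia.
have [S0|S0] := pselect (S (orbit_point 0)); [right|left].
  by apply/seteqP; split=> // y _; have [s ->] := orbit_pointP y; rewrite h0.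
by apply/seteqP; split=> // y; have [s ->] := orbit_pointP y; rewrite h0.
Qed.

Lemma ergodic_counting (p : Y) : ergodic T (counting_measure R p).
Proof.
split=> [S _|S _ /invariant_orbit_set[->|->]]; first exact: counting_preimage.
  by left; rewrite measure0.
by right; rewrite setCT measure0.
Qed.

Lemma infinite_orbit : (forall s, sh q s = q -> s = 0) -> infinite_set [set: Y].
Proof.
move=> hq fY; suff : finite_set [set: nat] by exact: infinite_nat.
have inj : {in [set: nat] &, injective (fun m : nat => orbit_point m%:Z)}.
  move=> m1 m2 _ _ /(congr1 \val) /= h.
  have : sh q (m1%:Z - m2%:Z) = q.
    apply/funext => j; have := congr1 (fun z : fullshift A => z (j - m2%:Z)) h.
    by rewrite /sh subrK => <-; congr (q _); ring.
  by move/hq; lia.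
rewrite -(eq_finite_set (inj_card_eq inj)); exact: sub_finite_set fY.
Qed.

End ShiftOrbit.

Section IsolatedOrbit.
Variables (R : realType) (A : finType) (Y : set (fullshift A)) (p : Y).
Local Notation q := (\val p : fullshift A).
Hypothesis YE : Y = Torbit q.
Variable M : nat.
Hypothesis iso : forall s, window (sh q s) M = window q M -> s = 0.
Local Notation T := (@Tshift_on A Y).
Local Notation pt := (orbit_point YE).
Implicit Types (y : Y) (S : set Y) (s : int).

Lemma orbit_point_open s : open [set pt s].
Proof.
(* The central window of [q] appears in [pt s] around the coordinate [- s], whence this radius. *)
apply: (@local_open_sub A Y (M + `|s|)) => y y' + /= ye; rewrite ye => {y ye}.
have [t ->] := orbit_pointP YE y' => /= /windowP e; congr (pt _).
apply/eqP; rewrite -subr_eq0; apply/eqP/iso/windowP => j jM.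
have h : (`|j - s| <= M + `|s|)%N by lia.
have -> : (\val p : fullshift A) j = sh (\val p) s (j - s) by rewrite /sh subrK.
by rewrite e // /sh; congr ((\val p : fullshift A) _); ring.
Qed.

Lemma orbit_open S : open S.
Proof.
have -> : S = \bigcup_(s in [set s | S (pt s)]) [set pt s].
  apply/seteqP; split=> [y Sy|y [s /= Ss ->]] //.
  by have [s ey] := orbit_pointP YE y; exists s => //=; rewrite -ey.
by apply: bigcup_open => s _; exact: orbit_point_open.
Qed.

Lemma orbit_measurable S : measurable (S : set (borel p)).
Proof. by apply: sub_sigma_algebra; exact: orbit_open. Qed.

Lemma orbit_compact_finite S : compact S -> finite_set S.
Proof.
move=> cS; have [|||m hm] := @compact_increasing Y S
    (fun m => [set pt s | s in [set s : int | (`|s| <= m)%N]]) cS.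
- by move=> m; exact: orbit_open.
- by move=> m1 m2 mm y [s /= sm <-]; exists s => //=; exact: leq_trans mm.
- by move=> y _; have [s ->] := orbit_pointP YE y; exists `|s|%N => //; exists s => /=.
apply: sub_finite_set hm _; apply: finite_image.
apply: sub_finite_set (finite_image (fun j : nat => j%:Z - m%:Z) (finite_II m.*2.+1)).
by move=> s /= sm; exists (absz (s + m%:Z)) => /=; lia.
Qed.

Lemma orbit_infinite : infinite_set [set: Y].
Proof. by apply: (infinite_orbit YE) => s e; apply: iso; rewrite e. Qed.

Lemma counting_finiteE S : finite_set S -> (counting S < +oo :> \bar R)%E.
Proof. by move=> fS; rewrite /counting asboolT // ltry. Qed.

Lemma counting_setT : counting [set: Y] = +oo%E :> \bar R.
Proof. by rewrite /counting asboolF //; exact: orbit_infinite. Qed.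

Lemma counting_point y : counting [set y] = 1%E :> \bar R.
Proof.
by rewrite /counting asboolT; [rewrite fset_set1 finmap.cardfs1 | exact: finite_set1].
Qed.

Lemma counting_nonzero_invariant_radon :
  nonzero_invariant_radon T (counting_measure R p).
Proof.
split=> [S _|S /orbit_compact_finite/counting_finiteE|] //.
  exact: (counting_preimage R YE S).
by rewrite [counting_measure _ _ _]counting_setT.
Qed.

Lemma counting_unique (nu : {measure set (borel p) -> \bar R}) :
  nonzero_invariant_radon T nu -> exists2 c : R, 0 < c &
    forall S, measurable (S : set (borel p)) -> nu S = (c%:E * counting_measure R p S)%E.
Proof.
move=> [nu_inv nu_radon nu_nz].
have step s : nu [set pt s] = nu [set pt (s + 1)].
  rewrite -(nu_inv _ (orbit_measurable [set pt (s + 1)])); congr (nu _).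
  apply/seteqP; split=> y /= => [->|]; first exact: Tshift_orbit_point.
  by rewrite -Tshift_orbit_point => /(Tshift_orbit_inj YE).
have nu_pt s : nu [set pt s] = nu [set pt 0].
  elim/int_ind: s => [|m <-|m <-] //; first by rewrite (step m%:Z) intS addrC.
  by rewrite step; congr (nu [set pt _]); lia.
have fin0 : nu [set pt 0] \is a fin_num.
  rewrite ge0_fin_numE //; apply: nu_radon; exact: compact_set1.
have c0 : 0 <= fine (nu [set pt 0]) by exact: fine_ge0.
have hE S : measurable (S : set (borel p)) ->
    nu S = ((fine (nu [set pt 0]))%:E * counting_measure R p S)%E.
  move=> mS; rewrite -[RHS]/(mscale (NngNum c0) (counting_measure R p) S).
  (* The orbit is countable, so singletons and the empty set form a generating pi-system, and the
     sequence [g] of its members covers the orbit. *)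
  pose G := [set S' : set (borel p) | S' = set0 \/ exists s, S' = [set pt s]].
  pose g (m : nat) : set (borel p) := if unpickle m is Some s then [set pt s] else set0.
  apply: (@measure_unique _ R (borel p) G g) mS.
  - rewrite eqEsubset; split; last by move=> S' _; exact: orbit_measurable.
    move=> S' _; have -> : S' = \bigcup_m
        (if `[< g m `<=` S' >] then g m else set0).
      apply/seteqP; split=> [y Sy|y [m _]]; last by case: asboolP => // + gm; exact.
      have [s ey] := orbit_pointP YE y; exists (pickle s) => //.
      rewrite /g pickleK asboolT ?ey // => _ ->.
      by rewrite -ey.
    apply: sigma_algebra_bigcup => m; case: asboolP => _; last exact: sigma_algebra0.
    apply: sub_sigma_algebra; rewrite /G /g /=; case: unpickle => [s|]; last by left.
    by right; exists s.
  - move=> S1 S2 [->|[s ->]] _; first by rewrite set0I; left.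
    have [h|h] := pselect (S2 (pt s)).
      by right; exists s; apply/seteqP; split=> [y []|y ->] //.
    by left; apply/seteqP; split=> // y [-> /h].
  - by move=> m; rewrite /G /g /=; case: unpickle => [s|]; [right; exists s|left].
  - apply/seteqP; split=> // y _; have [s ->] := orbit_pointP YE y.
    by exists (pickle s); [exact: I | rewrite /g pickleK].
  - move=> S' [->|[s ->]]; first by rewrite !measure0.
    rewrite -[RHS]/((fine (nu [set pt 0]))%:E * counting [set pt s])%E counting_point mule1 nu_pt fineK //.
  - move=> m; rewrite /g; case: unpickle => [s|]; last by rewrite measure0 ltry.
    by rewrite nu_pt -(fineK fin0) ltry.
exists (fine (nu [set pt 0])) => //.
rewrite lt_neqAle c0 andbT eq_sym; apply: contra nu_nz => /eqP c00.
by rewrite hE; [rewrite c00 mul0e | exact: orbit_measurable].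
Qed.

End IsolatedOrbit.

(** * Components where a single new letter does not multiply *)

Section Blocks.
Variables (T : eqType) (P : seq T -> Prop).
Hypothesis P0 : P [::].
Hypothesis Pinfix : forall v w, infix v w -> P w -> P v.
Implicit Types (t v w x y : seq T) (bs : seq (seq T)) (l : nat).

Lemma infix_cat_cases t v w : infix t (v ++ w) ->
  [\/ infix t v, infix t w | exists x y, [/\ t = x ++ y, suffix x v & prefix y w]].
Proof.
move=> /infixP[p [q e]]; have [le|lt] := leqP (size v) (size p).
  have [_ ->] := cat_eq_split (esym e) le; apply: Or32.
  by apply/infixP; exists (drop (size v) p), q.
have [e1 e2] := cat_eq_split e (ltnW lt).
set x := drop (size p) v in e1 e2; have [le|lt2] := leqP (size x) (size t).
  have [e3 e4] := cat_eq_split e2 le; apply: Or33; exists x, (drop (size x) t).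
  by split; [|apply/suffixP; exists p | apply/prefixP; exists q].
have [e3 _] := cat_eq_split (esym e2) (ltnW lt2); apply: Or31.
by apply/infixP; exists p, (drop (size t) x); rewrite -e3.
Qed.

Lemma prefix_cat_cases t v w : prefix t (v ++ w) ->
  prefix t v \/ exists2 y, t = v ++ y & prefix y w.
Proof.
move=> /prefixP[q e]; have [le|lt] := leqP (size v) (size t).
  have [e1 ->] := cat_eq_split (esym e) le; right.
  by exists (drop (size v) t) => //; exact: prefix_prefix.
by have [-> _] := cat_eq_split e (ltnW lt); left; exact: prefix_prefix.
Qed.

Lemma prefix_blocks l bs t :
  (forall v, v \in bs -> (l <= size v)%N /\ P v \/ (size v <= 1)%N) ->
  (size t <= l)%N -> prefix t (flatten bs) ->
  exists m y, [/\ t = m ++ y, (size m <= size bs)%N & P y].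
Proof.
elim: bs t => [|v bs IH] t hbs tl /=.
  by case: t tl => // _; exists [::], [::].
have hv := hbs v (mem_head _ _).
move=> /prefix_cat_cases[tv|[t' et pt']].
  case: hv => [[_ Pv]|sv].
    by exists [::], t; split => //; exact: Pinfix (prefixW tv) Pv.
  exists t, [::]; split=> //; rewrite ?cats0 //.
  by apply: leq_trans (size_prefix tv) _; exact: leq_trans sv _.
have [||m [y [et' sm Py]]] := IH t' _ _ pt'.
- by move=> v' v'bs; apply: hbs; rewrite inE v'bs orbT.
- by move: tl; rewrite et size_cat; lia.
case: hv => [[lv Pv]|sv]; last first.
  by exists (v ++ m), y; rewrite et et' catA size_cat; split => //=; lia.
exists [::], t; split=> //; apply: Pinfix Pv.
have : size t' = 0%N by move: tl; rewrite et size_cat; lia.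
by move=> /size0nil t0; rewrite et t0 cats0 infix_refl.
Qed.

(* Here [l] bounds the length of [t]: a block of length at least [l] can meet
   [t] only at one of its ends. *)
Lemma infix_blocks l bs t :
  (forall v, v \in bs -> (l <= size v)%N /\ P v \/ (size v <= 1)%N) ->
  (size t <= l)%N -> infix t (flatten bs) ->
  exists x m y, [/\ t = x ++ m ++ y, (size m <= size bs)%N, P x & P y].
Proof.
elim: bs => [|v bs IH] hbs tl /=.
  by move=> /eqP->; exists [::], [::], [::].
have hv := hbs v (mem_head _ _).
have hbs' v' : v' \in bs -> (l <= size v')%N /\ P v' \/ (size v' <= 1)%N.
  by move=> v'bs; apply: hbs; rewrite inE v'bs orbT.
move=> /infix_cat_cases[tv|/(IH hbs' tl)|[x [t' [et xv pt']]]].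
- case: hv => [[_ Pv]|sv].
    by exists t, [::], [::]; rewrite /= cats0; split => //; exact: Pinfix tv Pv.
  exists [::], t, [::]; rewrite cats0; split=> //.
  by apply: leq_trans (size_infix tv) _; exact: leq_trans sv _.
- move=> [x [m [y [-> sm Px Py]]]]; exists x, m, y; split=> //.
  exact: leqW.
have [|m [y [et' sm Py]]] := prefix_blocks hbs' _ pt'.
  by move: tl; rewrite et size_cat; lia.
case: hv => [[_ Pv]|sv].
  exists x, m, y; rewrite et et'; split=> //; first exact: leqW.
  exact: Pinfix (suffixW xv) Pv.
exists [::], (x ++ m), y; rewrite et et' -catA; split=> //=.
by have := size_suffix xv; rewrite size_cat; lia.
Qed.

(** A word no longer than any block meets at most two consecutive ones; if it lies in a single
    block, that block is taken twice. *)
Lemma infix_two_rows t bs : (forall v, v \in bs -> (size t <= size v)%N) ->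
  infix t (flatten bs) -> t != [::] ->
  exists v w, [/\ v \in bs, w \in bs & infix t (v ++ w)].
Proof.
elim: bs => [|v bs IH] hbs /=; first by move=> ->.
have hbs' v' : v' \in bs -> (size t <= size v')%N.
  by move=> v'bs; apply: hbs; rewrite inE v'bs orbT.
move=> /infix_cat_cases[tv|/(IH hbs') h|[x [t' [et xv pt']]]] t0.
- exists v, v; rewrite mem_head; split=> //.
  by apply: infix_trans tv _; exact: prefixW (prefix_prefix _ _).
- by have [v1 [v2 [h1 h2 h3]]] := h t0; exists v1, v2; rewrite !inE h1 h2 !orbT.
case: bs pt' {IH} hbs hbs' => [|w bs] /= pt' hbs hbs'.
  have t'0 : t' = [::] by case: t' pt' {et}.
  exists v, v; rewrite mem_head; split=> //; rewrite et t'0 cats0.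
  by apply: infix_trans (suffixW xv) _; exact: prefixW (prefix_prefix _ _).
exists v, w; rewrite !inE !eqxx orbT; split=> //.
have : prefix t' w.
  case: (prefix_cat_cases pt') => // -[y ey _].
  have := hbs' w (mem_head _ _); rewrite et ey !size_cat => h.
  have : size y = 0%N by lia.
  by move=> /size0nil ->; rewrite cats0 prefix_refl.
move=> /prefixP[t2 ->]; case/suffixP: xv => x2 ->.
by rewrite et; apply/infixP; exists x2, t2; rewrite -!catA.
Qed.

End Blocks.

Section Isolation.
Variable A : finType.
Implicit Types (z : fullshift A) (s : int).

Lemma sh_period z s j : sh z s = z -> sh z (j%:Z * s) = z.
Proof.
move=> e; elim: j => [|j IH]; first by rewrite mul0r sh0.
by rewrite -{2}e -{2}IH shD; congr (sh z _); rewrite intS mulrDl mul1r addrC.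
Qed.

(** A nonzero period would give arbitrarily distant returns of the window, so [z] is aperiodic; a
    larger window then separates it from its finitely many shifts up to distance [r]. *)
Lemma window_isolated z m (r : nat) :
  (forall s, window (sh z s) m = window z m -> (`|s| <= r)%N) ->
  exists M, forall s, window (sh z s) M = window z M -> s = 0.
Proof.
move=> h; have aper s : sh z s = z -> s = 0.
  move=> e; have := h (r.+1%:Z * s); rewrite sh_period // => /(_ erefl).
  rewrite abszM /= => le; apply/eqP; rewrite -absz_eq0; apply: contraLR le => s0.
  by rewrite -ltnNge leq_pmulr // lt0n.
have sep s : exists j : nat, s != 0 -> window (sh z s) j != window z j.
  have [->|s0] := eqVneq s 0; first by exists 0%N.
  apply: contrapT => hn; move/eqP : s0; apply; apply: aper; apply/funext => j.
  apply: contrapT => hj; apply: hn; exists (absz j) => _; apply/eqP => /windowP.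
  by move=> /(_ j (leqnn _)).
have [f hf] := boolp.choice sep.
pose M := maxn m (\max_(i < r.*2.+1) f (i%:Z - r%:Z)%R); exists M => s e.
have sr : (`|s| <= r)%N by apply: h; apply: window_le e; exact: leq_maxl.
apply/eqP; apply: contraT => s0; have := hf _ s0.
suff -> : window (sh z s) (f s) = window z (f s) by rewrite eqxx.
apply: window_le e; apply: leq_trans _ (leq_maxr _ _).
have lt : (absz (s + r%:Z)%R < r.*2.+1)%N by move: sr; clear; lia.
apply: leq_trans _ (leq_bigmax (Ordinal lt)).
rewrite (_ : (Ordinal lt)%:Z - r%:Z = s) //=; move: sr; clear; lia.
Qed.

End Isolation.

Section SingleNewLetter.
Variables (A : finType) (sigma : A -> seq A) (B C : {set A}) (b s0 : A) (u v : seq A).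
Local Notation sw n := (iter n (subst_word sigma)).
Local Notation sp n := (subst_pow sigma n).
Local Notation XS := (subshift sigma B).
Hypothesis sC : forall a, a \in C -> word_on C (sigma a).
Hypothesis C0 : exists a, a \in C.
Hypothesis bC : b \notin C.
Hypothesis BE : forall a, a \in B -> a = b \/ a \in C.
Hypothesis uC : all (mem C) u.
Hypothesis vC : all (mem C) v.
Hypothesis sb : sigma b = u ++ b :: v.
Hypothesis long_or_fixed : forall c, c \in C ->
  (forall l, exists J, forall j, (J <= j)%N -> (l <= size (sp j c))%N) \/
  (c = s0 /\ forall j, sp j s0 = [:: s0]).
Implicit Types (z : fullshift A) (s t : int) (w : seq A).

(** What stands to the left of [b] in [sp N b], the row of highest order being outermost. *)
Definition left_rows N := flatten [seq sw j u | j <- rev (iota 0 N)].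
Definition right_rows N := flatten [seq sw j v | j <- iota 0 N].

Lemma sp_new N : sp N b = left_rows N ++ b :: right_rows N.
Proof.
elim: N => [|N IH] //; rewrite -addn1 spD /= /subst_word /= cats0 sb.
rewrite sw_cat -cat1s sw_cat -[sw N [:: b]]/(sp N b) IH.
rewrite /left_rows /right_rows -addn1 iotaD rev_cat !map_cat !flatten_cat /= !cats0.
by rewrite add0n -!catA cat_cons.
Qed.

Lemma rows_all w (r : seq nat) : all (mem C) w -> all (mem C) (flatten [seq sw j w | j <- r]).
Proof.
move=> wC; apply/allP => a /flatten_mapP[j _]; move: a; apply/allP; exact: sw_all.
Qed.

Lemma count_new N a : a \in B -> (count_mem b (sp N a) <= 1)%N.
Proof.
have nC w : all (mem C) w -> count_mem b w = 0%N.
  by move=> wC; apply/count_memPn; apply: contra bC => /(allP wC).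
move=> /BE[->|aC]; last by rewrite nC // sp_all.
by rewrite sp_new count_cat /= eqxx !nC //; exact: rows_all.
Qed.

(** The letter [b] occurs at most once in each word [sp n a], hence only once in [z]. *)
Lemma new_letter_isolated z (j : int) : XS z -> z j = b ->
  forall s, window (sh z s) (absz j) = window z (absz j) -> s = 0.
Proof.
move=> Xz zj s /windowP/(_ j (leqnn _)); rewrite /sh zj => zjs.
apply/eqP; apply: contraT => sn0.
suff h s1 s2 : s1 < s2 -> z s1 = b -> z s2 = b -> False.
  have [lt|lt|e] := ltgtP s 0; last by rewrite e eqxx in sn0.
    by case: (h (j + s) j) => //; lia.
  by case: (h j (j + s)) => //; lia.
move=> lt z1 z2; have [n [a [n0 aB wa]]] := lang_seg s1 (absz (s2 - s1)).+1 Xz.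
have /infixP[x [y e]] := wa; have := count_new n aB; rewrite e !count_cat.
have -> : (absz (s2 - s1)).+1 = (1 + ((absz (s2 - s1)).-1 + 1))%N by lia.
rewrite !seg_cat !count_cat /seg /= !addr0 z1.
rewrite (_ : s1 + _ + _ = s2) ?z2 ?eqxx; last lia.
set c1 := count_mem b x; set c2 := count_mem b y; set c3 := count_mem b _.
by move: c1 c2 c3; clear; lia.
Qed.

(** Every row has a block at least as long as [t], so [t] lies in two rows, that is, in twice
    [size w] blocks. Each block is either that long and in the language of [C], or the single letter
    [s0]; long blocks meet [t] at its ends only, and the letters [s0] make up [m]. *)
Lemma rows_flank w (r : seq nat) (t : seq A) J :
  (forall c, c \in C -> (forall j, (J <= j)%N -> (size t <= size (sp j c))%N) \/
    (c = s0 /\ forall j, sp j s0 = [:: s0])) ->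
  (0 < J)%N -> all (leq J) r -> all (mem C) w -> t != [::] ->
  (exists2 c, c \in w & forall j, (J <= j)%N -> (size t <= size (sp j c))%N) ->
  infix t (flatten [seq sw j w | j <- r]) ->
  exists x m y, [/\ t = x ++ m ++ y, (size m <= (size w).*2)%N,
    lang sigma C x & lang sigma C y].
Proof.
move=> hJ J0 rJ wC t0 [c cw hc] tin.
have [|v1 [v2 [/mapP[j1 jr1 ->] /mapP[j2 jr2 ->]]]] := infix_two_rows _ tin t0.
  move=> _ /mapP[j jr ->]; have jJ := allP rJ j jr.
  exact: leq_trans (hc _ jJ) (size_infix (infix_sp_sw sigma j cw)).
rewrite !swE -flatten_cat => tin2.
have L0 : lang sigma C [::].
  by case: C0 => a aC; exists 1%N, a; rewrite infix0s.
have [||x [m [y [e sm Lx Ly]]]] :=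
    infix_blocks L0 (@lang_infix A sigma C) (l := size t) _ _ tin2.
- move=> v'; have key j : j \in r -> v' \in map (sp j) w ->
      (size t <= size v')%N /\ lang sigma C v' \/ (size v' <= 1)%N.
    move=> jr /mapP[a aw ->]; have jJ := allP rJ j jr.
    have [/(_ _ jJ) h|[-> ->]] := hJ a (allP wC a aw); last by right.
    left; split=> //; apply: lang_sp; last exact: (allP wC a aw).
    exact: leq_trans jJ.
  by rewrite mem_cat => /orP[] /key; apply.
- by [].
exists x, m, y; split=> //.
by move: sm; rewrite size_cat !size_map addnn.
Qed.

Lemma infix_avoid (x y t : seq A) : infix t (x ++ b :: y) -> b \notin t ->
  infix t x \/ infix t y.
Proof.
move=> /infix_cat_cases[h|h|[t1 [t2 [et s1 p2]]]] bt; first by left.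
  move: h; rewrite -cat1s => /infix_cat_cases[h|h|[t1 [t2 [et s1 p2]]]].
  - left; have := size_infix h; case: t bt h => [|a [|a' t]] //=; first by rewrite infix0s.
    by rewrite inE eq_sym => /negPf->.
  - by right.
  case: t1 et s1 => [|a t1] et s1; first by right; rewrite et prefixW.
  case/suffixP: s1 => -[|? [|? ?]] // [] ea _.
  by move: bt; rewrite et /= -ea mem_head.
case: t2 et p2 => [|a t2] et p2; first by left; rewrite et cats0 suffixW.
case/prefixP: p2 => ? [] ea _.
by move: bt; rewrite et /= -ea mem_cat mem_head orbT.
Qed.

Lemma infix_catl_drop (x y p t : seq A) : infix (p ++ t) (x ++ y) ->
  (size x <= size p)%N -> infix t y.
Proof.
move=> /infixP[p1 [q e]] xp; have [||_ ->] := cat_eq_split (w1 := x) (w2 := y) (s1 := p1 ++ p) (s2 := t ++ q).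
- by rewrite e -!catA.
- by rewrite size_cat (leq_trans xp) // leq_addl.
by rewrite -[X in infix _ X]cat0s; apply/infixP; eexists; exists q.
Qed.

Lemma infix_catr_drop (x y p t : seq A) : infix (t ++ p) (y ++ x) ->
  (size x <= size p)%N -> infix t y.
Proof.
move=> /infixP[p1 [q e]] xp; have [||-> _] := cat_eq_split (s1 := y) (s2 := x) (w1 := p1 ++ t) (w2 := p ++ q).
- by rewrite e -!catA.
- move: (congr1 size e); rewrite !size_cat.
  by move: (size y) (size x) (size p1) (size t) (size p) (size q) xp; clear; lia.
by apply/infixP; exists p1; eexists; rewrite -catA.
Qed.

(* Far away from the letter [b], the words [sp n b] are concatenations of blocks
   [sp j c] with [j] large, which are longer than any given segment unless [c]
   is the fixed letter [s0]. *)
Lemma flank z t m0 N : XS z -> (forall j, z j != b) -> z t != z (t + 1) ->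
  ~ lang sigma C (window z m0) -> exists x m y,
  [/\ seg z (- N%:Z) N.*2.+1 = x ++ m ++ y, (size m <= (size u + size v).*2)%N,
    lang sigma C x & lang sigma C y].
Proof.
move=> Xz zb zt zm; set S := seg z _ _.
have sS : size S = N.*2.+1 by rewrite size_seg.
have [J [J0 hJ]] : exists J, (0 < J)%N /\ forall c, c \in C ->
    (forall j, (J <= j)%N -> (size S <= size (sp j c))%N) \/
    (c = s0 /\ forall j, sp j s0 = [:: s0]).
  have lf c : exists J, c \in C ->
      (forall j, (J <= j)%N -> (size S <= size (sp j c))%N) \/
      (c = s0 /\ forall j, sp j s0 = [:: s0]).
    have [cC|cC] := boolP (c \in C); last by exists 0%N.
    have [/(_ (size S))[J hJ]|h] := long_or_fixed cC; last by exists 0%N => _; right.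
    by exists J => _; left.
  have [f hf] := boolp.choice lf.
  exists (\max_c f c).+1; split=> // c cC; have [h|h] := hf c cC; last by right.
  by left=> j hj; apply: h; apply: leq_trans (leq_bigmax c) (ltnW hj).
(* The margin [Q] makes the enlarged segment contain the window of radius [m0] and the coordinates
   [t] and [t + 1]; it also absorbs the rows of order below [J], whose blocks may be short. *)
pose Q := (size (left_rows J) + size (right_rows J) + m0 + absz t + 2)%N.
set W1 := seg z (- (N + Q)%N%:Z) Q; set W3 := seg z (N%:Z + 1) Q.
have WE : seg z (- (N + Q)%N%:Z) (N + Q).*2.+1 = W1 ++ S ++ W3.
  rewrite (_ : (N + Q).*2.+1 = Q + (N.*2.+1 + Q))%N; last by lia.
  rewrite seg_cat (seg_cat z _ N.*2.+1 Q) (_ : - (N + Q)%N%:Z + Q%:Z = - N%:Z); last by lia.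
  by rewrite (_ : - N%:Z + N.*2.+1%:Z = N%:Z + 1) //; lia.
have bW : b \notin W1 ++ S ++ W3.
  rewrite -WE; apply/negP => h; have [i _ e] := mem_seg h.
  by have := zb (- (N + Q)%N%:Z + i%:Z); rewrite -e eqxx.
have [n [a [n0 aB]]] := lang_seg (- (N + Q)%N%:Z) (N + Q).*2.+1 Xz.
have mW : infix (window z m0) (W1 ++ S ++ W3).
  by rewrite -WE window_seg; apply: infix_seg; rewrite /Q; lia.
case: (BE aB) => [->|aC] wa; last first.
  case: zm; apply: (@lang_infix A sigma C _ (W1 ++ S ++ W3)) => //.
  by exists n, a; rewrite -WE.
have {wa} : infix (W1 ++ S ++ W3) (sp (n + J) b).
  rewrite -WE; apply: infix_trans wa _; rewrite spD; apply: infix_sp_sw.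
  by rewrite sp_new mem_cat mem_head orbT.
(* The enlarged segment is not constant; this excludes a side of [b] on which all letters are the
   fixed [s0]. *)
have tW : (forall c, c \in W1 ++ S ++ W3 -> c = s0) -> False.
  rewrite -WE => h; have ht (t' : int) : (absz t' <= absz t + 1)%N -> z t' = s0.
    move=> tt; apply: h; apply/mapP; exists (absz (t' + (N + Q)%N%:Z)).
      by rewrite mem_iota; move: tt; rewrite /Q; clear; lia.
    by congr (z _); move: tt; rewrite /Q; clear; lia.
  have t1 : (absz (t + 1)%R <= absz t + 1)%N by lia.
  by move: zt; rewrite (ht _ t1) (ht t (leq_addr _ _)) eqxx.
have side w (r0 r : seq nat) : all (mem C) w ->
    infix (W1 ++ S ++ W3) (flatten [seq sw j w | j <- r0]) -> all (leq J) r ->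
    infix S (flatten [seq sw j w | j <- r]) -> (size w <= size u + size v)%N ->
  exists x m y, [/\ S = x ++ m ++ y, (size m <= (size u + size v).*2)%N,
    lang sigma C x & lang sigma C y].
  move=> wC Win rJ Sin ws.
  have S0 : S != [::] by rewrite -size_eq0 sS.
  have [h|h] := pselect (exists2 c, c \in w &
      forall j, (J <= j)%N -> (size S <= size (sp j c))%N).
    have [x [m [y [e sm Lx Ly]]]] := rows_flank hJ J0 rJ wC S0 h Sin.
    exists x, m, y; split=> //; apply: leq_trans sm _; by rewrite leq_double.
  case: tW => c /(mem_infix Win)/flatten_mapP[j _].
  rewrite swE => /flatten_mapP[d dw]; have [h'|[-> ->]] := hJ d (allP wC d dw).
    by case: h; exists d.
  by rewrite inE => /eqP.
rewrite sp_new => /infix_avoid -/(_ bW)[Win|Win].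
- have e : left_rows (n + J) = flatten [seq sw j u | j <- rev (iota J n)] ++ left_rows J.
    by rewrite /left_rows addnC iotaD rev_cat map_cat flatten_cat add0n.
  apply: (side _ _ (rev (iota J n)) uC Win); last by rewrite leq_addr.
    by apply/allP => j; rewrite mem_rev mem_iota => /andP[].
  have := Win; rewrite -/(left_rows (n + J)) e catA => /infix_catr_drop h.
  have {h} := h; rewrite size_seg => h; have {h} : infix (W1 ++ S) (flatten [seq sw j u | j <- rev (iota J n)]).
    by apply: h; rewrite /Q; lia.
  by apply: infix_trans; exact: suffixW (suffix_suffix _ _).
- have e : right_rows (n + J) = right_rows J ++ flatten [seq sw j v | j <- iota J n].
    by rewrite /right_rows addnC iotaD map_cat flatten_cat add0n.
  apply: (side _ _ (iota J n) vC Win); last by rewrite leq_addl.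
    by apply/allP => j; rewrite mem_iota => /andP[].
  have := Win; rewrite -/(right_rows (n + J)) e => /infix_catl_drop h.
  have {h} := h; rewrite size_seg => h; have {h} : infix (S ++ W3) (flatten [seq sw j v | j <- iota J n]).
    by apply: h; rewrite /Q; lia.
  by apply: infix_trans; exact: prefixW (prefix_prefix _ _).
Qed.

(** If the window of radius [m0] recurs at distance [s], write the segment of radius |s| + m0 as in
    [flank]. Neither occurrence fits into [x] or [y], which are in the language of [C]; so both
    reach the middle part [m], whose length is bounded independently of [s]. *)
Lemma flank_isolated z t m0 : XS z -> (forall j, z j != b) -> z t != z (t + 1) ->
  ~ lang sigma C (window z m0) ->
  exists M, forall s, window (sh z s) M = window z M -> s = 0.
Proof.
move=> Xz zb zt zm.
apply: (@window_isolated A z m0 ((size u + size v).*2 + m0.*2.+1)) => s e.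
have [x [m [y [E sm Lx Ly]]]] := flank (absz s + m0) Xz zb zt zm.
set N := (absz s + m0)%N in E.
have sE : (size x + (size m + size y) = N.*2.+1)%N.
  by rewrite -!size_cat -E size_seg.
have ex : x = seg z (- N%:Z) (size x).
  have := E; rewrite -sE seg_cat => /eqP; rewrite eqseq_cat ?size_seg //.
  by move=> /andP[/eqP].
have ey : y = seg z (- N%:Z + (size x + size m)%N%:Z) (size y).
  have := E; rewrite -sE addnA seg_cat catA => /eqP.
  by rewrite eqseq_cat ?size_seg ?size_cat // => /andP[_ /eqP].
have bad i : window (sh z i) m0 = window z m0 -> (absz i <= absz s)%N ->
    (size x)%:Z < N%:Z + i - m0%:Z + m0.*2.+1%:Z /\ N%:Z + i - m0%:Z < (size x + size m)%N%:Z.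
  rewrite window_seg seg_sh => ei il; split.
    rewrite ltNge; apply/negP => le; apply: zm; rewrite -ei.
    apply: lang_infix Lx; rewrite ex; apply: infix_seg.
      by move: il le; rewrite /N; clear; lia.
    by move: il le; rewrite /N; clear; lia.
  rewrite ltNge; apply/negP => le; apply: zm; rewrite -ei.
  apply: lang_infix Ly; rewrite ey; apply: infix_seg.
    by move: il le sE; rewrite /N; clear; lia.
  by move: il le sE; rewrite /N; clear; lia.
have [h1 h2] := bad s e (leqnn _).
have [||h3 h4] := bad 0; [by rewrite sh0 | by [] |].
by move: h1 h2 h3 h4 sm; clear; lia.
Qed.

End SingleNewLetter.

(** * The decomposition *)

Lemma split_count (T : eqType) (P : pred T) (w : seq T) m : (m < count P w)%N ->
  exists x d y, [/\ w = x ++ d :: y, P d & count P x = m].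
Proof.
elim: w m => // a w IH m /=; have [Pa|Pa] := boolP (P a) => /= h; last first.
  by have [x [d [y [-> Pd <-]]]] := IH m h; exists (a :: x), d, y; rewrite /= (negPf Pa).
case: m h => [|m] h; first by exists [::], a, w.
have [|x [d [y [-> Pd <-]]]] := IH m; first by move: h; rewrite add1n ltnS.
by exists (a :: x), d, y; rewrite /= Pa.
Qed.

Lemma compact_closure (A : finType) (K : set (fullshift A)) : compact K -> closure K `<=` K.
Proof.
move=> cK z clz; apply: contrapT => nKz.
have [|||m hm] := @compact_increasing (fullshift A) K
  (fun m => [set z' | window z' m <> window z m]) cK.
- by move=> m; apply: (@local_open A m) => z1 z2 /= ->.
- by move=> m m' mm z' /= h /(window_le mm).
- move=> z' Kz'; apply: contrapT => h; apply: nKz; suff <- : z' = z by [].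
  apply/funext => j; apply: contrapT => zj; apply: h.
  by exists (absz j) => // /windowP/(_ j (leqnn _)).
have [|z' [/hm]] := clz [set z' | window z' m = window z m].
  by apply/nbhs_windowP; exists m.
exact.
Qed.

Section Letters.
Variables (A : finType) (sigma : A -> seq A) (n : nat) (Ac : nat -> {set A}).
Hypothesis hpc : primitive_components sigma n Ac.
Local Notation sw n := (iter n (subst_word sigma)).
Local Notation sp n := (subst_pow sigma n).
Local Notation Dl i := (Ac i :\: Ac i.-1)%SET.
Implicit Types (i j l : nat) (a b c : A) (u v : seq A).

Lemma Ac_level i c : (i <= n)%N -> c \in Ac i -> exists2 j, (1 <= j <= i)%N & c \in Dl j.
Proof.
elim: i => [|i IH] hi; first by rewrite (pc_bottom hpc) inE.
have [cC _|cC cA] := boolP (c \in Ac i).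
  by have [j hj cj] := IH (ltnW hi) cC; exists j => //; move: hj; lia.
by exists i.+1; rewrite /= ?leqnn // inE cC.
Qed.

Lemma primitive_mem i k a : (1 <= i <= n)%N ->
  (forall i a b, (1 <= i <= n)%N -> a \in Dl i -> b \in Ac i -> b \in sp k a) ->
  a \in Dl i -> a \in sp k a.
Proof. by move=> hi prim aD; apply: (prim i) => //; exact: memDB aD. Qed.

(** The letter [c] occurs in [sp k c]. If there is a second letter, the length increases every [k]
    steps. Otherwise [sp k c] is [c] alone; as it contains the whole first level, this level is {c},
    and [sigma] fixes [c]. *)
Lemma long_or_fixed i s0 c : (1 <= i <= n)%N -> s0 \in Ac 1 -> c \in Ac i ->
  (forall l, exists J, forall j, (J <= j)%N -> (l <= size (sp j c))%N) \/
  (c = s0 /\ forall j, sp j s0 = [:: s0]).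
Proof.
move=> hi s0A cA; have [k k0 prim] := pc_primitive hpc.
have hin : (i <= n)%N by case/andP: hi.
have [j0 hj0 cD] := Ac_level hin cA.
have hj0n : (1 <= j0 <= n)%N by move: hj0 hi; clear; lia.
have sA := Ac_stable hpc hi.
have cc := primitive_mem hj0n prim cD.
have s0c : s0 \in sp k c.
  apply: (prim j0) => //; have h : (1 <= j0 <= n)%N by [].
  exact: (fintype.subsetP (Ac_mono hpc h)).
have [le|lt] := leqP 2 (size (sp k c)).
  left=> l; have grow j : (j < size (sp (k * j) c))%N.
    elim: j => [|j IH]; first by rewrite muln0.
    have := sp_all sA k cA; rewrite mulnS addnC spD; case/splitPr: cc le => x y.
    rewrite -cat1s !all_cat => le /and3P[xA _ yA].
    rewrite !sw_cat !size_cat -[sw _ [:: c]]/(sp (k * j) c).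
    move: le (sw_size sA (k * j) xA) (sw_size sA (k * j) yA) IH; rewrite !size_cat /=.
    by clear; lia.
  exists (k * l)%N => j kj; rewrite -(subnK kj) spD.
  apply: leq_trans (sw_size sA _ _); first exact: ltnW.
  exact: sp_all.
right.
have ek : sp k c = [:: c].
  case: (sp k c) cc lt => [|d [|]] //; by rewrite inE => /eqP->.
have cs : c = s0 by move: s0c; rewrite ek inE => /eqP.
have hn1 : (1 <= 1 <= n)%N by move: hi; clear; lia.
have A1 d : d \in Ac 1 -> d = s0.
  move=> dA; have : d \in sp k c.
    by apply: (prim j0) => //; exact: (fintype.subsetP (Ac_mono hpc hj0n)).
  by rewrite ek inE cs => /eqP.
split=> //; have s1 : sigma s0 = [:: s0].
  have /andP[sn0 /allP sall] := Ac_stable hpc hn1 s0A.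
  have sz : (size (sigma s0) <= 1)%N.
    have e : sp k s0 = sw k.-1 (sigma s0).
      by rewrite -(prednK k0) -addn1 spD /= /subst_word /= cats0 addn1.
    have : size (sp k s0) = 1%N by rewrite -cs ek.
    have sA1 := Ac_stable hpc hn1.
    by rewrite e => <-; apply: (sw_size sA1); apply/allP.
  case: (sigma s0) sn0 sall sz => [|d [|]] // _ h _.
  by rewrite (A1 d) //; apply: h; rewrite mem_head.
by elim=> // j /= ->; rewrite /subst_word /= s1.
Qed.

(** If [sp k a] has a single occurrence of a new letter, then [a] is the only new letter, since all
    of them occur there. It occurs in [sigma a], and just once, because every occurrence leads to a
    new letter in [sp k a]. *)
Lemma new_letter_cases i : (1 <= i <= n)%N ->
  (exists k, [/\ (0 < k)%N, forall a b, a \in Dl i -> b \in Ac i -> b \in sp k a &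
    forall a, a \in Dl i -> (2 <= count (mem (Dl i)) (sp k a))%N]) \/
  (exists b u v, [/\ Dl i = [set b]%SET, sigma b = u ++ b :: v,
    all (mem (Ac i.-1)) u & all (mem (Ac i.-1)) v]).
Proof.
move=> hi; have [k k0 prim0] := pc_primitive hpc.
have prim a b := prim0 i a b hi.
have sB := Ac_stable hpc hi; have sC := Ac_stable_pred hpc hi.
have [h|h] := pselect (forall a, a \in Dl i -> (2 <= count (mem (Dl i)) (sp k a))%N).
  by left; exists k.
right; have [a aD lt] : exists2 a, a \in Dl i & (count (mem (Dl i)) (sp k a) < 2)%N.
  apply: contrapT => hn; apply: h => a aD; rewrite leqNgt; apply/negP => lt.
  by apply: hn; exists a.
have aB := memDB aD; have aa := primitive_mem hi prim0 aD.
have uniqD d : d \in Dl i -> d = a.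
  move=> dD; apply/eqP; apply: contraT => da; move: lt; rewrite ltnNge => /negP[].
  have := prim a d aD (memDB dD); case/splitPr: aa => x y.
  rewrite -cat1s !count_cat /= aD mem_cat inE (negPf da) /= => /orP[] dx.
    have : has (mem (Dl i)) x by apply/hasP; exists d.
    by rewrite has_count; lia.
  have : has (mem (Dl i)) y by apply/hasP; exists d.
  by rewrite has_count; lia.
have /andP[_ sBa] := sB a aB.
have spk : sp k a = sw k.-1 (sigma a).
  by rewrite -(prednK k0) -addn1 spD /= /subst_word /= cats0 addn1.
have asa : a \in sigma a.
  apply: contraT => nas; have : all (mem (Ac i.-1)) (sigma a).
    apply: (@nD0_all _ (Ac i) (Ac i.-1)) => //; apply/eqP; rewrite -leqn0 leqNgt -has_count.
    by apply/hasPn => d dsa; apply/negP => /uniqD da; move: nas; rewrite -{1}da dsa.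
  move=> /(sw_all sC k.-1); rewrite -spk.
  by move=> /allP/(_ a aa) /= aC; move: aD; rewrite inE aC.
have [u [v e]] : exists u v, sigma a = u ++ a :: v by case/splitPr: asa => u v; exists u, v.
have uvD w : infix w (u ++ a :: v) -> a \notin w -> all (mem (Ac i.-1)) w.
  move=> wi aw; apply/allP => d dw; apply: contraT => dC.
  have dD : d \in Dl i.
    by rewrite inE dC; apply: (allP sBa); rewrite e; exact: (mem_infix wi).
  by move: aw; rewrite -(uniqD d dD) dw.
have pos := nD_sp_pos sB sC k0 prim k.-1 aD.
have side w : a \in w -> (0 < count (mem (Dl i)) (sw k.-1 w))%N.
  move=> aw; apply: leq_trans pos _; apply: count_infix.
  exact: infix_sp_sw.
move: lt; rewrite spk e -cat1s !sw_cat !count_cat -[sw _ [:: a]]/(sp k.-1 a) => lt.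
exists a, u, v; split => //.
- by apply/setP => d; rewrite [RHS]inE; apply/idP/eqP => [/uniqD|->].
- apply: uvD; first exact: prefixW (prefix_prefix _ _).
  by apply/negP => /side; move: lt pos; clear; lia.
- apply: uvD; first by rewrite -cat_rcons; exact: suffixW (suffix_suffix _ _).
  by apply/negP => /side; move: lt pos; clear; lia.
Qed.

End Letters.

Section Decomposed.
Variables (R : realType) (A : finType) (sigma : A -> seq A) (n : nat)
  (Ac : nat -> {set A}) (X : nat -> set (fullshift A))
  (y : nat -> option (fullshift A)) (N : nat -> nat) (x : nat -> nat -> fullshift A).
Hypothesis hpc : primitive_components sigma n Ac.
Hypothesis hdec : decomposition sigma n Ac X y N x.
Local Notation sp n := (subst_pow sigma n).
Local Notation Dl i := (Ac i :\: Ac i.-1)%SET.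
Local Notation XS := (subshift_at sigma Ac).
Implicit Types (i j : nat) (z : fullshift A) (s : int).

Lemma component_sub i z : (1 <= i <= n)%N -> X i z -> XS i z /\ ~ XS i.-1 z.
Proof.
move=> hi Xz; have : (XS i `\` XS i.-1) z by rewrite (dec_cover hdec hi); left; left.
by [].
Qed.

Lemma component_sh i z s : (1 <= i <= n)%N -> X i z -> X i (sh z s).
Proof.
move=> hi; have e z' : Tshift z' = sh z' 1 by [].
have up z' : X i z' -> X i (sh z' 1).
  by move=> Xz; rewrite -(dec_invX hdec hi) -e; exists z'.
have dn z' : X i z' -> X i (sh z' (-1)).
  rewrite -{1}(dec_invX hdec hi) => -[z'' Xz'' <-].
  by rewrite e shD addrN sh0.
move=> Xz; elim/int_ind: s => [|m IH|m IH]; first by rewrite sh0.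
  by have := up _ IH; rewrite shD; congr (X i (sh z _)); lia.
by have := dn _ IH; rewrite shD; congr (X i (sh z _)); lia.
Qed.

Lemma component_dense i z z' m : (1 <= i <= n)%N -> X i z -> XS i z' ->
  exists s, window (sh z s) m = window z' m.
Proof.
move=> hi Xz Xz'; have [_ h] := dec_X hdec hi (ex_intro _ z Xz).
have [|_ [[s ->] e]] := h z Xz z' Xz' [set w | window w m = window z' m].
  by apply/nbhs_windowP; exists m.
by exists s.
Qed.

(** By compactness it suffices to find words of the language of every radius [m] centred at a new
    letter. A word with [m.*2.+1] new letters has one with [m] others on either side. *)
Lemma point_with_new_letter i k : (1 <= i <= n)%N -> (0 < k)%N ->
  (forall a b, a \in Dl i -> b \in Ac i -> b \in sp k a) ->
  (forall a, a \in Dl i -> (2 <= count (mem (Dl i)) (sp k a))%N) ->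
  exists2 z, XS i z & z 0 \in Dl i.
Proof.
move=> hi k0 prim grow; have sB := Ac_stable hpc hi; have sC := Ac_stable_pred hpc hi.
pose O m := [set z : fullshift A | ~ (lang sigma (Ac i) (window z m) /\ z 0 \in Dl i)].
apply: contrapT => hn.
have [|||m hm] := @compact_increasing (fullshift A) setT O (@compact_fullshift A).
- move=> m; apply: (@local_open A m) => z z' e; rewrite /O /mkset e.
  by move/windowP: e => /(_ 0 (leq0n _)) ->.
- move=> m m' mm z h [h1 h2]; apply: h; split=> //; apply: lang_infix h1.
  by rewrite !window_seg; apply: infix_seg; lia.
- move=> z _; apply: contrapT => h; apply: hn.
  have h' m : lang sigma (Ac i) (window z m) /\ z 0 \in Dl i.
    by apply: contrapT => h1; apply: h; exists m.
  by exists z; [move=> m _; have [] := h' m | have [] := h' 0%N].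
have [a aD] := Ac_new hpc hi.
have [M hM] := nD_sp_large sB sC k0 prim grow (m.*2.+1).
have lt := hM M.+1 a (leqnSn M) aD.
have lt' : (m < count (mem (Dl i)) (sp M.+1 a))%N by move: lt; clear; lia.
have [u [d [v [ew dD' eu]]]] := split_count lt'; have dD : d \in Dl i := dD'.
set l := size u.
have ml : (m <= l)%N by rewrite -eu count_size.
have lm : (l + m < size (sp M.+1 a))%N.
  move: lt (count_size (mem (Dl i)) v); rewrite ew count_cat size_cat /= dD eu.
  by rewrite -/l; clear; lia.
(* Outside the window of radius [m] the values of [z] are arbitrary. *)
pose z : fullshift A := fun r : int => nth a (sp M.+1 a) (absz (r + l%:Z)%R).
apply: (hm z I); split; last by rewrite /z add0r ew nth_cat ltnn subnn.
apply: (@lang_infix _ _ _ _ (sp M.+1 a)); last by apply: lang_sp => //; exact: memDB aD.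
rewrite (_ : window z m = take m.*2.+1 (drop (l - m) (sp M.+1 a))).
  by apply: infix_trans (suffixW (suffix_drop _ _)); exact: prefixW (prefix_take _ _).
apply: (@eq_from_nth _ a); rewrite /window.
  by rewrite size_map size_iota size_takel // size_drop; lia.
move=> r; rewrite size_map size_iota => rm.
rewrite (nth_map 0%N) ?size_iota // nth_iota // nth_take // nth_drop /z.
by congr (nth a _ _); lia.
Qed.

(** Density of orbits puts a new letter into every point of [X i]. Conversely, a point [z] with a
    new letter has a shift close to [p]. That shift is a limit of shifts of [p] lying in a compact
    neighbourhood of [p] in [X i], hence belongs to it, so [z] is in none of the excluded orbits. *)
Lemma component_new_letterE i k : (1 <= i <= n)%N -> (0 < k)%N -> X i !=set0 ->
  (forall a b, a \in Dl i -> b \in Ac i -> b \in sp k a) ->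
  (forall a, a \in Dl i -> (2 <= count (mem (Dl i)) (sp k a))%N) ->
  X i = [set z | XS i z /\ exists j : int, z j \in Dl i].
Proof.
move=> hi k0 [p Xp] prim grow; have sB := Ac_stable hpc hi.
have sC := Ac_stable_pred hpc hi.
have [z0 Xz0 z0D] := point_with_new_letter hi k0 prim grow.
have [XE _] := dec_X hdec hi (ex_intro _ p Xp).
apply/seteqP; split=> [z Xz|z [Xz [j zj]]].
  split; first by have [] := component_sub hi Xz.
  have [s /windowP/(_ 0 (leqnn _)) e] := component_dense 0 hi Xz Xz0.
  by exists s; move: z0D; rewrite -e /sh add0r.
rewrite XE; split=> // -[Xz'|[j1 hj1 zx]].
  have := lang_all sC (Xz' (absz j).+1 isT) => /allP h.
  have : z j \in Ac i.-1.
    apply: h; rewrite window_seg; apply/mapP; exists (absz (j + (absz j).+1%:Z)).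
      by rewrite mem_iota; lia.
    by congr (z _); lia.
  by move: zj; rewrite inE => /andP[/negP].
have lcX := dec_lcX hdec hi.
pose p0 : X i := exist (fun z' => z' \in X i) p (mem_set Xp).
have [U nU [cU clU]] := lcX p0 I.
have [m hm] : exists m, forall p', X i p' -> window p' m = window p m ->
    (\val @` U) p'.
  have /nbhs_subP[m hm] : nbhs p0 [set q : X i | [set: X i] q -> U q] := nU.
  exists m => p' Xp' e.
  by exists (exist (fun z' => z' \in X i) p' (mem_set Xp')) => //; exact: hm.
have cV : compact (\val @` U).
  apply: continuous_compact => //; apply: continuous_subspaceT; exact: initial_continuous.
have [Xp' _] := component_sub hi Xp.
have [s es] : exists s, window (sh z s) m = window p m.
  have [|s es] := point_dense sB sC k0 prim Xz zj (w := window p m.+1).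
    exact: Xp'.
  exists (s + m.+1%:Z); apply: (@window_le _ _ _ m m.+1) => //.
  rewrite es size_map size_iota [LHS]window_seg seg_sh; congr (seg z _ _); lia.
have Xzs : XS i (sh z s) by exact: subshift_sh.
have : X i (sh z s).
  suff [q _ <-] : (\val @` U) (sh z s) by exact: set_valP.
  apply: (compact_closure cV) => P /nbhs_windowP[m' hm'].
  have [t et] := component_dense (maxn m m') hi Xp Xzs.
  exists (sh p t); split; last by apply: hm'; apply: window_le et; exact: leq_maxr.
  apply: hm; first exact: component_sh.
  by rewrite -es; apply: window_le et; exact: leq_maxl.
move=> Xs; have : (X i `&` x_orbits N x i) (sh z s).
  split=> //; exists j1 => //; case: zx => r ->; exists (r + s).
  by apply/funext => t; rewrite /sh; congr (x i j1 _); ring.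
by rewrite (dec_disjXx hdec hi).
Qed.

Lemma single_new_letter_isolated i p b u v : (1 <= i <= n)%N -> X i p ->
  Dl i = [set b]%SET -> sigma b = u ++ b :: v ->
  all (mem (Ac i.-1)) u -> all (mem (Ac i.-1)) v ->
  (2 <= i)%N /\ exists M, forall s, window (sh p s) M = window p M -> s = 0.
Proof.
move=> hi Xp Db sb uC vC; have sB := Ac_stable hpc hi; have sC := Ac_stable_pred hpc hi.
have [XSp nXSp] := component_sub hi Xp.
have bD : b \in Dl i by rewrite Db inE.
have bC : b \notin Ac i.-1 by move: bD; rewrite inE => /andP[].
have BE a : a \in Ac i -> a = b \/ a \in Ac i.-1.
  move=> aB; have [aC|aC] := boolP (a \in Ac i.-1); [by right | left].
  have : a \in Dl i by rewrite inE aC.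
  by rewrite Db inE => /eqP.
have i2 : (2 <= i)%N.
  (* On the first level [u] and [v] would be empty and every [sp j b] the single letter [b], leaving
     no word of length 3. *)
  rewrite ltnNge; apply/negP => i1; have e1 : i = 1%N by move: hi i1; clear; lia.
  move: (XSp 1%N isT) uC vC BE bC; rewrite {}e1 /= (pc_bottom hpc) => -[m [a [_ aA wa]]] uC vC BE _.
  have u0 : u = [::] by case: (u) uC => // c u' /=; rewrite inE.
  have v0 : v = [::] by case: (v) vC => // c v' /=; rewrite inE.
  have [ab|] := BE a aA; last by rewrite inE.
  have sp1 j : sp j b = [:: b].
    by elim: j => // j /= ->; rewrite /subst_word /= cats0 sb u0 v0.
  by have := size_infix wa; rewrite ab sp1 window_seg size_seg.
split=> //; have hi1 : (1 <= i.-1 <= n)%N by move: hi i2; clear; lia.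
have hn1 : (1 <= 1 <= n)%N by move: hi; clear; lia.
have [s0 s0D] := Ac_new hpc hn1; have s0A := memDB s0D.
have C0 : exists a, a \in Ac i.-1.
  exists s0; apply: (fintype.subsetP (Ac_mono hpc _)) s0A; exact: hi1.
have lf c : c \in Ac i.-1 -> _ := long_or_fixed hpc hi1 s0A (c := c).
have [[j pj]|nb] := pselect (exists j : int, p j = b).
  exists (absz j); exact: (new_letter_isolated sC bC BE uC vC sb XSp pj).
(* Fixed points of the shift above the first level are listed among the [x i j], so [p] is not
   constant. *)
have [t pt] : exists t, p t != p (t + 1).
  apply: contrapT => hn; apply: (dec_fixed hdec (i := i) (z := p)) => //.
    by move: hi i2; clear; lia.
  apply/funext => t; apply: contrapT => ht; apply: hn; exists t.
  by apply/eqP => e; apply: ht; rewrite /Tshift e.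
have [m0 pm] : exists m0, ~ lang sigma (Ac i.-1) (window p m0).
  by apply: contrapT => hn; apply: nXSp => m _; apply: contrapT => h; apply: hn; exists m.
have nb' (r : int) : p r != b by apply/eqP => pr; apply: nb; exists r.
exact: (flank_isolated C0 bC BE uC vC sb lf XSp nb' pt pm).
Qed.

(** Some shift of [z] agrees with [p] on the isolating window. It is a limit of shifts of [p], and
    those that agree with it on that window are [p] itself; so it equals [p]. *)
Lemma isolated_component i p M : (1 <= i <= n)%N -> X i p ->
  (forall s, window (sh p s) M = window p M -> s = 0) -> X i = Torbit p.
Proof.
move=> hi Xp iso; apply/seteqP; split=> [z Xz|z [s ->]]; last exact: component_sh.
have [Xp' _] := component_sub hi Xp.
have [s es] := component_dense M hi Xz Xp'.
suff e : sh z s = p.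
  exists (- s); rewrite -[RHS]/(sh p (- s)) -e shD addrC.
  by rewrite ?addNr ?addrN sh0.
have Xzs := component_sh s hi Xz; have [Xzs' _] := component_sub hi Xzs.
apply/funext => j; have [t et] := component_dense (maxn M (absz j)) hi Xp Xzs'.
have t0 : t = 0.
  by apply: iso; rewrite -es; apply: window_le et; exact: leq_maxl.
have /windowP/(_ j (leqnn _)) : window (sh p t) (absz j) = window (sh z s) (absz j).
  by apply: window_le et; exact: leq_maxr.
by rewrite t0 sh0.
Qed.

(** The matrix of this level is (1), so its [theta] is 1, and the level below has [theta] at least
    1. *)
Lemma theta_single i b u v : (1 <= i <= n)%N -> (2 <= i)%N ->
  Dl i = [set b]%SET -> sigma b = u ++ b :: v ->
  all (mem (Ac i.-1)) u -> all (mem (Ac i.-1)) v ->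
  theta sigma Ac R i <= lambda_max sigma Ac R i.-1.
Proof.
move=> hi i2 Db sb uC vC; have [h [th0 h0 h1 hth]] := theta_eigenvector R hpc hi.
have bD : b \in Dl i by rewrite Db inE.
have z w : all (mem (Ac i.-1)) w -> \sum_(c <- w) h c = 0.
  move=> /allP wC; rewrite big_seq big1 // => c /wC cC; apply: h1.
  by rewrite inE; move: cC => /= ->.
have -> : theta sigma Ac R i = 1.
  have := hth b bD; rewrite sb big_cat big_cons /= !z // add0r addr0 => e.
  by apply: (mulIf (lt0r_neq0 (h0 b bD))); rewrite mul1r -e.
have hi1 : (1 <= i.-1 <= n)%N by move: hi i2; clear; lia.
apply: le_trans (theta_ge1 R hpc hi1) _.
rewrite /lambda_max (@le_bigmax_seq _ _ _ _ _ i.-1) //.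
by rewrite mem_index_iota; move: hi1; clear; lia.
Qed.

Theorem component_invariant_measure i (p : X i) : (1 <= i <= n)%N ->
  exists mu : {measure set (borel p) -> \bar R},
    [/\ nonzero_invariant_radon (@Tshift_on A (X i)) mu,
        (forall nu : {measure set (borel p) -> \bar R},
          nonzero_invariant_radon (@Tshift_on A (X i)) nu ->
          exists2 c : R, 0 < c &
            forall B, measurable B -> nu B = (c%:E * mu B)%E),
        ergodic (@Tshift_on A (X i)) mu,
        (theta sigma Ac R i > lambda_max sigma Ac R i.-1 -> (mu setT < +oo)%E) &
        (theta sigma Ac R i <= lambda_max sigma Ac R i.-1 -> mu setT = +oo%E)].
Proof.
move=> hi; have Xp : X i (\val p) := set_valP p.
have [[k [k0 prim grow]]|[b [u [v [Db sb uC vC]]]]] := new_letter_cases hpc hi.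
  have YE := component_new_letterE hi k0 (ex_intro _ _ Xp) prim grow.
  have sB := Ac_stable hpc hi; have sC := Ac_stable_pred hpc hi.
  have [mu [h1 h2 h3 h4 h5]] := component_measure R sB sC k0 prim grow p YE.
  exists mu; split=> // [lt|le]; first by apply: h4; exact: (length_ratio_bounded hpc hi lt).
  by apply: h5 => c; exact: (length_ratio_unbounded hpc c hi le).
have [i2 [M iso]] := single_new_letter_isolated hi Xp Db sb uC vC.
have XE := isolated_component hi Xp iso.
exists (counting_measure R p); split.
- exact: (counting_nonzero_invariant_radon R XE iso).
- exact: (counting_unique XE iso).
- exact: (ergodic_counting R XE p).
- by rewrite ltNge (theta_single hi i2 Db sb uC vC).
- move=> _; exact: (counting_setT R XE iso).
Qed.

(** A finite orbit has a nonzero period, and the decomposition makes a shift-periodic [x i j]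
    constant. *)
Lemma fixed_orbit_counting i j : (2 <= i <= n)%N -> (1 <= j <= N i)%N ->
  (counting_measure R (Torbit_base (x i j)) setT < +oo)%E <-> Tshift (x i j) = x i j.
Proof.
move=> hi hj; set q := x i j; have hi' : (1 <= i <= n)%N by move: hi; clear; lia.
split=> [fin|fix_q].
  have [_ hx] := dec_x hdec hi' hj.
  have fY : finite_set [set: Torbit q].
    by apply: contrapT => nf; move: fin; rewrite /counting_measure /= /counting asboolF.
  have [s s0 es] : exists2 s, s != 0 & sh q s = q.
    apply: contrapT => hn; apply: (infinite_orbit (erefl (Torbit q)) _ fY) => s es.
    by apply/eqP; apply: contraT => s0; case: hn; exists s.
  have [k k0 ek] : exists2 k, (0 < k)%N & sh q k%:Z = q.
    exists (absz s); first by rewrite absz_gt0.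
    have [s_ge|s_lt] := lerP 0 s; first by rewrite gez0_abs.
    rewrite ltz0_abs // -{1}es shD.
    by rewrite ?addNr ?addrN sh0.
  have itE m : iter m (@Tshift A) q = sh q m%:Z.
    elim: m => [|m IH]; first by rewrite sh0.
    by rewrite iterS IH; apply/funext => r; rewrite /Tshift /sh; congr (q _); lia.
  have [|s1 [_ e]] := hx; first by exists k => //; rewrite itE.
  by rewrite /q e.
have orb z : Torbit q z -> z = q.
  move=> [m ->]; rewrite -[LHS]/(sh q m).
  have qs r : q (r + 1) = q r by rewrite -[in RHS]fix_q.
  apply/funext => r; rewrite /sh; elim/int_ind: m => [|m IH|m IH]; first by rewrite addr0.
    by rewrite -IH -[RHS]qs; congr (q _); lia.
  by rewrite -IH -[LHS]qs; congr (q _); lia.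
rewrite /counting_measure /= /counting asboolT ?ltry //.
apply: sub_finite_set (finite_set1 (Torbit_base q)) => z _; apply: val_inj.
by rewrite /= (orb _ (set_valP z)).
Qed.

(** The only new letter of [q] stands at coordinate 0, so [q] has no nonzero period. *)
Lemma primitive_orbit_counting i q : (2 <= i <= n)%N -> y i = Some q ->
  counting_measure R (Torbit_base q) setT = +oo%E.
Proof.
move=> hi yq; have hi' : (1 <= i <= n)%N by move: hi; clear; lia.
have [_ _ hq] := dec_y hdec hi' yq.
rewrite /counting_measure /= /counting asboolF //.
apply: (infinite_orbit (erefl (Torbit q))) => s es.
apply/hq; rewrite -[s]add0r -[X in X \in _]/(sh q s 0) es.
exact/hq.
Qed.

End Decomposed.

Theorem theorem5p5 (R : realType) (A : finType) (sigma : A -> seq A)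
    (n : nat) (Ac : nat -> {set A})
    (X : nat -> set (fullshift A)) (y : nat -> option (fullshift A))
    (N : nat -> nat) (x : nat -> nat -> fullshift A)
    (hA : (1 < #|A|)%N)
    (hsigma : substitution sigma)
    (hpc : primitive_components sigma n Ac)
    (hn : (2 <= n)%N)
    (hdec : decomposition sigma n Ac X y N x) :
  [/\ forall i j : nat, (2 <= i <= n)%N -> (1 <= j <= N i)%N ->
        let m := counting_measure R (Torbit_base (x i j)) in
        ergodic (@Tshift_on A (Torbit (x i j))) m /\
        ((m setT < +oo)%E <-> Tshift (x i j) = x i j),
      forall (i : nat) (q : fullshift A), (2 <= i <= n)%N -> y i = Some q ->
        let m := counting_measure R (Torbit_base q) in
        ergodic (@Tshift_on A (Torbit q)) m /\ m setT = +oo%E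
    & forall i : nat, (1 <= i <= n)%N -> forall p : X i,
        exists mu : {measure set (borel p) -> \bar R},
          [/\ nonzero_invariant_radon (@Tshift_on A (X i)) mu,
              (forall nu : {measure set (borel p) -> \bar R},
                nonzero_invariant_radon (@Tshift_on A (X i)) nu ->
                exists2 c : R, 0 < c &
                  forall B, measurable B -> nu B = (c%:E * mu B)%E),
              ergodic (@Tshift_on A (X i)) mu,
              (theta sigma Ac R i > lambda_max sigma Ac R i.-1 ->
                (mu setT < +oo)%E) &
              (theta sigma Ac R i <= lambda_max sigma Ac R i.-1 ->
                mu setT = +oo%E)]].
Proof.
split=> [i j hi hj m|i q hi yq m|i hi p].
- split; first exact: (ergodic_counting R (erefl (Torbit (x i j)))).
  exact: (fixed_orbit_counting R hdec hi hj).
- split; first exact: (ergodic_counting R (erefl (Torbit q))).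
  exact: (primitive_orbit_counting R hdec hi yq).
- exact: (component_invariant_measure R hpc hdec p hi).
Qed.
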